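(* Let $\lambda > 0$ and define $\lambda_0^U := \pi^2$. Let $\mathcal E^U_\lambda(\Omega) = \mathcal H^1(\partial \Omega) - \frac{\lambda}{\mathcal I_1(\Omega)}$. Then: (i) If $\lambda < \lambda_0^U$, we have $\inf_{\Omega \in \mathcal A} \mathcal E^U_\lambda(\Omega) = 0$, and the infimum is not attained. (ii) If $\lambda = \lambda_0^U$, then $\inf_{\Omega \in \mathcal A} \mathcal E^U_\lambda(\Omega) = 0$, and the infimum is attained by any closed ball and no other set. (iii) If $\lambda > \lambda_0^U$, we have $\inf_{\Omega \in \mathcal A} \mathcal E^U_\lambda(\Omega) = -\infty$.
   Context: $\mathcal H^1$ is the one-dimensional Hausdorff measure, $\partial\Omega$ is the topological boundary and $|\Omega|$ the Lebesgue measure of $\Omega\subset\mathbb R^2$. Balls are balls in $\mathbb R^2$ of positive radius. The Riesz capacitary energy is $\mathcal I_1(\Omega):=\inf\left\{\int_\Omega \int_\Omega \frac{d\mu(x)\,d\mu(y)}{|x-y|} : \mu(\Omega)=1\right\}$, the infimum being over probability measures $\mu$ supported on $\Omega$. For $A,B\subset\mathbb R^2$ write $A\sim B$ if $\mathcal H^1(A\setminus B)=\mathcal H^1(B\setminus A)=0$. The admissible class is $\mathcal A := \{ \Omega \subset \mathbb R^2 : \Omega \text{ compact}, |\Omega| > 0, \mathcal H^1(\partial \Omega) < \infty \}/\sim$. Sets in $\mathcal A$ are identified when equivalent under $\sim$; in particular, uniqueness and equality of sets are understood modulo $\sim$. *)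

(* Defs.v *)
From mathcomp Require Import all_boot all_order all_algebra.
From mathcomp Require Import all_classical all_reals all_analysis.

Set Implicit Arguments.
Unset Strict Implicit.
Unset Printing Implicit Defensive.

Import Order.TTheory GRing.Theory Num.Theory.
Import numFieldNormedType.Exports.

Local Open Scope classical_set_scope.
Local Open Scope ring_scope.
Local Open Scope ereal_scope.

(* The plane is R * R. The library norm on a product is the sup norm, hence the
   explicit Euclidean distance. The product topology and the product
   sigma-algebra are the Euclidean topology and its Borel sigma-algebra. *)
Definition eucl_dist (R : realType) (x y : R * R) : R :=
  Num.sqrt ((x.1 - y.1) ^+ 2 + (x.2 - y.2) ^+ 2)%R.

Definition eucl_cball (R : realType) (c : R * R) (r : R) : set (R * R) :=
  [set x | (eucl_dist c x <= r)%R].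

(* The added 0 only serves to give the empty set diameter 0. *)
Definition eucl_diam (R : realType) (A : set (R * R)) : \bar R :=
  ereal_sup ([set 0] `|`
             [set (eucl_dist xy.1 xy.2)%:E | xy in A `*` A]).

Definition hausdorff1_pre (R : realType) (delta : R) (A : set (R * R)) :
    \bar R :=
  ereal_inf [set \sum_(0 <= i <oo) eucl_diam (F i) |
    F in [set F : nat -> set (R * R) |
            A `<=` \bigcup_i F i /\
            forall i, eucl_diam (F i) <= delta%:E]].

(* In dimension one the usual normalisation constant is 1: segments have their
   length as measure. This is an outer measure, defined on all sets. *)
Definition hausdorff1 (R : realType) (A : set (R * R)) : \bar R :=
  ereal_sup [set hausdorff1_pre delta A | delta in [set d : R | (0 < d)%R]].

Definition boundary (T : topologicalType) (A : set T) : set T :=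
  closure A `\` A°.

Definition area (R : realType) (A : set (R * R)) : \bar R :=
  (@lebesgue_measure R \x @lebesgue_measure R) A.

(* Extended inverse: the kernel is +oo on the diagonal, since 0^-1 = +oo. *)
Definition riesz_kernel (R : realType) (x y : R * R) : \bar R :=
  (eucl_dist x y)%:E^-1.

Definition riesz_energy (R : realType) (Omega : set (R * R)) : \bar R :=
  ereal_inf [set \int[mu]_(x in Omega) \int[mu]_(y in Omega) riesz_kernel x y |
    mu in [set mu : probability (R * R)%type R | mu Omega = 1]].

(* Omega is a representative of a class of the admissible class modulo
   H1_equiv. Equivalent admissible sets have the same interior, so their
   boundaries differ by an H^1-null set; and H^1-null sets are not charged by
   measures of finite energy. So the functional below does not depend on the
   representative, and its infimum over classes is the one over
   representatives. *)
Definition admissible (R : realType) (Omega : set (R * R)) : Prop :=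
  [/\ compact Omega, 0 < area Omega & hausdorff1 (boundary Omega) < +oo].

Definition H1_equiv (R : realType) (A B : set (R * R)) : Prop :=
  hausdorff1 (A `\` B) = 0 /\ hausdorff1 (B `\` A) = 0.

Definition functional (R : realType) (lambda : R) (Omega : set (R * R)) :
    \bar R :=
  hausdorff1 (boundary Omega) - lambda%:E / riesz_energy Omega.

Definition inf_functional (R : realType) (lambda : R) : \bar R :=
  ereal_inf [set functional lambda Omega | Omega in @admissible R].

Definition minimizer (R : realType) (lambda : R) (Omega : set (R * R)) : Prop :=
  admissible Omega /\ functional lambda Omega = inf_functional lambda.

Definition lambda0U (R : realType) : R := (@pi R ^+ 2)%R.

(* Main.v *)
Require Import Defs.
From HB Require Import structures.
From mathcomp Require Import all_boot all_order all_algebra.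
From mathcomp Require Import all_classical all_reals all_analysis.
From mathcomp Require Import measurable_realfun ring lra.

Set Implicit Arguments.
Unset Strict Implicit.
Unset Printing Implicit Defensive.

Import Order.TTheory GRing.Theory Num.Theory.
Import numFieldNormedType.Exports.

Local Open Scope classical_set_scope.
Local Open Scope ring_scope.

(** Everything rests on integral geometry. A line is encoded by a pair [(t, p)]
    and consists of the points [x] with [dot x (dir t) = p]; the measure
    [dt dp] on lines is [leb2].

    Energy. The measure of the lines that pass within distance [h] of two points
    [x] and [y], divided by [(2 h)^2], tends to [1 / |x - y|] as [h] tends to 0
    ([cvg_strip_kernel]). The energy of a measure [mu] is therefore the limit of
    the integrals, over all lines, of the squared density of the projection of
    [mu] along the line ([strip_energyE]). The inequality
    [2 q g <= q^2 + g^2] then bounds the energy from below by means of any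
    function [q] on lines whose average over the lines through a point of the
    set is a constant [J]: the energy is at least [2 J] minus the integral of
    [q^2] ([energy_test]). Such tests are made on the lines that meet the
    interior of the set; this suffices because a measure of finite energy does
    not charge a boundary of finite length ([finite_energy_null]). With [q]
    constant and [W] the measure of the lines that meet the interior, the
    capacitary energy is at least [pi^2 / W] ([riesz_energy_ge_lines]).

    Perimeter. A line that meets the interior crosses the boundary at least
    twice, hence [W <= H], where [H] is the length of the boundary
    ([lines_le_hausdorff]). The boundary may be very irregular, so the indicator
    of the set is mollified: covers of the boundary bound the total variation of
    the mollified function by [H] ([integral_norm_flux2]), while its variation
    along a line counts the crossings. Lines that leave the set and meet it
    again cross four times and improve the inequality by their own measure.

    Together, [functional lambda] is at least [H (1 - lambda / pi^2)]
    ([functional_ge]). On a disc of radius [r] it is at most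
    [(2 r / pi) (pi^2 - lambda)] ([functional_le_disc]), since a suitable
    probability on the disc has uniform projections and hence energy at most
    [pi / (2 r)] ([energy_disc_measure]). Letting [r] tend to 0 or to infinity
    gives the infimum in each regime, and for [lambda < pi^2] the lower bound is
    positive on every admissible set.

    Equality. At [lambda = pi^2], a minimizer satisfies [H = W] and has
    capacitary energy [pi^2 / W]. The first equality says that almost no line
    leaves the set and comes back, so the interior is convex
    ([optimal_convex]). The second one says that no test improves on the
    constant one. Testing with the inverse of the width shows that the width is
    constant ([optimal_width]); then perturbing the constant test by the part of
    the midpoints of the projections that is orthogonal to [cos] and [sin] shows
    that these midpoints are the projections of one point ([optimal_midpoint]).
    Hence the interior is a disc, whose circle already accounts for all of [H],
    and the rest of the set has no length ([optimal_H1_equiv]). *)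

(** * The Euclidean plane *)

Section Plane.
Context {R : realType}.
Implicit Types (u v x y z : R * R) (a b t r : R).

Definition norm2 v : R := Num.sqrt (v.1 ^+ 2 + v.2 ^+ 2).
Definition dot u v : R := u.1 * v.1 + u.2 * v.2.
Definition dir (t : R) : R * R := (cos t, sin t).
Definition rot90 v : R * R := (- v.2, v.1).

Lemma eucl_distE x y : eucl_dist x y = norm2 (x - y).
Proof. by []. Qed.

Lemma norm2_ge0 v : 0 <= norm2 v.
Proof. exact: sqrtr_ge0. Qed.

Lemma sqr_norm2 v : norm2 v ^+ 2 = v.1 ^+ 2 + v.2 ^+ 2.
Proof. by rewrite sqr_sqrtr// addr_ge0// sqr_ge0. Qed.

Lemma norm2_le v r : 0 <= r -> (norm2 v <= r) = (v.1 ^+ 2 + v.2 ^+ 2 <= r ^+ 2).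
Proof. by move=> r0; rewrite -sqr_norm2 ler_sqr// nnegrE norm2_ge0. Qed.

Lemma normr_dot u v : `|dot u v| <= norm2 u * norm2 v.
Proof.
rewrite -ler_sqr ?nnegrE ?normr_ge0 ?mulr_ge0 ?norm2_ge0//.
rewrite real_normK ?num_real// exprMn !sqr_norm2 /dot.
have := sqr_ge0 (u.1 * v.2 - u.2 * v.1); nra.
Qed.

Lemma norm2N v : norm2 (- v) = norm2 v.
Proof. by rewrite /norm2/= !sqrrN. Qed.

Lemma norm2D u v : norm2 (u + v) <= norm2 u + norm2 v.
Proof.
rewrite norm2_le ?addr_ge0 ?norm2_ge0//=.
have := normr_dot u v; rewrite ler_norml => /andP[_].
by have := sqr_norm2 u; have := sqr_norm2 v; rewrite /dot; nra.
Qed.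

Lemma norm2Z a v : norm2 (a *: v) = `|a| * norm2 v.
Proof.
apply/eqP; rewrite -(@eqrXn2 _ 2)// ?mulr_ge0 ?norm2_ge0 ?normr_ge0//.
by rewrite exprMn !sqr_norm2/= real_normK ?num_real// /GRing.scale/= !exprMn mulrDr.
Qed.

Lemma norm2_eq0 v : norm2 v = 0 -> v = 0.
Proof.
move=> v0; have := sqr_norm2 v; rewrite v0 expr0n/= => /esym/eqP.
rewrite paddr_eq0 ?sqr_ge0// !sqrf_eq0 => /andP[/eqP v1 /eqP v2].
by case: v v1 v2 {v0} => ? ? /= -> ->.
Qed.

Lemma norm20 : norm2 0 = 0.
Proof. by rewrite /norm2/= expr0n/= addr0 sqrtr0. Qed.

Lemma norm2_gt0 v : v != 0 -> 0 < norm2 v.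
Proof.
move=> v0; rewrite lt0r norm2_ge0 andbT; apply: contra v0 => /eqP/norm2_eq0 ->.
by [].
Qed.

Lemma norm_fst_le v : `|v.1| <= norm2 v.
Proof.
rewrite -ler_sqr ?nnegrE ?normr_ge0 ?norm2_ge0//.
by rewrite real_normK ?num_real// sqr_norm2 lerDl sqr_ge0.
Qed.

Lemma norm_snd_le v : `|v.2| <= norm2 v.
Proof.
rewrite -ler_sqr ?nnegrE ?normr_ge0 ?norm2_ge0//.
by rewrite real_normK ?num_real// sqr_norm2 lerDr sqr_ge0.
Qed.

Lemma norm2_le_sum v : norm2 v <= `|v.1| + `|v.2|.
Proof.
rewrite norm2_le ?addr_ge0//.
have := normr_ge0 v.1; have := normr_ge0 v.2.
have -> : v.1 ^+ 2 = `|v.1| ^+ 2 by rewrite real_normK ?num_real.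
have -> : v.2 ^+ 2 = `|v.2| ^+ 2 by rewrite real_normK ?num_real.
by nra.
Qed.

Lemma eucl_dist_ge0 x y : 0 <= eucl_dist x y.
Proof. by rewrite eucl_distE norm2_ge0. Qed.

Lemma eucl_distC x y : eucl_dist x y = eucl_dist y x.
Proof. by rewrite !eucl_distE -norm2N opprB. Qed.

Lemma eucl_dist_triangle y x z : eucl_dist x z <= eucl_dist x y + eucl_dist y z.
Proof. by rewrite !eucl_distE -(subrKA y) norm2D. Qed.

Lemma eucl_distxx x : eucl_dist x x = 0.
Proof. by rewrite eucl_distE subrr norm20. Qed.

Lemma eucl_dist_gt0 x y : x != y -> 0 < eucl_dist x y.
Proof. by move=> xy; rewrite eucl_distE norm2_gt0// subr_eq0. Qed.

Lemma norm2_dir t : norm2 (dir t) = 1.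
Proof. by rewrite /norm2/= cos2Dsin2 sqrtr1. Qed.

Lemma norm2_rot90 v : norm2 (rot90 v) = norm2 v.
Proof. by rewrite /norm2/= sqrrN addrC. Qed.

Lemma dotC u v : dot u v = dot v u.
Proof. by rewrite /dot; ring. Qed.

Lemma dotBl u v z : dot (u - v) z = dot u z - dot v z.
Proof. by rewrite /dot/=; ring. Qed.

Lemma dotDl u v z : dot (u + v) z = dot u z + dot v z.
Proof. by rewrite /dot/=; ring. Qed.

Lemma dotZl a v z : dot (a *: v) z = a * dot v z.
Proof. by rewrite /dot/= /GRing.scale/=; ring. Qed.

Lemma normr_dot_dir v t : `|dot v (dir t)| <= norm2 v.
Proof. by rewrite (le_trans (normr_dot _ _))// norm2_dir mulr1. Qed.

(** Every vector is a signed multiple of a direction of the upper half circle;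
    the sign makes half a turn enough. *)
Lemma polar v : exists t r,
  [/\ 0 <= t <= pi, `|r| = norm2 v & v = r *: dir t].
Proof.
have [->|v0] := eqVneq v 0.
  exists 0, 0; split; rewrite ?lexx ?pi_ge0 ?normr0 ?norm20//.
  by rewrite scale0r.
wlog v2 : v v0 / 0 <= v.2.
  move=> W; have [|v2] := leP 0 v.2; first exact: W.
  have [||t [r [t01 rE vE]]] := W (- v).
  - by rewrite oppr_eq0.
  - by rewrite /= oppr_ge0 ltW.
  exists t, (- r); split => //; first by rewrite normrN rE norm2N.
  by rewrite scaleNr -vE opprK.
have n0 := norm2_gt0 v0.
have v1b : -1 <= v.1 / norm2 v <= 1.
  by rewrite -ler_norml normrM normfV (gtr0_norm n0) ler_pdivrMr// mul1r norm_fst_le.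
exists (acos (v.1 / norm2 v)), (norm2 v); split.
- by rewrite acos_ge0// acos_lepi.
- by rewrite ger0_norm// ltW.
- rewrite /dir acosK ?in_itv//= sin_acos//.
  have nn0 : norm2 v != 0 by rewrite gt_eqF.
  have -> : 1 - (v.1 / norm2 v) ^+ 2 = (v.2 / norm2 v) ^+ 2.
    rewrite !exprMn exprVn -[X in X - _](@divff _ (norm2 v ^+ 2)) ?expf_neq0//.
    by rewrite -mulrBl sqr_norm2 addrAC subrr add0r.
  rewrite sqrtr_sqr ger0_norm ?divr_ge0 ?norm2_ge0//.
  have -> : norm2 v *: (v.1 / norm2 v, v.2 / norm2 v) =
      (norm2 v * (v.1 / norm2 v), norm2 v * (v.2 / norm2 v)) by [].
  by rewrite !(mulrC (norm2 v)) !divfK// -surjective_pairing.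
Qed.

Lemma nbhs_euclP x (A : set (R * R)) :
  nbhs x A <-> exists2 r, 0 < r & forall y, eucl_dist x y < r -> A y.
Proof.
split.
- move=> /nbhs_ballP[r /= r0 rA]; exists r => // y xy; apply: rA; split => /=.
  + by rewrite -ball_normE/=; apply: le_lt_trans xy; exact: (norm_fst_le (x - y)).
  + by rewrite -ball_normE/=; apply: le_lt_trans xy; exact: (norm_snd_le (x - y)).
- move=> [r r0 rA]; apply/nbhs_ballP; exists (r / 2) => /=; first by rewrite divr_gt0.
  move=> y [] /=; rewrite -!ball_normE/= => y1 y2; apply: rA.
  by rewrite eucl_distE (le_lt_trans (norm2_le_sum _))//= [ltRHS]splitr ltrD.
Qed.

Lemma open_euclP (U : set (R * R)) :
  open U <-> forall x, U x -> exists2 r, 0 < r & forall y, eucl_dist x y < r -> U y.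
Proof.
split=> [oU x Ux|h].
  by apply/nbhs_euclP; exact: open_nbhs_nbhs.
by rewrite openE => x /h/nbhs_euclP.
Qed.

End Plane.

(** * Measurability in the plane *)

Section Measurability.
Context {R : realType}.

Lemma open_measurable_plane (U : set (R * R)) : open U -> measurable U.
Proof.
move=> oU.
pose box (q : rat * rat * nat) : set (R * R) :=
  ball (ratr q.1.1 : R) (q.2.+1%:R^-1) `*` ball (ratr q.1.2 : R) (q.2.+1%:R^-1).
pose F q := if `[< box q `<=` U >] then box q else set0.
have -> : U = \bigcup_q F q.
  apply/seteqP; split => [x Ux|x [q _]]; last first.
    by rewrite /F; case: asboolP => // + bx; exact.
  have /nbhs_ballP[r /= r0 rU] : nbhs x U by exact: open_nbhs_nbhs.
  have [n nr] : exists n, n.+1%:R^-1 < r / 2.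
    have r20 : 0 < r / 2 by rewrite divr_gt0.
    have [n _ /(_ n (leqnn n)) /= h] := near_infty_natSinv_lt (PosNum r20).
    by exists n.
  have e0 : (0 : R) < n.+1%:R^-1 by rewrite invr_gt0.
  have [q1 q1x] : exists q : rat, ball x.1 (n.+1%:R^-1) (ratr q : R).
    have [||y [yb [q _ qy]]] := @dense_rat R (ball x.1 n.+1%:R^-1).
    - by exists x.1; exact: ballxx.
    - exact: ball_open.
    by exists q; rewrite qy.
  have [q2 q2x] : exists q : rat, ball x.2 (n.+1%:R^-1) (ratr q : R).
    have [||y [yb [q _ qy]]] := @dense_rat R (ball x.2 n.+1%:R^-1).
    - by exists x.2; exact: ballxx.
    - exact: ball_open.
    by exists q; rewrite qy.
  exists (q1, q2, n) => //; rewrite /F asboolT; first by split; exact: ball_sym.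
  move=> y [/= y1 y2]; apply: rU; split.
  - by apply: (le_ball _ (ball_triangle q1x y1)); rewrite [leRHS]splitr lerD// ltW.
  - by apply: (le_ball _ (ball_triangle q2x y2)); rewrite [leRHS]splitr lerD// ltW.
apply: countable_bigcupT_measurable => // q; rewrite /F; case: ifP => // _.
by apply: measurableX; apply: open_measurable; exact: ball_open.
Qed.

Lemma closed_measurable_plane (A : set (R * R)) : closed A -> measurable A.
Proof.
by move=> /closed_openC/open_measurable_plane/measurableC; rewrite setCK.
Qed.


Lemma continuous_measurable_plane (f : R * R -> R) :
  continuous f -> measurable_fun setT f.
Proof.
move=> /continuousP cf; apply: (measurability _ (RGenOpens.measurableE R)).
move=> _ [_ [a [b ->] <-]]; rewrite setTI; apply: open_measurable_plane.
exact/cf/interval_open.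
Qed.

Lemma measurable_set_ltr d (T : measurableType d) (f g : T -> R) :
  measurable_fun setT f -> measurable_fun setT g ->
  measurable [set x | f x < g x].
Proof.
move=> mf mg; have /(_ measurableT [set true] I) := measurable_fun_ltr mf mg.
by rewrite setTI; congr measurable; apply/seteqP.
Qed.

Lemma measurable_set_ler d (T : measurableType d) (f g : T -> R) :
  measurable_fun setT f -> measurable_fun setT g ->
  measurable [set x | f x <= g x].
Proof.
move=> mf mg; have /(_ measurableT [set true] I) := measurable_fun_ler mf mg.
by rewrite setTI; congr measurable; apply/seteqP.
Qed.

Lemma measurable_cos : measurable_fun [set: R] (@cos R).
Proof. by apply: continuous_measurable_fun => ?; exact: continuous_cos. Qed.

Lemma measurable_sin : measurable_fun [set: R] (@sin R).
Proof. by apply: continuous_measurable_fun => ?; exact: continuous_sin. Qed.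

Lemma measurable_dot d (T : measurableType d) (f g : T -> R * R) :
  measurable_fun setT f -> measurable_fun setT g ->
  measurable_fun setT (fun x => dot (f x) (g x)).
Proof.
move=> mf mg; have m1 (h : T -> R * R) : measurable_fun setT h ->
    measurable_fun setT (fun x => (h x).1) /\ measurable_fun setT (fun x => (h x).2).
  by move=> mh; split; [exact: (measurableT_comp measurable_fst)|
                       exact: (measurableT_comp measurable_snd)].
have [f1 f2] := m1 _ mf; have [g1 g2] := m1 _ mg.
by apply: measurable_funD; exact: measurable_funM.
Qed.

Lemma measurable_dir d (T : measurableType d) (f : T -> R) :
  measurable_fun setT f -> measurable_fun setT (fun x => dir (f x)).
Proof.
move=> mf; apply: measurable_fun_pair.
- exact: (measurableT_comp measurable_cos).
- exact: (measurableT_comp measurable_sin).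
Qed.

Lemma measurable_rot90 d (T : measurableType d) (f : T -> R * R) :
  measurable_fun setT f -> measurable_fun setT (fun x => rot90 (f x)).
Proof.
move=> mf; apply: measurable_fun_pair => /=.
- apply: measurable_funN; exact: (measurableT_comp measurable_snd).
- exact: (measurableT_comp measurable_fst).
Qed.

Lemma measurable_planeD d (T : measurableType d) (f g : T -> R * R) :
  measurable_fun setT f -> measurable_fun setT g ->
  measurable_fun setT (fun x => f x + g x).
Proof.
move=> mf mg; apply: measurable_fun_pair => /=; apply: measurable_funD;
  by [exact: (measurableT_comp measurable_fst)|exact: (measurableT_comp measurable_snd)].
Qed.

Lemma measurable_planeB d (T : measurableType d) (f g : T -> R * R) :
  measurable_fun setT f -> measurable_fun setT g ->
  measurable_fun setT (fun x => f x - g x).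
Proof.
move=> mf mg; apply: measurable_fun_pair => /=; apply: measurable_funB;
  by [exact: (measurableT_comp measurable_fst)|exact: (measurableT_comp measurable_snd)].
Qed.

Lemma measurable_planeZ d (T : measurableType d) (a : T -> R) (f : T -> R * R) :
  measurable_fun setT a -> measurable_fun setT f ->
  measurable_fun setT (fun x => a x *: f x).
Proof.
move=> ma mf; apply: measurable_fun_pair => /=; apply: measurable_funM => //;
  by [exact: (measurableT_comp measurable_fst)|exact: (measurableT_comp measurable_snd)].
Qed.

Lemma measurable_norm2 d (T : measurableType d) (f : T -> R * R) :
  measurable_fun setT f -> measurable_fun setT (fun x => norm2 (f x)).
Proof.
move=> mf; apply: (@measurableT_comp _ _ _ _ _ _ (@Num.sqrt R)).
  by apply: continuous_measurable_fun => ?; exact: sqrt_continuous.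
by apply: measurable_funD; apply: measurable_funX;
  [exact: (measurableT_comp measurable_fst)|exact: (measurableT_comp measurable_snd)].
Qed.

End Measurability.

(** * Lebesgue measure on the line and in the plane *)

Section Leb.
Context {R : realType}.

(** Lebesgue measure, on the Borel sigma-algebra that the real line carries by
    default, so that it can be combined with probabilities on the plane. *)
Definition leb : set R -> \bar R := @lebesgue_measure R.

Let leb0 : leb set0 = 0%E.
Proof. exact: (@measure0 _ _ _ (@lebesgue_measure R)). Qed.

Let leb_ge0 A : (0 <= leb A)%E.
Proof. exact: (@measure_ge0 _ _ _ (@lebesgue_measure R)). Qed.

Let leb_semi_sigma_additive : semi_sigma_additive leb.
Proof. exact: (@measure_semi_sigma_additive _ _ _ (@lebesgue_measure R)). Qed.

HB.instance Definition _ := isMeasure.Build _ _ _ leb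
  leb0 leb_ge0 leb_semi_sigma_additive.

Let leb_sigma_finite : sigma_finite setT leb.
Proof. exact: (@sigma_finiteT _ _ _ (@lebesgue_measure R)). Qed.

HB.instance Definition _ := Measure_isSigmaFinite.Build _ _ _ leb leb_sigma_finite.

Let idR : measurableTypeR R -> R := idfun.
Let measurable_idR : measurable_fun setT idR.
Proof. by move=> _ Y mY; rewrite setTI; exact: mY. Qed.

Local Open Scope ereal_scope.

Lemma ge0_integral_leb (D : set R) (f : R -> \bar R) :
  measurable D -> measurable_fun D f -> (forall x, D x -> 0 <= f x) ->
  \int[leb]_(x in D) f x = \int[@lebesgue_measure R]_(x in D) f x.
Proof.
move=> mD mf f0.
transitivity (\int[pushforward (@lebesgue_measure R) idR]_(x in D) f x).
  by apply: eq_measure_integral.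
by rewrite ge0_integral_pushforward// => x /set_mem; exact: f0.
Qed.

Lemma integral_leb (D : set R) (f : R -> R) :
  measurable D -> measurable_fun D f ->
  \int[leb]_(x in D) (f x)%:E = \int[@lebesgue_measure R]_(x in D) (f x)%:E.
Proof.
move=> mD mf.
rewrite integralE [RHS]integralE; congr (_ - _).
- by rewrite ge0_integral_leb//; apply/measurable_funepos/measurable_EFinP.
- by rewrite ge0_integral_leb//; apply/measurable_funeneg/measurable_EFinP.
Qed.

Lemma leb_itv (i : interval R) :
  leb [set` i] = (if i.1 < i.2 then (i.2 : \bar R) - i.1 else 0).
Proof. exact: lebesgue_measure_itv. Qed.

Definition leb2 : set (R * R) -> \bar R := @leb \x @leb.
HB.instance Definition _ := Measure.on leb2.

Let leb2_sigma_finite : sigma_finite setT leb2.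
Proof.
have /sigma_finiteP[F [TF ndF Foo]] := sigma_finiteT leb.
exists (fun n => F n `*` F n).
  rewrite -setXTT TF predeqE => -[x y]; split.
    move=> [/= [n _ Fnx] [k _ Gky]]; exists (maxn n k) => //; split.
    - by move: x Fnx; exact/subsetPset/ndF/leq_maxl.
    - by move: y Gky; exact/subsetPset/ndF/leq_maxr.
  by move=> [n _ []/= ? ?]; split; exists n.
move=> k; have [? ?] := Foo k.
split; first exact: measurableX.
by rewrite /leb2 product_measure1E// lte_mul_pinfty// ge0_fin_numE.
Qed.

HB.instance Definition _ := Measure_isSigmaFinite.Build _ _ _ leb2 leb2_sigma_finite.

Lemma ge0_integral_leb2 (f : R * R -> \bar R) :
  measurable_fun setT f -> (forall z, 0 <= f z) ->
  \int[leb2]_z f z = \int[leb]_x \int[leb]_y f (x, y).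
Proof. by move=> mf f0; exact: (fubini_tonelli1 f). Qed.

End Leb.

Section Invariance.
Context {R : realType}.
Local Open Scope ereal_scope.

Lemma leb_shift (a : R) (A : set R) : measurable A ->
  leb ((fun x => x + a)%R @^-1` A) = leb A.
Proof.
move=> mA; apply/esym.
apply: (@lebesgue_measure_unique R (pushforward (@lebesgue_measure R)
   (fun x : measurableTypeR R => (x + a)%R : measurableTypeR R))) => //; last first.
  move=> mphi X [[x y] _ <-]/=.
  rewrite /pushforward /=.
  have -> : (fun z => z + a)%R @^-1` `]x, y] = `](x - a)%R, (y - a)%R]%classic.
    by apply/seteqP; split => z /=; rewrite !in_itv/= ltrBlDr lerBrDr.
  rewrite !lebesgue_measure_itv/= !lte_fin ltrD2r.
  by case: ifP => // _; rewrite -!EFinB; congr EFin; ring.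
exact: measurable_funD.
Qed.

Lemma ge0_integral_pushforward_inv d (T : measurableType d) (m : {measure set T -> \bar R})
    (phi : T -> T) (f : T -> \bar R) :
  measurable_fun setT phi -> (forall A, measurable A -> m (phi @^-1` A) = m A) ->
  measurable_fun setT f -> (forall x, 0 <= f x) ->
  \int[m]_x f (phi x) = \int[m]_x f x.
Proof.
move=> mphi inv mf f0.
transitivity (\int[pushforward m phi]_x f x).
  by rewrite ge0_integral_pushforward.
by apply: eq_measure_integral => A mA _; exact: inv.
Qed.

Lemma ge0_integral_shift (a : R) (f : R -> \bar R) :
  measurable_fun [set: R] f -> (forall x, 0 <= f x) ->
  \int[leb]_x f (x + a)%R = \int[leb]_x f x.
Proof.
apply: (@ge0_integral_pushforward_inv _ _ leb); first exact: measurable_funD.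
exact: leb_shift.
Qed.

Definition shear1 (s : R) (z : R * R) : R * R := (z.1 + s * z.2, z.2)%R.
Definition shear2 (s : R) (z : R * R) : R * R := (z.1, z.2 + s * z.1)%R.

Lemma measurable_shear1 s : measurable_fun setT (shear1 s).
Proof.
apply: measurable_fun_pair => //=; apply: measurable_funD => //.
exact: measurable_funM.
Qed.

Lemma measurable_shear2 s : measurable_fun setT (shear2 s).
Proof.
apply: measurable_fun_pair => //=; apply: measurable_funD => //.
exact: measurable_funM.
Qed.

Lemma leb2_shear2 (s : R) (A : set (R * R)) : measurable A ->
  leb2 (shear2 s @^-1` A) = leb2 A.
Proof.
move=> mA; rewrite /leb2 /product_measure1; apply: eq_integral => x _ /=.
rewrite -[RHS](leb_shift (s * x)%R); last exact: measurable_xsection.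
by congr (leb _); apply/seteqP; split => y /xsectionP ?; apply/xsectionP.
Qed.

Lemma leb2E (A : set (R * R)) : measurable A ->
  leb2 A = \int[leb]_y leb (ysection A y).
Proof.
move=> mA; transitivity ((leb \x^ leb) A); last by [].
apply: product_measure_unique => // B C mB mC /=.
by rewrite product_measure2E.
Qed.

Lemma leb2_shear1 (s : R) (A : set (R * R)) : measurable A ->
  leb2 (shear1 s @^-1` A) = leb2 A.
Proof.
move=> mA; rewrite !leb2E//; last first.
  by rewrite -[X in measurable X]setTI; exact: measurable_shear1.
apply: eq_integral => x _ /=.
rewrite -[RHS](leb_shift (s * x)%R); last exact: measurable_ysection.
by congr (leb _); apply/seteqP; split => y /ysectionP ?; apply/ysectionP.
Qed.

(** For [u = dir t], the first coordinate selects a line orthogonal to [u] and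
    the second one moves along that line. *)
Definition frame (u z : R * R) : R * R := (z.1 *: u + z.2 *: rot90 u)%R.

Lemma measurable_frame u : measurable_fun setT (frame u).
Proof.
by apply: measurable_planeD; apply: measurable_planeZ.
Qed.

Lemma frameE (u z : R * R) :
  frame u z = (z.1 * u.1 - z.2 * u.2, z.1 * u.2 + z.2 * u.1)%R.
Proof. by rewrite /frame/= -mulrN. Qed.

Lemma measurable_preim d d' (T : measurableType d) (T' : measurableType d')
    (f : T -> T') (B : set T') :
  measurable_fun setT f -> measurable B -> measurable (f @^-1` B).
Proof. by move=> mf mB; rewrite -[X in measurable X]setTI; exact: mf. Qed.

(** A rotation is a product of three shears, except for the half turn, which is
    the square of a quarter turn; shears preserve areas by Fubini. *)
Lemma leb2_frame (u : R * R) (A : set (R * R)) : norm2 u = 1%R -> measurable A ->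
  leb2 (frame u @^-1` A) = leb2 A.
Proof.
have main v B : norm2 v = 1%R -> v.1 != (-1)%R -> measurable B ->
    leb2 (frame v @^-1` B) = leb2 B.
  move=> v1 vN1 mB; pose t := (v.2 / (1 + v.1))%R.
  have v11 : (1 + v.1 != 0)%R.
    by apply: contra vN1; rewrite addrC addr_eq0.
  have vv : (v.2 * v.2 = (1 - v.1) * (1 + v.1))%R.
    have := sqr_norm2 v; rewrite v1 expr1n !expr2 => e.
    have -> : ((1 - v.1) * (1 + v.1) = 1 - v.1 * v.1)%R by ring.
    lra.
  have tv2 : (t * v.2 = 1 - v.1)%R by rewrite /t mulrAC vv mulfK.
  have -> : frame v @^-1` B =
      shear1 (- t) @^-1` (shear2 v.2 @^-1` (shear1 (- t) @^-1` B)).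
    have E z : frame v z = shear1 (- t) (shear2 v.2 (shear1 (- t) z)).
      rewrite frameE /shear1 /shear2 /=; congr pair; last by nra.
      have -> : (z.1 + - t * z.2 + - t * (z.2 + v.2 * (z.1 + - t * z.2)) =
         z.1 * (1 - t * v.2) - z.2 * (t + t * (1 - t * v.2)))%R by ring.
      by rewrite tv2 /t; field.
    by apply/seteqP; rewrite /preimage; split => z /=; rewrite E.
  rewrite leb2_shear1 ?leb2_shear2 ?leb2_shear1//.
  - by apply: measurable_preim => //; exact: measurable_shear1.
  - apply: measurable_preim; first exact: measurable_shear2.
    by apply: measurable_preim => //; exact: measurable_shear1.
move=> u1 mA; have [uN1|uN1] := eqVneq u.1 (-1)%R; last exact: main.
have u2 : u.2 = 0%R.
  have /eqP := sqr_norm2 u.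
  rewrite u1 uN1 sqrrN expr1n -subr_eq0 opprD addrA subrr add0r oppr_eq0 sqrf_eq0.
  by move/eqP.
pose q : R * R := (0, 1)%R.
have q1 : norm2 q = 1%R by rewrite /norm2/= expr0n expr1n add0r sqrtr1.
have qN1 : q.1 != (-1)%R by rewrite /= eq_sym oppr_eq0 oner_eq0.
have -> : frame u @^-1` A = frame q @^-1` (frame q @^-1` A).
  have E z : frame u z = frame q (frame q z).
    by rewrite !frameE /q/= uN1 u2; congr pair; ring.
  by apply/seteqP; rewrite /preimage; split => z /=; rewrite E.
by rewrite !main//; apply: measurable_preim => //; exact: measurable_frame.
Qed.

Lemma ge0_integral_frame (u : R * R) (f : R * R -> \bar R) : norm2 u = 1%R ->
  measurable_fun setT f -> (forall x, 0 <= f x) ->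
  \int[leb2]_x f x = \int[leb]_p \int[leb]_t f (frame u (p, t)).
Proof.
move=> u1 mf f0; rewrite -(ge0_integral_pushforward_inv (phi := frame u))//.
- rewrite (ge0_integral_leb2 (f := fun z => f (frame u z)))//.
  by apply: measurableT_comp => //; exact: measurable_frame.
- exact: measurable_frame.
- by move=> A mA; exact: leb2_frame.
Qed.

End Invariance.

(** * Integrals over angles *)

Section Angles.
Context {R : realType}.
Local Open Scope ereal_scope.
Implicit Types (a b c r t : R).

Lemma integral_FTC (F f : R -> R) a b : (a <= b)%R -> continuous f ->
  (forall x : R, is_derive x 1%R F (f x)) ->
  \int[leb]_(x in `[a, b]) (f x)%:E = (F b - F a)%:E.
Proof.
move=> ab cf dF; rewrite integral_leb//; last first.
  by apply: measurable_funTS; exact: continuous_measurable_fun.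
have cF x : {for x, continuous F}.
  by apply: differentiable_continuous; apply/derivable1_diffP; exact: ex_derive.
move: ab; rewrite le_eqVlt => /predU1P[->|ab].
  by rewrite set_itv1 integral_set1 subrr.
rewrite (continuous_FTC2 ab (F := F)) ?EFinB//.
- exact: continuous_subspaceT.
- split => [x _||]; first exact: ex_derive.
  + by apply: cvg_at_right_filter; exact: cF.
  + by apply: cvg_at_left_filter; exact: cF.
- by move=> x _; rewrite derive1E; exact: derive_val.
Qed.

Lemma ge0_integral_obnd_cbnd b c (f : R -> \bar R) :
  measurable_fun setT f -> (forall x, 0 <= f x) ->
  \int[leb]_(x in `]b, c]) f x = \int[leb]_(x in `[b, c]) f x.
Proof.
move=> mf f0; rewrite !ge0_integral_leb//; try exact: measurable_funTS.
by apply: integral_itv_obnd_cbnd; exact: measurable_funTS.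
Qed.

Lemma ge0_integral_itv_split a b c (f : R -> \bar R) : (a <= b <= c)%R ->
  measurable_fun setT f -> (forall x, 0 <= f x) ->
  \int[leb]_(x in `[a, c]) f x =
  \int[leb]_(x in `[a, b]) f x + \int[leb]_(x in `[b, c]) f x.
Proof.
move=> /andP[ab bc] mf f0.
have -> : `[a, c]%classic = `[a, b] `|` `]b, c].
  apply/seteqP; split => [x|x []]/=; rewrite !in_itv/=.
  - by move=> /andP[-> ->]; rewrite andbT/=; case: (leP x b); [left|right].
  - by move=> /andP[-> xb]; exact: le_trans bc.
  - by move=> /andP[bx ->]; rewrite andbT (le_trans ab)// ltW.
rewrite ge0_integral_setU//.
- by rewrite (ge0_integral_obnd_cbnd b c mf).
- exact: measurable_funTS.
- apply/disj_setPS => x []/=; rewrite !in_itv/= => /andP[_ xb] /andP[bx _].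
  by move: bx; rewrite ltNge xb.
Qed.

Lemma ge0_integral_itv_shift a b c (f : R -> \bar R) :
  measurable_fun setT f -> (forall x, 0 <= f x) ->
  \int[leb]_(x in `[a, b]) f (x + c)%R = \int[leb]_(x in `[(a + c)%R, (b + c)%R]) f x.
Proof.
move=> mf f0; rewrite integral_mkcond [RHS]integral_mkcond.
rewrite -[RHS](ge0_integral_shift c).
- apply: eq_integral => x _; rewrite !patchE.
  have -> // : ((x + c)%R \in `[(a + c)%R, (b + c)%R]%classic) = (x \in `[a, b]%classic).
  by apply/idP/idP; rewrite !inE/= !in_itv/= !lerD2r.
- by apply/(measurable_restrictT f) => //; exact: measurable_funTS.
- by move=> x; rewrite patchE; case: ifP.
Qed.

Lemma ge0_integral_periodic c (f : R -> \bar R) : (- (pi / 2) <= c <= pi / 2)%R ->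
  measurable_fun setT f -> (forall x, 0 <= f x) ->
  (forall x, f (x + pi)%R = f x) ->
  \int[leb]_(x in `[0%R, pi]) f (x + c)%R =
  \int[leb]_(x in `[(- (pi / 2))%R, (pi / 2)%R]) f x.
Proof.
move=> /andP[c1 c2] mf f0 fpi.
have pi0 := @pi_ge0 R.
rewrite ge0_integral_itv_shift// add0r.
rewrite (@ge0_integral_itv_split c (pi / 2)) ?c2//=; last by lra.
rewrite addeC.
have -> : (pi / 2 = (- (pi / 2)) + pi :> R)%R by lra.
rewrite (addrC pi c) -ge0_integral_itv_shift//.
under eq_integral do rewrite fpi.
have -> : ((- (pi / 2)) + pi = pi / 2 :> R)%R by lra.
by rewrite -ge0_integral_itv_split// c1.
Qed.

(** The projection of a vector on a direction, averaged over all directions,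
    only depends on its length. *)
Lemma ge0_integral_dir (v : R * R) (G : R -> \bar R) :
  measurable_fun setT G -> (forall x, 0 <= G x) ->
  \int[leb]_(t in `[0%R, pi]) G `|dot v (dir t)|%R =
  \int[leb]_(t in `[(- (pi / 2))%R, (pi / 2)%R]) G (norm2 v * `|sin t|)%R.
Proof.
move=> mG G0; have [t [r [/andP[t0 tpi] rE vE]]] := polar v.
rewrite -(@ge0_integral_periodic (pi / 2 - t)).
- apply: eq_integral => x _; congr G; rewrite -rE vE dotZl normrM; congr (_ * `|_|)%R.
  have -> : (x + (pi / 2 - t) = (x - t) + pi / 2)%R by ring.
  by rewrite sinDpihalf cosB /dot/= (mulrC (cos t)) (mulrC (sin t)).
- by apply/andP; split; lra.
- apply: (measurableT_comp mG); apply: measurable_funM => //.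
  by apply: measurableT_comp => //; exact: measurable_sin.
- by move=> x; exact: G0.
- by move=> x; rewrite sinDpi normrN.
Qed.

Lemma ge0_is_derive_le (F f : R -> R) a b : (a <= b)%R ->
  (forall x : R, is_derive x 1%R F (f x)) ->
  (forall x, a <= x <= b -> 0 <= f x)%R -> (F a <= F b)%R.
Proof.
move=> ab dF f0; apply: (@ger0_derive1_ndecr _ F a b) => //.
- move=> x; rewrite in_itv/= => /andP[ax xb].
  by rewrite derive1E derive_val f0// !ltW.
- apply: continuous_subspaceT => x.
  by apply: differentiable_continuous; apply/derivable1_diffP; exact: ex_derive.
Qed.

Lemma sin_geM_cos t : (0 <= t <= pi / 2)%R -> (t * cos t <= sin t)%R.
Proof.
move=> /andP[t0 tpi]; rewrite -subr_ge0.
have dF (x : R) : is_derive x 1%R (fun x : R => sin x - x * cos x)%R (x * sin x)%R.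
  by apply: trigger_derive; rewrite /GRing.scale/=; ring.
have := ge0_is_derive_le t0 dF; rewrite /= sin0 mul0r subr0; apply => x /andP[x0 xt].
rewrite mulr_ge0// sin_ge0_pi// x0/=; have := @pi_gt0 R; lra.
Qed.

Lemma sin_ge_half t : (0 <= t <= pi / 2)%R -> (t / 2 <= sin t)%R.
Proof.
move=> /andP[t0 tpi].
have pi0 := @pi_gt0 R.
have h2 : (0 <= t / 2 <= pi / 2)%R by apply/andP; split; lra.
have -> : t = (t / 2 + t / 2)%R by lra.
move: h2; set u := (t / 2)%R => u2; have := sin_geM_cos u2.
have uE : (u + u = t)%R by rewrite /u; lra.
have c0 : (0 <= cos u)%R by apply: cos_ge0_pihalf; move: u2; lra.
have c1 : (0 <= cos (u + u))%R by rewrite uE; apply: cos_ge0_pihalf; lra.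
move: c1; rewrite sinD cosD => c1 h.
have /andP[u0 _] := u2.
have s2 := cos2Dsin2 u.
have : (u * cos u * cos u <= sin u * cos u)%R by rewrite ler_wpM2r.
by move: c1 s2; rewrite !expr2; nra.
Qed.

Lemma sin_le_id t : (0 <= t)%R -> (sin t <= t)%R.
Proof.
move=> t0; rewrite -subr_ge0.
have dF (x : R) : is_derive x 1%R (fun x : R => x - sin x)%R (1 - cos x)%R.
  by apply: trigger_derive.
have := ge0_is_derive_le t0 dF; rewrite /= sin0 subr0; apply => x _.
by rewrite subr_ge0 cos_le1.
Qed.

Lemma integral_norm_dot_dir (v : R * R) :
  \int[leb]_(t in `[0%R, pi]) `|dot v (dir t)|%:E = (2 * norm2 v)%:E.
Proof.
have pi0 := @pi_gt0 R.
transitivity (\int[leb]_(t in `[0%R, pi]) (`| `|dot v (dir t)| |)%:E).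
  by apply: eq_integral => t _; rewrite normr_id.
rewrite (ge0_integral_dir v (G := fun x => `|x|%:E)); last 2 first.
- by apply/measurable_EFinP; exact: normr_measurable.
- by move=> x; rewrite lee_fin.
rewrite (@ge0_integral_itv_split _ 0%R); last 3 first.
- by apply/andP; split; lra.
- apply/measurable_EFinP; apply: measurableT_comp => //.
  apply: measurable_funM => //; apply: measurableT_comp => //.
  exact: measurable_sin.
- by move=> x; rewrite lee_fin.
have -> : (2 * norm2 v)%:E = (norm2 v)%:E + (norm2 v)%:E.
  by rewrite -EFinD; congr EFin; ring.
have n0 := norm2_ge0 v.
have csin : continuous (@sin R) by move=> ?; exact: continuous_sin.
congr (_ + _).
- transitivity (\int[leb]_(t in `[(- (pi / 2))%R, 0%R]) (norm2 v * - sin t)%:E).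
    apply: eq_integral => t; rewrite inE/= in_itv/= => /andP[t1 t0].
    have s0 : (0 <= sin (- t))%R by apply: sin_ge0_pi; apply/andP; split; lra.
    have -> : `|sin t|%R = (- sin t)%R by rewrite ler0_norm// -oppr_ge0 -sinN.
    by rewrite ger0_norm// -sinN mulr_ge0.
  have dF (x : R) : is_derive x 1%R (fun x : R => norm2 v * cos x)%R (norm2 v * - sin x)%R.
    by apply: trigger_derive; rewrite /GRing.scale/=; ring.
  rewrite (integral_FTC _ _ dF); [|by lra|].
    by rewrite cosN cos0 cos_pihalf mulr0 subr0 mulr1.
  by move=> x; apply: cvgM; [exact: cvg_cst|apply: cvgN; exact: csin].
- transitivity (\int[leb]_(t in `[0%R, (pi / 2)%R]) (norm2 v * sin t)%:E).
    apply: eq_integral => t; rewrite inE/= in_itv/= => /andP[t1 t0].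
    have s0 : (0 <= sin t)%R by apply: sin_ge0_pi; apply/andP; split; lra.
    by rewrite (ger0_norm s0) ger0_norm// mulr_ge0.
  have dF (x : R) : is_derive x 1%R (fun x : R => - norm2 v * cos x)%R (norm2 v * sin x)%R.
    by apply: trigger_derive; rewrite /GRing.scale/=; ring.
  rewrite (integral_FTC _ _ dF); [|by lra|].
    by rewrite cos0 cos_pihalf mulr0 mulr1 add0r opprK.
  by move=> x; apply: cvgM; [exact: cvg_cst|exact: csin].
Qed.

Lemma integral_triangle a b : (0 < a)%R -> (0 < b)%R ->
  \int[leb]_x (Num.max 0 (a - b * `|x|))%:E = (a ^+ 2 / b)%:E.
Proof.
move=> a0 b0; have c0 : (0 <= a / b)%R by rewrite divr_ge0// ltW.
have mF : measurable_fun [set: R] (fun x => (Num.max 0 (a - b * `|x|))%:E).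
  apply/measurable_EFinP/measurable_maxr => //; apply: measurable_funB => //.
  by apply: measurable_funM => //; exact: measurableT_comp.
have F0 (x : R) : 0 <= (Num.max 0 (a - b * `|x|))%:E.
  by rewrite lee_fin le_max lexx.
transitivity (\int[leb]_(x in `[(- (a / b))%R, (a / b)%R]) (Num.max 0 (a - b * `|x|))%:E).
  rewrite [RHS]integral_mkcond; apply: eq_integral => x _; rewrite patchE.
  case: ifPn => // /negP; rewrite inE/= in_itv/= -ler_norml ler_pdivlMr// => /negP.
  by rewrite -ltNge mulrC => h; congr EFin; apply/max_idPl; rewrite subr_le0 ltW.
rewrite (@ge0_integral_itv_split _ 0%R)// ?oppr_le0 ?c0//.
have -> : (a ^+ 2 / b)%:E = (a ^+ 2 / b / 2)%:E + (a ^+ 2 / b / 2)%:E.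
  by rewrite -EFinD -splitr.
congr (_ + _).
- transitivity (\int[leb]_(x in `[(- (a / b))%R, 0%R]) (a + b * x)%:E).
    apply: eq_integral => x; rewrite inE/= in_itv/= => /andP[x1 x0].
    rewrite ler0_norm// mulrN opprK; congr EFin; apply/max_idPr.
    by move: x1; rewrite lerNl ler_pdivlMr// mulNr mulrC; lra.
  have dF (x : R) : is_derive x 1%R (fun x : R => a * x + b * x ^+ 2 / 2)%R (a + b * x)%R.
    by apply: trigger_derive; rewrite /GRing.scale/=; field.
  rewrite (integral_FTC _ _ dF) ?oppr_le0//.
  + by congr EFin; field; rewrite gt_eqF.
  + move=> x; apply: cvgD; first exact: cvg_cst.
    by apply: cvgM; [exact: cvg_cst|exact: cvg_id].
- transitivity (\int[leb]_(x in `[0%R, (a / b)%R]) (a - b * x)%:E).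
    apply: eq_integral => x; rewrite inE/= in_itv/= => /andP[x0 x1].
    rewrite ger0_norm//; congr EFin; apply/max_idPr.
    by move: x1; rewrite ler_pdivlMr// mulrC; lra.
  have dF (x : R) : is_derive x 1%R (fun x : R => a * x - b * x ^+ 2 / 2)%R (a - b * x)%R.
    by apply: trigger_derive; rewrite /GRing.scale/=; field.
  rewrite (integral_FTC _ _ dF)//.
  + by congr EFin; field; rewrite gt_eqF.
  + move=> x; apply: cvgB; first exact: cvg_cst.
    by apply: cvgM; [exact: cvg_cst|exact: cvg_id].
Qed.

End Angles.

(** * The Riesz kernel as an average over strips of lines *)

Section Strips.
Context {R : realType}.
Local Open Scope ereal_scope.
Implicit Types (h : R) (x y : R * R).

(** The line [dot x (dir t) = p] is encoded by the pair [(t, p)]; these are the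
    lines that pass at distance less than [h] from [x]. *)
Definition strip h x : set (R * R) :=
  [set l | (0 <= l.1 <= pi)%R /\ (`|dot x (dir l.1) - l.2| < h)%R].

Lemma measurable_angles : measurable [set l : R * R | (0 <= l.1 <= pi)%R].
Proof.
have -> : [set l : R * R | (0 <= l.1 <= pi)%R] = `[0%R, pi] `*` setT.
  by apply/seteqP; split => l /=; rewrite in_itv/=; [|case].
exact: measurableX.
Qed.

Lemma measurable_strip_rel h :
  measurable [set z : (R * R) * (R * R) | strip h z.2 z.1].
Proof.
have -> : [set z : (R * R) * (R * R) | strip h z.2 z.1] =
    (fst @^-1` [set l : R * R | (0 <= l.1 <= pi)%R]) `&`
    [set z : (R * R) * (R * R) | (`|dot z.2 (dir z.1.1) - z.1.2| < h)%R] by [].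
apply: measurableI.
  exact: (measurable_preim measurable_fst measurable_angles).
apply: measurable_set_ltr => //; apply: measurableT_comp => //.
apply: measurable_funB.
  apply: measurable_dot => //; apply: measurable_dir.
  exact: (measurableT_comp measurable_fst).
exact: (measurableT_comp measurable_snd).
Qed.

Lemma measurable_strip h x : measurable (strip h x).
Proof.
have -> : strip h x = (fun l => (l, x)) @^-1` [set z : (R * R) * (R * R) | strip h z.2 z.1] by [].
apply: measurable_preim; first exact: measurable_fun_pair.
exact: measurable_strip_rel.
Qed.

Lemma leb_itvoo_ge0 (a b : R) : leb `]a, b[ = (Num.max 0 (b - a))%:E.
Proof.
rewrite leb_itv/= lte_fin; case: ltP => [ab|ba].
  by rewrite -EFinB; congr EFin; apply/esym/max_idPr; rewrite subr_ge0 ltW.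
by congr EFin; apply/esym/max_idPl; rewrite subr_le0.
Qed.

(** At a fixed angle the two strips are intervals of length [2 h], whose
    centres are at distance [|dot (x - y) (dir t)|]; averaging over the angle
    leaves only the distance between the points. *)
Lemma leb2_stripI h x y : leb2 (strip h x `&` strip h y) =
  \int[leb]_(t in `[(- (pi / 2))%R, (pi / 2)%R])
     (Num.max 0 (2 * h - eucl_dist x y * `|sin t|))%:E.
Proof.
rewrite eucl_distE -(@ge0_integral_dir _ (x - y)%R (fun s => (Num.max 0 (2 * h - s))%:E)); last 2 first.
- by apply/measurable_EFinP/measurable_maxr => //; exact: measurable_funB.
- by move=> s; rewrite lee_fin le_max lexx.
rewrite /leb2 /product_measure1 [RHS]integral_mkcond; apply: eq_integral => t _.
rewrite patchE /=; case: ifPn => [|/negP]; rewrite inE/= in_itv/= => t01; last first.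
  rewrite (_ : xsection _ t = set0) ?measure0//.
  by apply/seteqP; split => // p /xsectionP[[/= + _] _]; move/t01.
set a := dot x (dir t); set b := dot y (dir t).
have -> : xsection (strip h x `&` strip h y) t = `](Num.max a b - h)%R, (Num.min a b + h)%R[%classic.
  apply/seteqP; split => p; rewrite /= in_itv/=.
  - move=> /xsectionP[[_ /=]]; rewrite -/a ltr_norml => /andP[a1 a2] [_ /=].
    rewrite -/b ltr_norml => /andP[b1 b2].
    by case: (leP a b) => ab; apply/andP; split; lra.
  - move=> h12; apply/xsectionP; split; split => //=; rewrite -?/a -?/b ltr_norml;
      move: h12; case: (leP a b) => ab /andP[p1 p2]; apply/andP; split; lra.
rewrite leb_itvoo_ge0; congr (Num.max _ _)%:E.
rewrite dotBl -/a -/b; case: (leP a b) => ab;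
  [rewrite ler0_norm ?subr_le0//|rewrite gtr0_norm ?subr_gt0//]; ring.
Qed.

Let Tri (a b : R) := \int[leb]_(t in `[(- (pi / 2))%R, (pi / 2)%R])
     (Num.max 0 (a - b * `|t|))%:E.

Let mTri (a b : R) : measurable_fun [set: R] (fun t => (Num.max 0 (a - b * `|t|))%:E).
Proof.
by apply/measurable_EFinP/measurable_maxr => //; apply: measurable_funB => //;
  apply: measurable_funM => //; exact: measurableT_comp.
Qed.

Let Tri_le (a b : R) : (0 < a)%R -> (0 < b)%R -> Tri a b <= (a ^+ 2 / b)%:E.
Proof.
move=> a0 b0; rewrite -integral_triangle//; apply: ge0_subset_integral => //.
by move=> x _; rewrite lee_fin le_max lexx.
Qed.

Let Tri_eq (a b : R) : (0 < a)%R -> (0 < b)%R -> (a <= b * (pi / 2))%R ->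
  Tri a b = (a ^+ 2 / b)%:E.
Proof.
move=> a0 b0 ab; rewrite -integral_triangle// /Tri integral_mkcond.
apply: eq_integral => x _; rewrite patchE; case: ifPn => // /negP.
rewrite inE/= in_itv/= -ler_norml => /negP; rewrite -ltNge => h.
congr EFin; apply/esym/max_idPl; rewrite subr_le0 (le_trans ab)// ler_pM2l// ltW//.
Qed.

Let mS (a b : R) : measurable_fun [set: R] (fun t => (Num.max 0 (a - b * `|sin t|))%:E).
Proof.
apply/measurable_EFinP/measurable_maxr => //; apply: measurable_funB => //.
apply: measurable_funM => //; apply: measurableT_comp => //; exact: measurable_sin.
Qed.

Let max_ge0 (a : R) : 0 <= (Num.max 0 a)%:E.
Proof. by rewrite lee_fin le_max lexx. Qed.

Let sin_abs (t : R) : (- (pi / 2) <= t <= pi / 2)%R ->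
  [/\ (`|sin t| <= `|t|)%R, (`|t| / 2 <= `|sin t|)%R & (`|t| * cos t <= `|sin t|)%R].
Proof.
rewrite -ler_norml => tpi; have t0 := normr_ge0 t.
have pi0 := @pi_gt0 R.
have -> : `|sin t|%R = sin `|t|.
  have s0 : (0 <= sin `|t|)%R by apply: sin_ge0_pi; lra.
  case: (leP 0%R t) s0 => t'; first by rewrite (ger0_norm t') => /ger0_norm.
  by rewrite (ltr0_norm t') -normrN -sinN => /ger0_norm.
rewrite -(cos_norm t); split; first exact: sin_le_id.
  by apply: sin_ge_half; rewrite t0.
by apply: sin_geM_cos; rewrite t0.
Qed.

(** Crude, but valid for every [h]: it provides the domination of the strip
    kernels by twice the Riesz kernel. *)
Lemma leb2_stripI_le h x y : (0 < h)%R -> x != y ->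
  leb2 (strip h x `&` strip h y) <= (8 * h ^+ 2 / eucl_dist x y)%:E.
Proof.
move=> h0 xy; have r0 : (0 < eucl_dist x y)%R by exact: eucl_dist_gt0.
rewrite leb2_stripI; set r := eucl_dist x y in r0 *.
have -> : (8 * h ^+ 2 / r = (2 * h) ^+ 2 / (r / 2))%R by field; rewrite gt_eqF.
apply: (@le_trans _ _ (Tri (2 * h) (r / 2))); last by apply: Tri_le; lra.
apply: ge0_le_integral; [by []|by move=> t _; exact: max_ge0|exact: measurable_funTS|
  exact: measurable_funTS|].
move=> t; rewrite /= in_itv/= => /sin_abs[_ t2 _].
rewrite lee_fin ge_max !le_max !lexx/=; apply/orP; right.
by rewrite lerD2l lerN2 -mulrA ler_pM2l// mulrC.
Qed.

Lemma leb2_stripI_ge h x y : (0 < h)%R -> x != y -> (4 * h <= eucl_dist x y * pi)%R ->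
  (4 * h ^+ 2 / eucl_dist x y)%:E <= leb2 (strip h x `&` strip h y).
Proof.
move=> h0 xy; have r0 : (0 < eucl_dist x y)%R by exact: eucl_dist_gt0.
rewrite leb2_stripI; set r := eucl_dist x y in r0 * => hr.
have -> : (4 * h ^+ 2 / r = (2 * h) ^+ 2 / r)%R by field; rewrite gt_eqF.
rewrite -Tri_eq; [|lra|lra|lra].
apply: ge0_le_integral; [by []|by move=> t _; exact: max_ge0|exact: measurable_funTS|
  exact: measurable_funTS|].
move=> t; rewrite /= in_itv/= => /sin_abs[t2 _ _].
rewrite lee_fin ge_max !le_max !lexx/=; apply/orP; right.
by rewrite lerD2l lerN2 ler_pM2l.
Qed.

(** Only the angles below [4 h / |x - y|] contribute, and there [|sin t| >=
    |t| cos t] is nearly [|t|]; as [h] tends to 0 this matches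
    [leb2_stripI_ge]. *)
Lemma leb2_stripI_le_sharp h x y : (0 < h)%R -> x != y ->
  (8 * h < eucl_dist x y * pi)%R ->
  leb2 (strip h x `&` strip h y) <=
  (4 * h ^+ 2 / (eucl_dist x y * cos (4 * h / eucl_dist x y)))%:E.
Proof.
move=> h0 xy; have r0 : (0 < eucl_dist x y)%R by exact: eucl_dist_gt0.
rewrite leb2_stripI; set r := eucl_dist x y in r0 * => hr.
set s := (4 * h / r)%R.
have s0 : (0 < s)%R by rewrite divr_gt0// mulr_gt0.
have spi : (s < pi / 2)%R by rewrite ltr_pdivrMr//; lra.
have c0 : (0 < cos s)%R by apply: cos_gt0_pihalf; lra.
have rc0 : (0 < r * cos s)%R by rewrite mulr_gt0.
have -> : (4 * h ^+ 2 / (r * cos s) = (2 * h) ^+ 2 / (r * cos s))%R.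
  by congr (_ / _)%R; ring.
apply: (@le_trans _ _ (Tri (2 * h) (r * cos s))); last by apply: Tri_le => //; lra.
apply: ge0_le_integral; [by []|by move=> t _; exact: max_ge0|exact: measurable_funTS|
  exact: measurable_funTS|].
move=> t; rewrite /= in_itv/= => tpi; have [_ t2 t3] := sin_abs tpi.
rewrite lee_fin ge_max !le_max !lexx/=.
case: (leP (2 * h)%R (r * `|sin t|)%R) => [ht|ht].
  by apply/orP; left; rewrite subr_le0.
apply/orP; right; rewrite lerD2l lerN2 -mulrA ler_pM2l//.
rewrite (le_trans _ t3)// mulrC ler_wpM2l//.
have ts : (`|t| <= s)%R.
  rewrite /s ler_pdivlMr//; have : (r * (`|t| / 2) < 2 * h)%R.
    by rewrite (le_lt_trans _ ht)// ler_pM2l.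
  by lra.
rewrite -(cos_norm t) leNgt ltr_cos ?in_itv/= -?leNgt//.
  by rewrite ltW//=; have := @pi_gt0 R; lra.
by rewrite normr_ge0/= (le_trans ts)//; have := @pi_gt0 R; lra.
Qed.

Lemma leb2_stripI_diag h x : (0 < h)%R ->
  leb2 (strip h x `&` strip h x) = (2 * h * pi)%:E.
Proof.
move=> h0; rewrite leb2_stripI eucl_distxx.
have -> : (2 * h * pi)%:E = (2 * h)%:E * leb `[(- (pi / 2))%R, (pi / 2)%R].
  rewrite leb_itv/= lte_fin; have pi0 := @pi_gt0 R.
  by rewrite ifT; [rewrite -EFinB -EFinM; congr EFin; lra|lra].
rewrite -integral_cst//; apply: eq_integral => t _; rewrite mul0r subr0.
by congr EFin; apply/max_idPr; lra.
Qed.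

(** The normalization makes these kernels converge to the Riesz kernel. *)
Definition strip_kernel h x y : \bar R :=
  ((2 * h) ^- 2)%:E * leb2 (strip h x `&` strip h y).

Lemma riesz_kernelxx x : riesz_kernel x x = +oo.
Proof. by rewrite /riesz_kernel eucl_distxx inver eqxx. Qed.

Lemma riesz_kernelE x y : x != y -> riesz_kernel x y = (eucl_dist x y)^-1%:E.
Proof. by move=> xy; rewrite /riesz_kernel inver gt_eqF// eucl_dist_gt0. Qed.

Lemma strip_kernel_ge0 h x y : 0 <= strip_kernel h x y.
Proof. by rewrite mule_ge0// lee_fin invr_ge0 sqr_ge0. Qed.

Lemma riesz_kernel_ge0 x y : 0 <= riesz_kernel x y.
Proof. by rewrite inve_ge0 lee_fin eucl_dist_ge0. Qed.

Lemma strip_kernel_le h x y : (0 < h)%R ->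
  strip_kernel h x y <= 2%:E * riesz_kernel x y.
Proof.
move=> h0; have [->|xy] := eqVneq x y.
  by rewrite riesz_kernelxx gt0_muley ?lte_fin// leey.
rewrite riesz_kernelE// -EFinM /strip_kernel.
have r0 := eucl_dist_gt0 xy.
rewrite (le_trans (lee_wpmul2l _ (leb2_stripI_le h0 xy)))//.
  by rewrite lee_fin invr_ge0 sqr_ge0.
rewrite -EFinM lee_fin le_eqVlt; apply/orP; left; apply/eqP; field.
by rewrite !gt_eqF.
Qed.

Lemma cvg_strip_kernel x y :
  strip_kernel n.+1%:R^-1%R x y @[n --> \oo] --> riesz_kernel x y.
Proof.
pose h n : R := n.+1%:R^-1%R.
have h0 n : (0 < h n)%R by rewrite invr_gt0.
have ch : h @ \oo --> (0 : R)%R by exact: cvg_harmonic.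
have pi0 := @pi_gt0 R.
have [->|xy] := eqVneq x y.
  rewrite riesz_kernelxx.
  have -> : (fun n => strip_kernel n.+1%:R^-1%R y y) = (fun n => (pi / 2 * n.+1%:R)%:E).
    apply/funext => n; rewrite /strip_kernel leb2_stripI_diag; last exact: h0.
    by rewrite -EFinM; congr EFin; field; rewrite !(gt_eqF, ltr0Sn).
  apply/cvgeryP/cvgryPge => A; have := nbhs_infty_ger (A / (pi / 2))%R.
  apply: filterS => n An; rewrite mulrC -ler_pdivrMr ?divr_gt0//.
  by rewrite (le_trans An)// ler_nat.
rewrite riesz_kernelE//; have r0 := eucl_dist_gt0 xy.
set r := eucl_dist x y in r0 *.
have hE n : ((2 * h n) ^- 2)%:E * (4 * h n ^+ 2 / r)%:E = r^-1%:E.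
  by rewrite -EFinM; congr EFin; field; rewrite !gt_eqF.
have near_small : \forall n \near \oo, (8 * h n < r * pi)%R.
  have e0 : (0 < r * pi / 8)%R by rewrite divr_gt0// mulr_gt0.
  have /cvgr0Pnorm_lt/(_ _ e0) := ch; apply: filterS => n.
  by rewrite ger0_norm ?ltW// => hn; lra.
have cs : (fun n => r^-1 / cos (4 * h n / r))%R @ \oo --> (r^-1)%R.
  have c1 : (fun n => cos (4 * h n / r))%R @ \oo --> (1 : R)%R.
    rewrite -[X in _ --> X](@cos0 R); apply: continuous_cvg.
      exact: continuous_cos.
    have -> : (0 : R)%R = (4 * 0 / r)%R by rewrite mulr0 mul0r.
    by apply: cvgM; [apply: cvgM => //; exact: cvg_cst|exact: cvg_cst].
  rewrite -[X in _ --> X]divr1; apply: cvgM; first exact: cvg_cst.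
  by apply: cvgV => //; exact: oner_neq0.
apply: (@squeeze_cvge _ _ _ _ (fun=> r^-1%:E) _
    (fun n => (r^-1 / cos (4 * h n / r))%:E)).
- near=> n.
  have hn : (8 * h n < r * pi)%R by near: n; exact: near_small.
  have hn0 := h0 n.
  have k0 : 0 <= ((2 * h n) ^- 2)%:E by rewrite lee_fin invr_ge0 sqr_ge0.
  apply/andP; split.
  + rewrite -(hE n) lee_wpmul2l//; apply: leb2_stripI_ge => //; rewrite -/r; lra.
  + rewrite (le_trans (lee_wpmul2l k0 (leb2_stripI_le_sharp hn0 xy hn)))//.
    rewrite -/r; set c := cos _.
    have -> : (4 * h n ^+ 2 / (r * c))%:E = (4 * h n ^+ 2 / r)%:E * c^-1%:E.
      by rewrite -EFinM invfM mulrA.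
    by rewrite muleA hE -EFinM.
- exact: cvg_cst.
- by apply/cvg_EFin; [exact: nearW|exact: cs].
Unshelve. all: end_near. Qed.

End Strips.

(** * Lower bounds on the energy by tests on lines *)

Section Energy.
Context {R : realType}.
Local Open Scope ereal_scope.
Implicit Types (h : R) (x y : R * R) (mu : probability (R * R)%type R).

Definition energy mu : \bar R := \int[mu]_x \int[mu]_y riesz_kernel x y.

Lemma measurable_strip_kernel h :
  measurable_fun setT (fun z : (R * R) * (R * R) => strip_kernel h z.1 z.2).
Proof.
apply: measurable_funeM.
pose A := [set w : ((R * R) * (R * R)) * (R * R) | strip h w.1.1 w.2 /\ strip h w.1.2 w.2].
have mA : measurable A.
  apply: measurableI.
  - apply: (@measurable_preim _ _ _ _ (fun w : ((R * R) * (R * R)) * (R * R) => (w.2, w.1.1)) _ _ (measurable_strip_rel h)).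
    apply: measurable_fun_pair => //; exact: (measurableT_comp measurable_fst).
  - apply: (@measurable_preim _ _ _ _ (fun w : ((R * R) * (R * R)) * (R * R) => (w.2, w.1.2)) _ _ (measurable_strip_rel h)).
    apply: measurable_fun_pair => //; exact: (measurableT_comp measurable_snd).
have -> : (fun z : (R * R) * (R * R) => leb2 (strip h z.1 `&` strip h z.2)) = leb2 \o xsection A.
  apply/funext => z /=; congr (leb2 _).
  by apply/seteqP; split => l /= => [H|/xsectionP//]; apply/xsectionP.
exact: measurable_fun_xsection.
Qed.

Lemma measurable_riesz_kernel :
  measurable_fun setT (fun z : (R * R) * (R * R) => riesz_kernel z.1 z.2).
Proof.
apply: (emeasurable_fun_cvg (fun n z => strip_kernel n.+1%:R^-1%R z.1 z.2)) => //.
- by move=> n; exact: measurable_strip_kernel.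
- by move=> z _; exact: cvg_strip_kernel.
Qed.

Lemma energyE mu : energy mu = \int[mu \x mu]_z riesz_kernel z.1 z.2.
Proof.
rewrite (fubini_tonelli1 (fun z => riesz_kernel z.1 z.2))//.
- exact: measurable_riesz_kernel.
- by move=> z; exact: riesz_kernel_ge0.
Qed.

Lemma energy_ge0 mu : 0 <= energy mu.
Proof.
by apply: integral_ge0 => x _; apply: integral_ge0 => y _; exact: riesz_kernel_ge0.
Qed.

Lemma integrable_riesz_kernel mu : energy mu < +oo ->
  (mu \x mu).-integrable setT (fun z => riesz_kernel z.1 z.2).
Proof.
move=> E; apply/integrableP; split; first exact: measurable_riesz_kernel.
under eq_integral do rewrite gee0_abs ?riesz_kernel_ge0//.
by rewrite -energyE.
Qed.

Definition strip_energy h mu : \bar R :=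
  \int[mu \x mu]_z strip_kernel h z.1 z.2.

Lemma cvg_strip_energy mu : energy mu < +oo ->
  strip_energy n.+1%:R^-1%R mu @[n --> \oo] --> energy mu.
Proof.
move=> E; rewrite energyE.
have [] // := @dominated_convergence _ _ _ (mu \x mu) setT measurableT
  (fun n z => strip_kernel n.+1%:R^-1%R z.1 z.2)
  (fun z => riesz_kernel z.1 z.2) (fun z => 2%:E * riesz_kernel z.1 z.2).
- by move=> n; exact: measurable_strip_kernel.
- exact: measurable_riesz_kernel.
- by apply: aeW => z _; exact: cvg_strip_kernel.
- by apply: integrableZl => //; exact: integrable_riesz_kernel.
- by apply: aeW => z n _; rewrite gee0_abs ?strip_kernel_ge0// strip_kernel_le.
Qed.

(** Fatou's lemma replaces dominated convergence here, because upper bounds are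
    wanted for measures whose energy is not yet known to be finite. *)
Lemma energy_le_strip_energy mu (c : \bar R) :
  (forall h, (0 < h)%R -> strip_energy h mu <= c) -> energy mu <= c.
Proof.
move=> H; rewrite energyE.
have <- : (fun z => limn_einf (fun n => strip_kernel n.+1%:R^-1%R z.1 z.2)) =
   (fun z : (R * R) * (R * R) => riesz_kernel z.1 z.2).
  apply/funext => z; have cz := @cvg_strip_kernel R z.1 z.2.
  by rewrite is_cvg_limn_einfE; [exact/cvg_lim|apply/cvg_ex; eexists; exact: cz].
apply: (le_trans (fatou _ _ _ _)) => //.
- by move=> n; exact: measurable_strip_kernel.
- by move=> n z _; exact: strip_kernel_ge0.
- rewrite limn_einf_lim; apply: lime_le; first exact: is_cvg_einfs.
  apply: nearW => n; apply: (@le_trans _ _ (strip_energy n.+1%:R^-1%R mu)); last exact: H.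
  by apply: ereal_inf_lbound; exists n => /=.
Qed.

Definition through h (l : R * R) : set (R * R) := [set x | strip h x l].

Lemma measurable_through h l : measurable (through h l).
Proof.
have -> : through h l = (fun x => (l, x)) @^-1` [set z : (R * R) * (R * R) | strip h z.2 z.1] by [].
apply: measurable_preim; first exact: measurable_fun_pair.
exact: measurable_strip_rel.
Qed.

Lemma measurable_mu_through h mu : measurable_fun setT (fun l => mu (through h l)).
Proof.
have := @measurable_fun_xsection _ _ _ _ _ mu _ (@measurable_strip_rel R h).
congr measurable_fun; apply/funext => z /=; congr (mu _).
by apply/seteqP; split => l /= => [/xsectionP|H]//; apply/xsectionP.
Qed.

Lemma integral_strip_swap h mu (w : R * R -> \bar R) :
  measurable_fun setT w -> (forall l, 0 <= w l) ->
  measurable_fun setT (fun x => \int[leb2]_(l in strip h x) w l) /\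
  \int[mu]_x \int[leb2]_(l in strip h x) w l =
  \int[leb2]_l (w l * mu (through h l)).
Proof.
move=> mw w0; pose B := [set z : (R * R) * (R * R) | strip h z.2 z.1].
have mB : measurable B by exact: measurable_strip_rel.
pose F z : \bar R := w z.1 * (\1_B z)%:E.
have mF : measurable_fun setT F.
  apply: emeasurable_funM; first exact: (measurableT_comp mw).
  by apply/measurable_EFinP; exact: measurable_indic.
have F0 z : 0 <= F z by rewrite mule_ge0// lee_fin.
have E x : \int[leb2]_(l in strip h x) w l = \int[leb2]_l F (l, x).
  rewrite integral_mkcond; apply: eq_integral => l _; rewrite patchE /F indicE.
  have -> : ((l, x) \in B) = (l \in strip h x) by apply/idP/idP; rewrite !inE.
  by case: ifP; rewrite ?mule1 ?mule0.
split.
  have -> : (fun x => \int[leb2]_(l in strip h x) w l) =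
     (fun x => \int[leb2]_l F (l, x)) by apply/funext.
  exact: (measurable_fun_fubini_tonelli_G (m1 := leb2) F).
under eq_integral do rewrite E.
rewrite -(fubini_tonelli (m1 := leb2) (m2 := mu) F)//; apply: eq_integral => l _.
rewrite /F /= ge0_integralZl//.
- congr (_ * _); rewrite -[X in mu X](setIT _) -integral_indic//.
  exact: measurable_through.
- apply: (@measurableT_comp _ _ _ _ _ _ (fun z => (\1_B z)%:E)).
    by apply/measurable_EFinP; exact: measurable_indic.
  exact: measurable_fun_pair.
Qed.

(** Exchanging the points with the lines turns the double integral over pairs
    of points near a common line into a square for each line. *)
Lemma strip_energyE h mu :
  strip_energy h mu = ((2 * h) ^- 2)%:E * \int[leb2]_l (mu (through h l) * mu (through h l)).
Proof.
have mmu := measurable_mu_through h mu.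
rewrite /strip_energy (fubini_tonelli1 (fun z => strip_kernel h z.1 z.2)); last 2 first.
- exact: measurable_strip_kernel.
- by move=> z; exact: strip_kernel_ge0.
have k0 : 0 <= ((2 * h) ^- 2)%:E by rewrite lee_fin invr_ge0 sqr_ge0.
have E x : \int[mu]_y strip_kernel h x y =
    ((2 * h) ^- 2)%:E * \int[leb2]_(l in strip h x) mu (through h l).
  have msx : measurable_fun setT (fun l => (\1_(strip h x) l)%:E : \bar R).
    by apply/measurable_EFinP; apply: measurable_indic; exact: measurable_strip.
  have sx0 l : 0 <= (\1_(strip h x) l)%:E :> \bar R by rewrite lee_fin.
  have [m1 e1] := integral_strip_swap h mu msx sx0.
  have e2 y : leb2 (strip h x `&` strip h y) = \int[leb2]_(l in strip h y) (\1_(strip h x) l)%:E.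
    by rewrite integral_indic//; exact: measurable_strip.
  rewrite /strip_kernel; under eq_integral do rewrite e2.
  rewrite ge0_integralZl//; last by move=> y _; apply: integral_ge0.
  rewrite e1; congr (_ * _); rewrite [RHS]integral_mkcond.
  by apply: eq_integral => l _; rewrite patchE indicE; case: ifP; rewrite ?mul1e ?mul0e.
rewrite /fubini_F /=; under eq_integral do rewrite E.
have [m2 e2] := integral_strip_swap h mu mmu (fun l => measure_ge0 mu _).
rewrite ge0_integralZl//; first by rewrite e2.
by move=> x _; exact: integral_ge0.
Qed.

(** Arithmetic-geometric mean inequality between a test function [q] and the
    density of [mu] along lines, averaged over a strip. *)
Lemma strip_test h mu (q : R * R -> R) : (0 < h)%R ->
  measurable_fun setT q -> (forall l, 0 <= q l)%R ->
  2%:E * \int[mu]_x ((2 * h)^-1%:E * \int[leb2]_(l in strip h x) (q l)%:E) <=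
  strip_energy h mu + \int[leb2]_l (q l ^+ 2)%:E.
Proof.
move=> h0 mq q0.
have hh0 : (0 <= (2 * h)^-1 :> R)%R by rewrite invr_ge0 mulr_ge0// ltW.
have mqE : measurable_fun setT (fun l => (q l)%:E) by exact/measurable_EFinP.
have q0E l : 0 <= (q l)%:E by rewrite lee_fin.
have mmu := measurable_mu_through h mu.
have [m1 e1] := integral_strip_swap h mu mqE q0E.
have mqm : measurable_fun setT (fun l => (q l)%:E * mu (through h l)).
  exact: emeasurable_funM.
have mmm : measurable_fun setT (fun l => mu (through h l) * mu (through h l)).
  exact: emeasurable_funM.
have mq2 : measurable_fun setT (fun l => (q l ^+ 2)%:E).
  by apply/measurable_EFinP; exact: measurable_funX.
have k0 : 0 <= ((2 * h) ^- 2)%:E by rewrite lee_fin invr_ge0 sqr_ge0.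
have qm0 l : 0 <= (q l)%:E * mu (through h l) by rewrite mule_ge0.
rewrite ge0_integralZl//; last by move=> x _; apply: integral_ge0.
rewrite e1 muleA -EFinM strip_energyE -ge0_integralZl//; last first.
  by rewrite lee_fin mulr_ge0.
rewrite -(ge0_integralZl leb2 _ mmm)//; last by move=> l _; rewrite mule_ge0.
rewrite -ge0_integralD//; last 3 first.
- by move=> l _; rewrite mule_ge0// mule_ge0.
- exact: measurable_funeM.
- by move=> l _; rewrite lee_fin sqr_ge0.
apply: ge0_le_integral => //.
- by move=> l _; rewrite mule_ge0// lee_fin mulr_ge0.
- exact: measurable_funeM.
- by apply: emeasurable_funD => //; exact: measurable_funeM.
- move=> l _; have /fineK <- : mu (through h l) \is a fin_num.
    by apply: fin_num_measure; exact: measurable_through.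
  set m := fine _; rewrite -!EFinM -EFinD lee_fin -exprVn.
  by have := sqr_ge0 ((2 * h)^-1 * m - q l); rewrite !expr2; nra.
Qed.

End Energy.

Section EnergyTest.
Context {R : realType}.
Local Open Scope ereal_scope.
Implicit Types (h : R) (x y : R * R) (U : set (R * R)) (mu : probability (R * R)%type R).

Definition lines U : set (R * R) :=
  [set l | (0 <= l.1 <= pi)%R /\ exists2 x, U x & dot x (dir l.1) = l.2].

Definition core U h : set (R * R) :=
  [set x | forall y, (eucl_dist x y < h)%R -> U y].

Lemma continuous_line_gap x :
  continuous (fun l : R * R => dot x (dir l.1) - l.2)%R.
Proof.
move=> l; apply: cvgB; last exact: cvg_snd.
have c1 : (fun l : R * R => cos l.1) @ l --> cos l.1.
  by apply: continuous_cvg; [exact: continuous_cos|exact: cvg_fst].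
have s1 : (fun l : R * R => sin l.1) @ l --> sin l.1.
  by apply: continuous_cvg; [exact: continuous_sin|exact: cvg_fst].
by apply: cvgD; apply: cvgM => //; exact: cvg_cst.
Qed.

Lemma open_near_line x h : open [set l : R * R | (`|dot x (dir l.1) - l.2| < h)%R].
Proof.
have -> : [set l : R * R | (`|dot x (dir l.1) - l.2| < h)%R] =
    (fun l : R * R => dot x (dir l.1) - l.2)%R @^-1` [set r : R | (`|r| < h)%R] by [].
apply: open_comp; first by move=> l _; exact: continuous_line_gap.
have -> : [set r : R | (`|r| < h)%R] = `](- h)%R, h[%classic.
  by apply/seteqP; split => r /=; rewrite in_itv/= ltr_norml.
exact: interval_open.
Qed.

Lemma project_on_line x l : exists y,
  dot y (dir l.1) = l.2 /\ eucl_dist x y = `|dot x (dir l.1) - l.2|%R.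
Proof.
pose n := dir l.1; pose y := (x - (dot x n - l.2) *: n)%R; exists y; split.
  have nn : dot n n = 1%R by rewrite /dot -!expr2 cos2Dsin2.
  by rewrite /y dotBl dotZl nn mulr1 opprB addrC subrK.
by rewrite eucl_distE /y opprB addrC subrK norm2Z norm2_dir mulr1.
Qed.

Lemma measurable_lines U : open U -> measurable (lines U).
Proof.
move=> oU.
have -> : lines U = [set l : R * R | (0 <= l.1 <= pi)%R] `&`
    \bigcup_(z in [set z : (R * R) * R | core U z.2 z.1 /\ (0 < z.2)%R])
       [set l : R * R | (`|dot z.1 (dir l.1) - l.2| < z.2)%R].
  apply/seteqP; split => [l [l01 [x Ux xl]]|l [l01 [[x h] [/= Uh h0] xl]]]; split => //.
    have [r r0 rU] := (open_euclP U).1 oU x Ux.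
    by exists (x, r) => //=; rewrite xl subrr normr0.
  have [y [yl xy]] := project_on_line x l.
  by exists y => //; apply: Uh; rewrite xy.
apply: measurableI; first exact: measurable_angles.
by apply: open_measurable_plane; apply: bigcup_open => z _; exact: open_near_line.
Qed.

Lemma measurable_core U h : measurable (core U h).
Proof.
have -> : core U h = ~` (\bigcup_(y in ~` U) [set x | eucl_dist x y < h]%R).
  apply/seteqP; split => [x xU [y Uy]/=|x nU y xy].
    by move=> xy; exact/Uy/xU.
  by apply: contrapT => Uy; apply: nU; exists y.
apply: measurableC; apply: open_measurable_plane; apply: bigcup_open => y _.
apply/open_euclP => x /= xy; exists (h - eucl_dist x y)%R; first by rewrite subr_gt0.
move=> z xz; rewrite eucl_distC (le_lt_trans (eucl_dist_triangle x _ _))// eucl_distC.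
by rewrite addrC -ltrBrDr.
Qed.

Lemma core_nonincr U h h' : (h <= h')%R -> core U h' `<=` core U h.
Proof. by move=> hh x Ux y xy; apply: Ux; exact: lt_le_trans xy hh. Qed.

Lemma core_sub U h : (0 < h)%R -> core U h `<=` U.
Proof. by move=> h0 x; apply; rewrite eucl_distxx. Qed.

Lemma bigcup_core U : open U -> \bigcup_n core U n.+1%:R^-1%R = U.
Proof.
move=> oU; apply/seteqP; split => [x [n _]|x Ux]; first exact: core_sub.
have [r r0 rU] := (open_euclP U).1 oU x Ux.
have [n _ /(_ n (leqnn n)) /= h] := near_infty_natSinv_lt (PosNum r0).
by exists n => // y xy; apply: rU; exact: lt_trans h.
Qed.

Lemma cvg_mu_core mu U : open U ->
  mu (core U n.+1%:R^-1%R) @[n --> \oo] --> mu U.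
Proof.
move=> oU; rewrite -[in X in _ --> X](bigcup_core oU).
apply: nondecreasing_cvg_mu.
- by move=> n; exact: measurable_core.
- by apply: bigcup_measurable => n _; exact: measurable_core.
- move=> n m nm; apply/subsetPset => x; apply: core_nonincr.
  by rewrite lef_pV2 ?posrE// ler_nat.
Qed.

Lemma strip_sub_lines U h x : core U h x -> strip h x `<=` lines U.
Proof.
move=> Ux l [l01 xl]; split => //; have [y [yl xy]] := project_on_line x l.
by exists y => //; apply: Ux; rewrite xy.
Qed.

Lemma integral_affine (al be c h : R) : (0 < h)%R ->
  \int[leb]_(p in `](c - h)%R, (c + h)%R[) (al + be * p)%:E = (2 * h * (al + be * c))%:E.
Proof.
move=> h0.
have mf : measurable_fun [set: R] (fun p : R => al + be * p)%R.
  by apply: measurable_funD => //; exact: measurable_funM.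
transitivity (\int[leb]_(p in `[(c - h)%R, (c + h)%R]) (al + be * p)%:E).
  rewrite !integral_leb//; try exact: measurable_funTS.
  apply/esym; apply: (@integral_itv_bndoo R _ _ _ true false).
  by apply/measurable_EFinP; exact: measurable_funTS.
have dF (p : R) : is_derive p 1%R (fun p : R => al * p + be * p ^+ 2 / 2)%R (al + be * p)%R.
  by apply: trigger_derive; rewrite /GRing.scale/=; field.
rewrite (integral_FTC _ _ dF).
- by congr EFin; field.
- lra.
- move=> p; apply: cvgD; first exact: cvg_cst.
  by apply: cvgM; [exact: cvg_cst|exact: cvg_id].
Qed.

(** An affine function of [p] has the same average over the strip around [x]
    as on the lines through [x], so widening the lines into strips costs
    nothing. *)
Lemma integral_strip_affine U h x (a b : R -> R) : (0 < h)%R ->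
  core U h x -> measurable_fun setT a -> measurable_fun setT b ->
  (forall t y, (0 <= t <= pi)%R -> U y -> (0 <= a t + b t * dot y (dir t))%R) ->
  \int[leb2]_(l in strip h x) (a l.1 + b l.1 * l.2)%:E =
  (2 * h)%:E * \int[leb]_(t in `[0%R, pi]) (a t + b t * dot x (dir t))%:E.
Proof.
move=> h0 Ux ma mb pos.
have mq : measurable_fun [set: R * R] (fun l => (a l.1 + b l.1 * l.2)%:E).
  apply/measurable_EFinP; apply: measurable_funD; first exact: (measurableT_comp ma).
  by apply: measurable_funM => //; exact: (measurableT_comp mb).
have mx : measurable_fun [set: R] (fun t => (a t + b t * dot x (dir t))%:E).
  apply/measurable_EFinP; apply: measurable_funD => //.
  by apply: measurable_funM => //; apply: measurable_dot => //; exact: measurable_dir.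
have Uxx : U x by exact: core_sub Ux.
rewrite integral_mkcond ge0_integral_leb2; last 2 first.
- by apply/(measurable_restrictT _ (measurable_strip h x)); exact: measurable_funTS.
- move=> l; rewrite patchE; case: ifP => //; rewrite inE => xl.
  have [l01 [y Uy <-]] := strip_sub_lines Ux xl.
  by rewrite lee_fin pos.
rewrite -ge0_integralZl//; last 3 first.
- exact: measurable_funTS.
- by move=> t; rewrite /= in_itv/= => t01; rewrite lee_fin pos.
- by rewrite lee_fin mulr_ge0// ltW.
rewrite [RHS]integral_mkcond; apply: eq_integral => t _; rewrite [RHS]patchE.
case: ifPn => [|/negP]; rewrite inE/= in_itv/= => t01; last first.
  apply: integral0_eq => p _; rewrite patchE ifF//; apply/negbTE/negP.
  by rewrite inE => -[].
rewrite -EFinM -integral_affine// [RHS]integral_mkcond; apply: eq_integral => p _.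
rewrite !patchE; congr (if _ then _ else _); apply/idP/idP; rewrite !inE/= in_itv/=.
- by move=> [_ /=]; rewrite ltr_norml => ?; lra.
- by move=> h12; split => //=; rewrite ltr_norml; lra.
Qed.

(** Testing the energy against the function [a + b p] on the lines that meet
    [U]; the hypothesis says that its average over the lines through a point of
    [U] does not depend on the point. *)
Lemma energy_test U mu (a b : R -> R) (J : R) :
  open U -> mu U = 1 -> measurable_fun setT a -> measurable_fun setT b ->
  (forall t y, (0 <= t <= pi)%R -> U y -> (0 <= a t + b t * dot y (dir t))%R) ->
  (forall y, U y ->
     \int[leb]_(t in `[0%R, pi]) (a t + b t * dot y (dir t))%:E = J%:E) ->
  (2 * J)%:E <= energy mu +
    \int[leb2]_(l in lines U) ((a l.1 + b l.1 * l.2) ^+ 2)%:E.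
Proof.
move=> oU muU ma mb pos avg.
have [Eoo|] := eqVneq (energy mu) +oo.
  rewrite Eoo addye ?leey// gt_eqF// (@lt_le_trans _ _ 0)//.
  by apply: integral_ge0 => l _; rewrite lee_fin sqr_ge0.
rewrite -ltey => Efin.
have [x0 Ux0] : U !=set0.
  by apply/set0P/eqP => U0; move: muU; rewrite U0 measure0 => /eqP; rewrite eq_sym onee_eq0.
have J0 : (0 <= J)%R.
  rewrite -lee_fin -(avg _ Ux0); apply: integral_ge0 => t; rewrite /= in_itv/= => t01.
  by rewrite lee_fin pos.
have mL := measurable_lines oU.
have mlin : measurable_fun [set: R * R] (fun l => a l.1 + b l.1 * l.2)%R.
  apply: measurable_funD; first exact: (measurableT_comp ma).
  by apply: measurable_funM => //; exact: (measurableT_comp mb).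
pose q l := (\1_(lines U) l * (a l.1 + b l.1 * l.2))%R.
have mq : measurable_fun [set: R * R] q.
  by apply: measurable_funM => //; exact: measurable_indic.
have q0 l : (0 <= q l)%R.
  rewrite /q indicE; case: (boolP (_ \in _)); rewrite ?mul0r// mul1r inE.
  by move=> [l01 [y Uy <-]]; exact: pos.
have qE : \int[leb2]_l (q l ^+ 2)%:E =
   \int[leb2]_(l in lines U) ((a l.1 + b l.1 * l.2) ^+ 2)%:E.
  rewrite [RHS]integral_mkcond; apply: eq_integral => l _; rewrite patchE /q indicE.
  by case: ifP; rewrite ?mul1r ?mul0r ?expr0n.
rewrite -qE.
set Q := \int[leb2]_l _.
have key h : (0 < h)%R -> (2 * J)%:E * mu (core U h) <= strip_energy h mu + Q.
  move=> h0; apply: le_trans (strip_test mu h0 mq q0).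
  rewrite EFinM -muleA lee_wpmul2l// ?lee_fin//.
  rewrite -[leLHS]integral_cst; last exact: measurable_core.
  rewrite [leLHS]integral_mkcond.
  have [mstrip _] := integral_strip_swap h mu (measurableT_comp (@EFin_measurable R setT) mq) q0.
  apply: ge0_le_integral => //.
  - by move=> x _; rewrite patchE; case: ifP => //; rewrite lee_fin.
  - by apply/(measurable_restrictT _ (measurable_core U h)); exact: measurable_cst.
  - exact: measurable_funeM.
  - move=> x _; rewrite patchE; case: ifPn => [|_]; last first.
      apply: mule_ge0; first by rewrite lee_fin invr_ge0 mulr_ge0// ltW.
      by apply: integral_ge0 => l _; rewrite lee_fin.
    rewrite inE => Uhx.
    have -> : \int[leb2]_(l in strip h x) (q l)%:E = (2 * h)%:E * J%:E.
      rewrite -(avg x (core_sub h0 Uhx)) -(integral_strip_affine h0 Uhx ma mb pos).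
      apply: eq_integral => l; rewrite inE => xl; rewrite /q indicE mem_set ?mul1r//.
      exact: strip_sub_lines Uhx _ xl.
    have hh : (2 * h != 0)%R by rewrite gt_eqF// mulr_gt0.
    by rewrite muleA -!EFinM mulVf// mul1r.
have c1 : (2 * J)%:E * mu (core U n.+1%:R^-1%R) @[n --> \oo] --> (2 * J)%:E.
  rewrite -[X in _ --> X]mule1 -muU; apply: cvgeMl => //; exact: cvg_mu_core.
have c2 : strip_energy n.+1%:R^-1%R mu + Q @[n --> \oo] --> energy mu + Q.
  apply: cvgeD; [|exact: cvg_strip_energy|exact: cvg_cst].
  by apply: fin_num_adde_defr; rewrite ge0_fin_numE// energy_ge0.
rewrite -(cvg_lim _ c1)// -(cvg_lim _ c2)//; apply: lee_lim.
- by apply/cvg_ex; eexists; exact: c1.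
- by apply/cvg_ex; eexists; exact: c2.
- by apply: nearW => n; exact: key.
Qed.

End EnergyTest.

(** * Covers and Hausdorff measure *)

Section Covers.
Context {R : realType}.
Local Open Scope ereal_scope.
Implicit Types (A B F : set (R * R)) (x y : R * R).

Lemma eucl_diam_ge0 A : 0 <= eucl_diam A.
Proof. by apply: ereal_sup_ubound; left. Qed.

Lemma eucl_diam_ge A x y : A x -> A y -> (eucl_dist x y)%:E <= eucl_diam A.
Proof. by move=> Ax Ay; apply: ereal_sup_ubound; right; exists (x, y). Qed.

Lemma eucl_diam_le A (d : R) : (0 <= d)%R ->
  (forall x y, A x -> A y -> (eucl_dist x y <= d)%R) -> eucl_diam A <= d%:E.
Proof.
move=> d0 H; apply: ge_ereal_sup => _ [->|[[x y] [/= Ax Ay] <-]]; rewrite lee_fin//.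
exact: H.
Qed.

Lemma hausdorff1_pre_ge0 (d : R) A : 0 <= hausdorff1_pre d A.
Proof.
apply: le_ereal_inf_tmp => _ [F _ <-]; apply: nneseries_ge0 => i _ _.
exact: eucl_diam_ge0.
Qed.

Lemma hausdorff1_ge0 A : 0 <= hausdorff1 A.
Proof.
apply: (le_trans (hausdorff1_pre_ge0 1 A)); apply: ereal_sup_ubound.
by exists 1%R => //=.
Qed.

(** Any cover can be fattened into an open one at an arbitrarily small cost,
    which makes strict bounds on the diameters available. *)
Lemma hausdorff1_open_cover A (H d : R) : hausdorff1 A < H%:E -> (0 < d)%R ->
  exists (F : nat -> set (R * R)) (e : nat -> R),
  [/\ forall i, open (F i),
      forall i x y, F i x -> F i y -> (eucl_dist x y < e i)%R,
      forall i, (0 < e i < d)%R,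
      A `<=` \bigcup_i F i &
      forall n, (\sum_(i < n) e i <= H)%R].
Proof.
move=> AH d0.
have d20 : (0 < d / 2)%R by rewrite divr_gt0.
have : hausdorff1_pre (d / 2) A < H%:E.
  apply: le_lt_trans AH; apply: ereal_sup_ubound; by exists (d / 2)%R.
move=> /ereal_inf_lt[_ [F0 [/= AF diamF] <-]] SH.
pose D i := fine (eucl_diam (F0 i)).
have DE i : eucl_diam (F0 i) = (D i)%:E.
  rewrite /D fineK// ge0_fin_numE ?eucl_diam_ge0//.
  by rewrite (le_lt_trans (diamF i))// ltry.
have D0 i : (0 <= D i)%R by rewrite -lee_fin -DE eucl_diam_ge0.
have Dd i : (D i <= d / 2)%R by rewrite -lee_fin -DE.
have [S SE] : exists S : R, \sum_(0 <= i <oo) eucl_diam (F0 i) = S%:E.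
  exists (fine (\sum_(0 <= i <oo) eucl_diam (F0 i))); rewrite fineK//.
  rewrite ge0_fin_numE; first by rewrite (lt_trans SH)// ltry.
  by apply: nneseries_ge0 => i _ _; exact: eucl_diam_ge0.
move: SH; rewrite SE lte_fin => SH.
have partial n : (\sum_(i < n) D i <= S)%R.
  rewrite -lee_fin -SE -sumEFin -(big_mkord xpredT (fun i => (D i)%:E)).
  under eq_bigr do rewrite -DE.
  by apply: nneseries_lim_ge => i _ _; exact: eucl_diam_ge0.
(* The total cost of the fattening is twice the sum of [(H - S) / 2^(i + 2)],
   hence at most [H - S]. *)
pose eta i : R := (Num.min (d / 8) ((H - S) / 2 ^+ i.+2))%R.
have g0 : (0 < H - S)%R by rewrite subr_gt0.
have eta0 i : (0 < eta i)%R.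
  by rewrite lt_min !divr_gt0// exprn_gt0.
pose F i := [set x | exists2 y, F0 i y & (eucl_dist x y < eta i)%R].
exists F, (fun i => D i + 2 * eta i)%R; split.
- move=> i; apply/open_euclP => x [y Fy xy]; exists (eta i - eucl_dist x y)%R.
    by rewrite subr_gt0.
  move=> z xz; exists y => //; rewrite (le_lt_trans (eucl_dist_triangle x _ _))//.
  by rewrite -ltrBrDr eucl_distC.
- move=> i x y [x' Fx' xx'] [y' Fy' yy'].
  have := eucl_diam_ge Fx' Fy'; rewrite DE lee_fin => Dxy.
  have := eucl_dist_triangle x' x y; have := eucl_dist_triangle y' x' y.
  rewrite (eucl_distC y'); lra.
- move=> i; have := eta0 i; have := D0 i; have := Dd i.
  have : (eta i <= d / 8)%R by rewrite ge_min lexx.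
  lra.
- move=> x /AF[i _ Fx]; exists i => //; exists x => //.
  by rewrite eucl_distxx.
- move=> n; rewrite big_split/= -mulr_sumr.
  have : (\sum_(i < n) eta i <= (H - S) / 2)%R.
    have h : (\sum_(i < n) eta i <= (H - S) / 2 * (1 - (2 ^+ n)^-1))%R.
      elim: n => [|n IH]; first by rewrite big_ord0 expr0 invr1 subrr mulr0.
      rewrite big_ord_recr/=; have : (eta n <= (H - S) / 2 ^+ n.+2)%R.
        by rewrite ge_min lexx orbT.
      rewrite !exprS; have : (0 < (2 ^+ n : R))%R by rewrite exprn_gt0.
      move: IH; set p := (2 ^+ n)%R => IH p0.
      have -> : ((H - S) / (2 * (2 * p)) = (H - S) / 2 * (p^-1 / 2))%R.
        by field; rewrite gt_eqF.
      have -> : ((2 * p)^-1 = p^-1 / 2)%R by field; rewrite gt_eqF.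
      nra.
    have p0 : (0 <= (2 ^+ n)^-1 :> R)%R by rewrite invr_ge0 exprn_ge0.
    apply: le_trans h _; move: p0 g0; nra.
  have := partial n; lra.
Qed.

Lemma compact_cover_nat A (F : nat -> set (R * R)) : compact A ->
  (forall i, open (F i)) -> A `<=` \bigcup_i F i ->
  exists n, A `<=` \bigcup_(i < n) F i.
Proof.
move=> /compact_near_coveringP cA oF AF.
have [|n _ nA] := cA nat (nbhs \oo) (fun n x => (\bigcup_(i < n) F i) x) _.
  move=> x /AF[i _ Fix]; exists (F i, [set n | (i < n)%N]).
    split => /=; last by exists i.+1.
    by apply: open_nbhs_nbhs; split => //; exact: oF.
  by move=> [y n] [/= Fiy iltn]; exists i.
by exists n; exact: (nA n (leqnn n)).
Qed.

Lemma hausdorff1_finite_cover A (H d : R) : compact A -> hausdorff1 A < H%:E ->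
  (0 < d)%R ->
  exists n (F : nat -> set (R * R)) (e : nat -> R),
  [/\ forall i, open (F i),
      forall i x y, F i x -> F i y -> (eucl_dist x y < e i)%R,
      forall i, (0 < e i < d)%R,
      A `<=` \bigcup_(i < n) F i &
      (\sum_(i < n) e i <= H)%R].
Proof.
move=> cA AH d0; have [F [e [oF Fe ed AF S]]] := hausdorff1_open_cover AH d0.
have [n An] := compact_cover_nat cA oF AF.
by exists n, F, e; split.
Qed.

End Covers.

(** * Measures of finite energy *)

Section FiniteEnergy.
Context {R : realType}.
Local Open Scope ereal_scope.
Implicit Types (A B F : set (R * R)) (x y : R * R) (mu : probability (R * R)%type R).

Lemma measurable_eucl_dist :
  measurable_fun setT (fun z : (R * R) * (R * R) => eucl_dist z.1 z.2).
Proof.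
have -> : (fun z : (R * R) * (R * R) => eucl_dist z.1 z.2) = (fun z => norm2 (z.1 - z.2)%R) by [].
by apply: measurable_norm2; apply: measurable_planeB.
Qed.

(** A measure of finite energy does not see the diagonal, so that its energy
    concentrated near the diagonal is small. *)
Lemma cvg_near_diagonal_energy mu : energy mu < +oo ->
  \int[mu \x mu]_(z in [set z | (eucl_dist z.1 z.2 < n.+1%:R^-1)%R])
     riesz_kernel z.1 z.2 @[n --> \oo] --> 0.
Proof.
move=> E; have ik := integrable_riesz_kernel E.
pose D n : set ((R * R) * (R * R)) := [set z | (eucl_dist z.1 z.2 < n.+1%:R^-1)%R].
have mD n : measurable (D n).
  by apply: measurable_set_ltr => //; exact: measurable_eucl_dist.
have mk := @measurable_riesz_kernel R.
pose f n := (fun z : (R * R) * (R * R) => riesz_kernel z.1 z.2) \_ (D n).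
rewrite [X in X @ _](_ : _ = (fun n => \int[mu \x mu]_z f n z)); last first.
  by apply/funext => n; rewrite integral_mkcond.
have [] // := @dominated_convergence _ _ _ (mu \x mu) setT measurableT f
  (fun=> 0) (fun z => riesz_kernel z.1 z.2).
- by move=> n; apply/(measurable_restrictT _ (mD n)); exact: measurable_funTS.
- have := integrable_ae measurableT ik; apply: filterS => z /(_ I) kz _.
  have zz : z.1 != z.2.
    by apply: contraPneq kz => ->; rewrite riesz_kernelxx.
  have d0 := eucl_dist_gt0 zz.
  apply: cvg_near_cst.
  have := near_infty_natSinv_lt (PosNum d0); apply: filterS => n /= dn.
  rewrite /f patchE ifF//; apply/negbTE/negP; rewrite inE /D /= => /(lt_trans dn).
  by rewrite ltxx.
- apply: aeW => z n _; rewrite /f patchE; case: ifP => _.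
    by rewrite gee0_abs// riesz_kernel_ge0.
  by rewrite abse0 riesz_kernel_ge0.
- by move=> _ _; rewrite integral0.
Qed.

(** If disjoint pieces of [A] have masses [m i] and diameters at most [e i],
    the energy near the diagonal is at least the sum of [m i ^ 2 / e i], hence
    at least [2 c mu(A) - c^2 H] for every [c > 0] when the [e i] sum to at
    most [H]. As this part of the energy tends to 0 with the diameters, [mu A]
    vanishes. *)
Lemma finite_energy_null mu A : energy mu < +oo ->
  compact A -> measurable A -> hausdorff1 A < +oo -> mu A = 0.
Proof.
move=> E cA mA HA; have cT := cvg_near_diagonal_energy E.
have [H AH] : exists H : R, hausdorff1 A < H%:E.
  have Hfin : hausdorff1 A \is a fin_num by rewrite ge0_fin_numE// hausdorff1_ge0.
  by exists (fine (hausdorff1 A) + 1)%R; rewrite EFinD fineK// lteDl.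
have [mA' muA] : exists r : R, mu A = r%:E.
  by exists (fine (mu A)); rewrite fineK//; exact: fin_num_measure.
have mA0 : (0 <= mA')%R by rewrite -lee_fin -muA.
pose T n := \int[mu \x mu]_(z in [set z | (eucl_dist z.1 z.2 < n.+1%:R^-1)%R])
     riesz_kernel z.1 z.2.
have H0 : (0 < H)%R by rewrite -lte_fin (le_lt_trans _ AH)// hausdorff1_ge0.
have mk := @measurable_riesz_kernel R.
have key (c : R) n : (0 < c)%R -> (2 * c * mA' - c ^+ 2 * H)%:E <= T n.
  move=> c0; have d0 : (0 < n.+1%:R^-1 :> R)%R by rewrite invr_gt0.
  have [N [F [e [oF Fe ed AF S]]]] := hausdorff1_finite_cover cA AH d0.
  have mF i : measurable (F i) by exact: open_measurable_plane.
  pose G i := seqDU F i `*` seqDU F i.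
  have mDU i : measurable (seqDU F i).
    by apply: measurableD => //; apply: bigsetU_measurable.
  have mG i : measurable (G i) by exact: measurableX.
  have DUF i : seqDU F i `<=` F i by move=> x [].
  have trivG : trivIset setT G.
    move=> i j _ _ [z [[z1 _] [z1' _]]].
    by apply: (@trivIset_seqDU _ F i j) => //; exists z.1.
  have step1 : \sum_(i < N) \int[mu \x mu]_(z in G i) riesz_kernel z.1 z.2 <= T n.
    rewrite -(big_mkord xpredT (fun i => \int[mu \x mu]_(z in G i) riesz_kernel z.1 z.2)).
    rewrite -ge0_integral_bigsetU//; last 4 first.
    - exact: iota_uniq.
    - exact: sub_trivIset trivG.
    - exact: measurable_funTS.
    - by move=> z _; exact: riesz_kernel_ge0.
    apply: ge0_subset_integral => //.
    - exact: bigsetU_measurable.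
    - by apply: measurable_set_ltr => //; exact: measurable_eucl_dist.
    - exact: measurable_funTS.
    - by move=> z _; exact: riesz_kernel_ge0.
    - move=> z; rewrite -bigcup_seq => -[i _ [z1 z2]] /=.
      rewrite (lt_trans (Fe i _ _ (DUF _ _ z1) (DUF _ _ z2)))//.
      by have /andP[] := ed i.
  (* The linear bound [2 c m - c^2 e <= m^2 / e] makes the sum over the pieces
     immediate. *)
  have step2 i : (2 * c * fine (mu (seqDU F i)) - c ^+ 2 * e i)%:E <=
      \int[mu \x mu]_(z in G i) riesz_kernel z.1 z.2.
    have /andP[e0 _] := ed i.
    have mfin : mu (seqDU F i) = (fine (mu (seqDU F i)))%:E.
      by rewrite fineK//; exact: fin_num_measure.
    apply: (@le_trans _ _ (\int[mu \x mu]_(z in G i) ((e i)^-1%:E))); last first.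
      apply: ge0_le_integral => //.
      - by move=> z _; rewrite lee_fin invr_ge0 ltW.
      - exact: measurable_funTS.
      - move=> z [z1 z2]; have [->|zz] := eqVneq z.1 z.2.
          by rewrite riesz_kernelxx leey.
        rewrite riesz_kernelE// lee_fin lef_pV2 ?posrE//; last exact: eucl_dist_gt0.
        by rewrite ltW//; apply: Fe; exact: DUF.
    have -> : \int[mu \x mu]_(z in G i) ((e i)^-1%:E) =
        (e i)^-1%:E * (mu (seqDU F i) * mu (seqDU F i)).
      by rewrite integral_cst//; congr (_ * _); exact: product_measure1E.
    set m := fine _ in mfin *; rewrite mfin -!EFinM lee_fin.
    rewrite [leRHS]mulrC ler_pdivlMr//.
    by have := sqr_ge0 (m - c * e i); rewrite !expr2; nra.
  apply: le_trans step1; apply: (@le_trans _ _ (\sum_(i < N) (2 * c * fine (mu (seqDU F i)) - c ^+ 2 * e i)%:E)); last first.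
    by apply: lee_sum => i _; exact: step2.
  rewrite sumEFin lee_fin sumrB -!mulr_sumr lerB//; last first.
    by rewrite ler_wpM2l// sqr_ge0.
  rewrite ler_wpM2l//; first by rewrite mulr_ge0// ltW.
  rewrite -lee_fin -muA -sumEFin.
  have -> : \sum_(i < N) (fine (mu (seqDU F i)))%:E = mu (\big[setU/set0]_(i < N) F i).
    rewrite bigsetU_seqDU measure_bigsetU//.
    by apply: eq_bigr => i _; rewrite fineK//; exact: fin_num_measure.
  apply: le_measure; rewrite ?inE//; first exact: bigsetU_measurable.
  by rewrite bigcup_mkord in AF *.
have key2 (c : R) : (0 < c)%R -> (2 * c * mA' <= c ^+ 2 * H)%R.
  move=> c0; rewrite -subr_le0 -lee_fin; apply: (cvge_to_ge cT).
  by apply: nearW => n; exact: key.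
rewrite muA; congr EFin; apply/eqP; rewrite eq_le mA0 andbT leNgt; apply/negP => mAp.
(* This [c] is the minimizer of [c^2 H - 2 c mu(A)]. *)
have c0 : (0 < mA' / H)%R by rewrite divr_gt0.
have := key2 _ c0; apply/negP; rewrite -ltNge.
have -> : ((mA' / H) ^+ 2 * H = mA' / H * mA')%R by field; rewrite gt_eqF.
have : (0 < mA' / H * mA')%R by rewrite mulr_gt0.
lra.
Qed.

Lemma ge0_integral_full mu A (f : R * R -> \bar R) : measurable A -> mu A = 1 ->
  measurable_fun setT f -> (forall x, 0 <= f x) ->
  \int[mu]_(x in A) f x = \int[mu]_x f x.
Proof.
move=> mA A1 mf f0.
have An : mu (~` A) = 0 by rewrite probability_setC// A1 subee.
rewrite -(setUv A) ge0_integral_setU//; last 3 first.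
- exact: measurableC.
- by rewrite setUv.
- by apply/disj_setPS => x [].
by rewrite (null_set_integral _ _ An) ?adde0//; [exact: measurableC|exact: measurable_funTS].
Qed.

End FiniteEnergy.

(** * Closed subsets of a line with a covered boundary *)

Section Slices.
Context {R : realType}.
Implicit Types (a b c t : R) (S : set R).

Lemma seq_argmin (f : nat -> R) (P : pred nat) (s : seq nat) : has P s ->
  exists i, [/\ i \in s, P i & forall j, j \in s -> P j -> f i <= f j].
Proof.
elim: s => //= k s IH; have [hs|/hasPn hs] := boolP (has P s); last first.
  rewrite orbF => Pk; exists k; split; rewrite ?mem_head// => j.
  by rewrite inE => /predU1P[->//|/hs/negP].
move=> _; have [i [si Pi mi]] := IH hs; have [Pk|nPk] := boolP (P k); last first.
  exists i; split; rewrite ?in_cons ?si ?orbT// => j.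
  by rewrite in_cons => /predU1P[->|]; [rewrite (negbTE nPk)|exact: mi].
have [ki|ik] := leP (f k) (f i).
  exists k; split; rewrite ?mem_head// => j; rewrite in_cons => /predU1P[->//|sj Pj].
  exact: le_trans ki (mi j sj Pj).
exists i; split; rewrite ?in_cons ?si ?orbT// => j.
by rewrite in_cons => /predU1P[->|]; [rewrite ltW|exact: mi].
Qed.

Lemma itv_no_boundary S a b : closed S -> a <= b ->
  (forall x, a <= x <= b -> S x -> S° x) ->
  `[a, b]%classic `<=` S \/ `[a, b]%classic `<=` ~` S.
Proof.
move=> cS ab Sbd; have [[x [xab Sx]]|nS] := pselect (exists x, `[a, b]%classic x /\ S x).
  left; have cI := @segment_connected R a b.
  have <- : `[a, b]%classic `&` S = `[a, b]%classic; last by move=> ? [].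
  apply: cI.
  - by exists x.
  - exists S°; first exact: open_interior.
    apply/seteqP; split => y [yab Sy]; split => //; last exact: interior_subset.
    by apply: Sbd => //; move: yab; rewrite /= in_itv.
  - by exists S.
by right => x xab Sx; apply: nS; exists x.
Qed.

(** An additive interval function [I] that behaves like the integral of the
    derivative of [phi] over [S] is controlled by the values of [phi] near the
    boundary of [S], each interval of the cover being charged once. *)
Lemma slice_bound S (phi : R -> R) (I : R -> R -> R) (L b : R) (t e : nat -> R) :
  closed S -> ~ S b -> 0 <= L ->
  (forall x, 0 <= phi x) ->
  (forall x y, `|phi x - phi y| <= L * `|x - y|) ->
  (forall i, 0 < e i) ->
  (forall x y z, x <= y <= z -> I x z = I x y + I y z) ->
  (forall x y, x <= y -> `|I x y| <= L * (y - x)) ->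
  (forall x y, x <= y -> `[x, y]%classic `<=` S -> I x y = phi y - phi x) ->
  (forall x y, x <= y -> `[x, y]%classic `<=` ~` S -> I x y = 0) ->
  forall s a, a <= b ->
  (forall x, a <= x <= b -> S x -> ~ S° x -> exists2 i, i \in s & `|x - t i| < e i) ->
  `|I a b + \1_S a * phi a| <= \sum_(i <- s) (phi (t i) + 4 * L * e i).
Proof.
move=> cS Sb L0 phi0 phiL e0 Iadd IL IS IC s.
have term0 i : 0 <= phi (t i) + 4 * L * e i.
  by rewrite addr_ge0// mulr_ge0 ?mulr_ge0// ltW.
have I0 x : I x x = 0.
  apply/eqP; rewrite -normr_le0 (le_trans (IL x x (lexx x)))// subrr mulr0//.
have [n] := ubnP (size s); elim: n s => // n IHn s; rewrite ltnS => sn a ab bd.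
(* Among the intervals of the cover that contain a boundary point in [[a, b]],
   the one with the smallest left end is removed first. It meets [[a, b]] in
   [[l, r]]: before [l] there is no boundary point, and [[r, b]] is treated by
   induction with one interval less. *)
pose P i := `[< exists x, [/\ a <= x <= b, S x, ~ S° x & `|x - t i| < e i] >].
have [hP|/hasPn nP] := boolP (has P s); last first.
  have [] := itv_no_boundary cS ab.
  - move=> x xab Sx; apply: contrapT => nSx; have [i si xi] := bd x xab Sx nSx.
    by have /negP := nP i si; apply; apply/asboolP; exists x.
  - by move=> /(_ b) abS; exfalso; apply/Sb/abS; rewrite /= in_itv/= ab lexx.
  - move=> abS; rewrite (IC _ _ ab abS) indicE memNset ?mul0r ?addr0 ?normr0.
      by rewrite big_seq sumr_ge0.
    by apply: abS; rewrite /= in_itv/= lexx ab.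
have [i [si /asboolP[x0 [/andP[ax0 x0b] Sx0 nSx0 x0i]] mini]] :=
  seq_argmin (fun i => t i - e i) hP.
rewrite (perm_big _ (perm_to_rem si))/= big_cons.
have ei := e0 i.
move: x0i; rewrite ltr_norml => /andP[x0l x0r].
pose l := Num.max a (t i - e i); pose r := Num.min b (t i + e i).
have al : a <= l by rewrite le_max lexx.
have lr : l <= r.
  by rewrite ge_max !le_min ab/=; apply/andP; split; [|apply/andP; split]; lra.
have rb : r <= b by rewrite ge_min lexx.
have lti : t i - e i <= l by rewrite le_max lexx orbT.
have rti : r <= t i + e i by rewrite ge_min lexx orbT.
have part1 : I a l + \1_S a * phi a = \1_S l * phi l.
  have [la|la] := eqVneq l a; first by rewrite la I0 add0r.
  have lE : l = t i - e i by move: la; rewrite /l; case: leP => // _; rewrite eqxx.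
  have [] := itv_no_boundary cS al.
  - move=> x /andP[ax xl] Sx; apply: contrapT => nSx.
    have xab : a <= x <= b by rewrite ax (le_trans xl (le_trans lr rb)).
    have [j sj xj] := bd x xab Sx nSx.
    have Pj : P j by apply/asboolP; exists x.
    have := mini j sj Pj; move: xj; rewrite ltr_norml => /andP[]; rewrite -lE; lra.
  - move=> alS; rewrite (IS _ _ al alS) !indicE !mem_set ?mul1r ?subrK//;
      by apply: alS; rewrite /= in_itv/= ?lexx ?al.
  - move=> alS; rewrite (IC _ _ al alS) !indicE !memNset ?mul0r ?addr0//;
      by apply: alS; rewrite /= in_itv/= ?lexx ?al.
have part2 := IL _ _ lr.
have part3 : `|I r b + \1_S r * phi r| <= \sum_(j <- rem i s) (phi (t j) + 4 * L * e j).
  have [br|rbn] := eqVneq r b.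
    rewrite br I0 add0r indicE memNset// mul0r normr0.
    by rewrite big_seq sumr_ge0.
  have rE : r = t i + e i by move: rbn; rewrite /r; case: leP => //; rewrite ?eqxx.
  apply: IHn => //.
    by apply: leq_trans sn; rewrite size_rem// ltn_predL; case: (s) si.
  move=> x /andP[rx xb] Sx nSx; have [|j sj xj] := bd x _ Sx nSx.
    by rewrite (le_trans al (le_trans lr rx)).
  exists j => //; have ji : j != i.
    apply/eqP => ji; move: xj; rewrite ji ltr_norml => /andP[_]; lra.
  by move: sj; rewrite (perm_mem (perm_to_rem si)) in_cons (negbTE ji).
(* The removed interval pays for the change of [phi] on [S] between [l] and
   [r], and for the integral in between. *)
have jump : `|\1_S l * phi l - \1_S r * phi r| <= phi (t i) + L * e i.
  have bnd x : t i - e i <= x <= t i + e i -> phi x <= phi (t i) + L * e i.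
    move=> /andP[x1 x2]; have := phiL x (t i); rewrite ler_norml => /andP[_ h].
    have : `|x - t i| <= e i by rewrite ler_norml; apply/andP; split; lra.
    by move=> /(ler_wpM2l L0); lra.
  have bl : phi l <= phi (t i) + L * e i by apply: bnd; apply/andP; split => //; exact: le_trans lr rti.
  have br : phi r <= phi (t i) + L * e i by apply: bnd; apply/andP; split => //; exact: le_trans lti lr.
  move: (phi0 l) (phi0 r) bl br; rewrite !indicE.
  move: (phi l) (phi r) (phi (t i) + L * e i) => u v w; clear.
  by case: (l \in S); case: (r \in S) => /=; rewrite ?mul1r ?mul0r ler_norml => *;
    apply/andP; split; lra.
have -> : I a b + \1_S a * phi a =
    (\1_S l * phi l - \1_S r * phi r) + I l r + (I r b + \1_S r * phi r).
  rewrite (Iadd a l b) ?al ?(le_trans lr)// (Iadd l r b) ?lr//; move: part1; lra.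
apply: (le_trans (ler_normD _ _)); apply: lerD => //.
apply: (le_trans (ler_normD _ _)).
have : L * (r - l) <= L * (2 * e i) by rewrite ler_wpM2l//; lra.
have : 0 <= L * e i by rewrite mulr_ge0// ltW.
lra.
Qed.

End Slices.

(** * A mollifier *)

Section Mollifier.
Context {R : realType}.
Implicit Types (t s e : R) (u v x y z : R * R).

Definition pospart s : R := Num.max 0 s.

Lemma pospart_ge0 s : 0 <= pospart s.
Proof. by rewrite le_max lexx. Qed.

Lemma continuous_pospart : continuous pospart.
Proof. by move=> s; apply: continuous_max => //; exact: cvg_cst. Qed.

Lemma is_derive_sqr_pospart s : is_derive s 1 (fun s => pospart s ^+ 2) (2 * pospart s).
Proof.
have [s0|s0|->] := ltgtP s 0.
- have -> : 2 * pospart s = 0 by rewrite /pospart max_l ?mulr0// ltW.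
  apply: (@near_eq_is_derive _ _ _ (fun=> 0)) => //.
  near=> z; rewrite /pospart max_l ?expr0n//.
  by rewrite ltW//; near: z; exact: lt_nbhsl.
- have -> : 2 * pospart s = 2 * s by rewrite /pospart max_r// ltW.
  apply: (@near_eq_is_derive _ _ _ (fun s => s ^+ 2)) => //.
    near=> z; rewrite /pospart max_r//.
    by rewrite ltW//; near: z; exact: lt_nbhsr.
  by apply: trigger_derive; rewrite /GRing.scale/=; ring.
- have -> : 2 * pospart 0 = 0 :> R by rewrite /pospart maxxx mulr0.
  have h : (fun h : R => h^-1 *: (pospart (h *: 1 + 0) ^+ 2 - pospart 0 ^+ 2)) @ 0^' --> (0 : R).
    apply/cvgr0Pnorm_le => d d0; near=> h.
    have hd : `|h| <= d by near: h; exact: dnbhs0_le.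
    rewrite /pospart maxxx expr0n subr0 addr0 /GRing.scale/= mulr1.
    have [h0|h0] := leP h 0; first by rewrite expr0n mulr0 normr0 ltW.
    by rewrite expr2 mulrA mulVf ?mul1r// gt_eqF.
  apply: DeriveDef; first by apply/cvg_ex; exists 0; exact: h.
  exact/cvg_lim.
Unshelve. all: end_near. Qed.

(** A continuously differentiable bump supported in the disc of radius [e],
    and its gradient. *)
Definition bump e z : R := pospart (e ^+ 2 - (z.1 ^+ 2 + z.2 ^+ 2)) ^+ 2.
Definition dbump e z : R * R :=
  (- 4 * pospart (e ^+ 2 - (z.1 ^+ 2 + z.2 ^+ 2))) *: z.

Lemma bump_ge0 e z : 0 <= bump e z. Proof. exact: sqr_ge0. Qed.

Lemma bumpN e z : bump e (- z) = bump e z.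
Proof. by rewrite /bump/= !sqrrN. Qed.

Lemma bump_eq0 e z : 0 < e -> e <= norm2 z -> bump e z = 0.
Proof.
move=> e0 ez; rewrite /bump /pospart -sqr_norm2 max_l ?expr0n// subr_le0.
by rewrite ler_sqr// nnegrE ?norm2_ge0// ltW.
Qed.

Lemma dbump_eq0 e z : 0 < e -> e <= norm2 z -> dbump e z = 0.
Proof.
move=> e0 ez; rewrite /dbump /pospart -sqr_norm2 max_l ?mulr0 ?scale0r// subr_le0.
by rewrite ler_sqr// nnegrE ?norm2_ge0// ltW.
Qed.

Lemma bump_le e z : bump e z <= e ^+ 4.
Proof.
have -> : e ^+ 4 = (e ^+ 2) ^+ 2 by rewrite -exprM.
rewrite ler_sqr ?nnegrE ?pospart_ge0 ?sqr_ge0// /pospart ge_max sqr_ge0/=.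
by rewrite gerBl addr_ge0// sqr_ge0.
Qed.

Lemma norm_dbump e z : 0 < e -> norm2 (dbump e z) <= 4 * e ^+ 3.
Proof.
move=> e0; have [ez|ze] := leP e (norm2 z).
  by rewrite dbump_eq0// norm20 mulr_ge0// exprn_ge0// ltW.
rewrite norm2Z mulNr normrN ger0_norm ?mulr_ge0 ?pospart_ge0//.
have -> : 4 * e ^+ 3 = (4 * e ^+ 2) * e by ring.
apply: ler_pM; rewrite ?norm2_ge0 ?mulr_ge0 ?pospart_ge0//; last exact: ltW.
rewrite ler_pM2l// /pospart ge_max sqr_ge0/= gerBl.
by rewrite addr_ge0// sqr_ge0.
Qed.

Lemma is_derive_bump e z u t :
  is_derive t 1 (fun t => bump e (z + t *: u)) (dot (dbump e (z + t *: u)) u).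
Proof.
pose g t : R := e ^+ 2 - ((z.1 + t * u.1) ^+ 2 + (z.2 + t * u.2) ^+ 2).
have dg : is_derive t 1 g (- 2 * ((z.1 + t * u.1) * u.1 + (z.2 + t * u.2) * u.2)).
  by apply: trigger_derive; rewrite /GRing.scale/=; ring.
have := @is_derive1_comp _ (fun s => pospart s ^+ 2) g t _ _ (is_derive_sqr_pospart (g t)) dg.
move=> h; apply: (is_derive_eq h).
by rewrite /dot /dbump/= /GRing.scale/= /GRing.scale/= /g; ring.
Qed.

Lemma continuous_line_comp (g : R * R -> R) z u : continuous g ->
  continuous (fun t => g (z + t *: u)).
Proof.
move=> cg t; apply: (@continuous_comp _ _ _ (fun t => z + t *: u) g).
  by apply: cvgD; [exact: cvg_cst|apply: cvgZr_tmp; exact: cvg_id].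
exact: cg.
Qed.

Lemma continuous_gap e : continuous (fun z : R * R => e ^+ 2 - (z.1 ^+ 2 + z.2 ^+ 2)).
Proof.
move=> z; apply: cvgB; first exact: cvg_cst.
by apply: cvgD; apply: (@cvgM _ _ _ _ _ _ _ _) ; do ?[exact: cvg_fst|exact: cvg_snd].
Qed.

Lemma continuous_dbump e u : continuous (fun z => dot (dbump e z) u).
Proof.
move=> z; have cp : (fun z : R * R => - 4 * pospart (e ^+ 2 - (z.1 ^+ 2 + z.2 ^+ 2))) @ z -->
    - 4 * pospart (e ^+ 2 - (z.1 ^+ 2 + z.2 ^+ 2)).
  apply: cvgM; first exact: cvg_cst.
  by apply: continuous_cvg; [exact: continuous_pospart|exact: continuous_gap].
apply: cvgD; apply: cvgM; try exact: cvg_cst.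
- by apply: cvgM => //; exact: cvg_fst.
- by apply: cvgM => //; exact: cvg_snd.
Qed.

Lemma continuous_bump e : continuous (bump e).
Proof.
move=> z; rewrite /bump; under eq_fun do rewrite expr2; rewrite expr2.
by apply: cvgM; apply: continuous_cvg; do ?[exact: continuous_pospart|exact: continuous_gap].
Qed.

Lemma bump_lipschitz e y z : 0 < e ->
  `|bump e y - bump e z| <= 4 * e ^+ 3 * eucl_dist y z.
Proof.
move=> e0; rewrite distrC.
have [] := @MVT_segment R (fun t => bump e (y + t *: (z - y)))
   (fun t => dot (dbump e (y + t *: (z - y))) (z - y)) 0 1 => //.
- by move=> t _; exact: is_derive_bump.
- apply: continuous_subspaceT; apply: continuous_line_comp; exact: continuous_bump.
move=> c _; rewrite scale0r scale1r addr0 subr0 mulr1 (addrC y) subrK => ->.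
rewrite (le_trans (normr_dot _ _))// -eucl_distE (eucl_distC z) ler_wpM2r ?eucl_dist_ge0//.
exact: norm_dbump.
Qed.

End Mollifier.

(** * Integrals over slices *)

Section SliceIntegral.
Context {R : realType}.
Implicit Types (a b t : R) (S : set R).

Lemma bounded_integrable d (T : measurableType d) (mu : {measure set T -> \bar R})
    (D : set T) (f : T -> R) (C : R) : measurable D -> (mu D < +oo)%E ->
  measurable_fun D f -> (forall x, D x -> `|f x| <= C) -> mu.-integrable D (EFin \o f).
Proof.
move=> mD fD mf fC; apply: measurable_bounded_integrable => //.
exists C; split; first by rewrite num_real.
by move=> M /ltW CM x Dx; exact: le_trans (fC x Dx) CM.
Qed.

(** The interval function to which [slice_bound] is applied is the integral of
    [dphi] over the part of [S] in the interval. *)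
Lemma slice_integral S (phi dphi : R -> R) (L b : R) (t e : nat -> R) (s : seq nat) :
  closed S -> (forall x, S x -> `|x| < b) -> 0 < b ->
  (forall x, 0 <= phi x) -> continuous dphi ->
  (forall x : R, is_derive x 1 phi (dphi x)) -> (forall x, `|dphi x| <= L) ->
  (forall i, 0 < e i) ->
  (forall x, S x -> ~ S° x -> exists2 i, i \in s & `|x - t i| < e i) ->
  (`|\int[leb]_x (\1_S x * dphi x)%:E| <= (\sum_(i <- s) (phi (t i) + 4 * L * e i))%:E)%E.
Proof.
move=> cS Sb b0 phi0 cd dphi_ dL e0 cov.
have L0 : 0 <= L by exact: le_trans (normr_ge0 _) (dL 0).
have mS : measurable S by exact: closed_measurable.
pose g x := \1_S x * dphi x.
have mg : measurable_fun [set: R] g.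
  by apply: measurable_funM; [exact: measurable_indic|exact: continuous_measurable_fun].
have gL x : `|g x| <= L.
  rewrite /g normrM indicE; case: (x \in S); rewrite ?normr1 ?normr0 ?mul1r ?mul0r//.
have ig (i : interval R) : (lebesgue_measure [set` i] < +oo)%E ->
    (@lebesgue_measure R).-integrable [set` i] (EFin \o g).
  move=> fi; apply: (bounded_integrable (C := L)) => //.
  exact: measurable_funTS.
have fi c d : (lebesgue_measure (`[c, d]%classic : set R) < +oo)%E.
  by rewrite lebesgue_measure_itv/=; case: ifP => // _; rewrite ltry.
pose I a b := \int[@lebesgue_measure R]_(x in `[a, b]) g x.
have -> : (\int[leb]_x (g x)%:E = (I (- b) b)%:E)%E.
  have -> : (\int[leb]_x (g x)%:E = \int[leb]_(x in `[(- b)%R, b]) (g x)%:E)%E.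
    rewrite [RHS]integral_mkcond; apply: eq_integral => x _ /=.
    rewrite patchE; case: ifPn => // /negP xb; congr EFin.
    rewrite /g indicE memNset ?mul0r// => /Sb; rewrite ltr_norml => /andP[x1 x2].
    by apply: xb; rewrite inE/= in_itv/= !ltW.
  rewrite integral_leb//; last exact: measurable_funTS.
  by rewrite /I /Rintegral fineK//; apply: integrable_fin_num => //; exact: ig.
rewrite lee_fin.
have Sbb : ~ S b by move=> /Sb; rewrite gtr0_norm// ltxx.
have -> : I (- b) b = I (- b) b + \1_S (- b) * phi (- b).
  rewrite indicE memNset ?mul0r ?addr0// => /Sb; rewrite normrN gtr0_norm ?ltxx//.
have FTC c d : c <= d -> \int[@lebesgue_measure R]_(x in `[c, d]) dphi x = phi d - phi c.
  move=> cd'; have := integral_FTC cd' cd dphi_.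
  rewrite integral_leb//; last by apply: measurable_funTS; exact: continuous_measurable_fun.
  by rewrite /Rintegral => ->.
apply: (@slice_bound _ S phi I L b t e) => //.
- move=> x y; wlog xy : x y / y <= x.
    by move=> h; have [|/ltW] := leP y x; [exact: h|rewrite distrC (distrC x); exact: h].
  have [] := @MVT_segment R phi dphi y x xy.
    by apply: continuous_subspaceT => z; apply: differentiable_continuous; apply/derivable1_diffP; exact: ex_derive.
  by move=> c _ ->; rewrite normrM ler_wpM2r.
- move=> x y z /andP[xy yz].
  have := @Rintegral_itvB R g (BLeft x) (BRight z) y (ig _ (fi x z)).
  rewrite !bnd_simp => /(_ xy yz).
  rewrite Rintegral_itv_obnd_cbnd; last first.
    by apply: ig; rewrite lebesgue_measure_itv/=; case: ifP => // _; rewrite ltry.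
  by move=> yzE; rewrite [X in _ = _ + X]/I -yzE addrC subrK.
- move=> x y xy; rewrite /I.
  apply: (le_trans (le_normr_Rintegral _ _)) => //; first exact: ig (fi x y).
  apply: (@le_trans _ _ (\int[@lebesgue_measure R]_(t in `[x, y]) L)).
    apply: le_Rintegral => //.
    + have := ig _ (fi x y); apply: integrable_norm.
    + apply: (bounded_integrable (C := L)); [by []|exact: fi|by []|].
      by move=> ? _; rewrite ger0_norm.
  by rewrite Rintegral_cst//= lebesgue_measure_itv/= lte_fin; case: ltP => h; rewrite ?mulr0 ?mulr_ge0 ?subr_ge0.
- move=> x y xy xyS; rewrite -FTC// /I; apply: eq_Rintegral => z zxy.
  by rewrite /g indicE mem_set ?mul1r//; apply: xyS; move: zxy; rewrite inE.
- move=> x y xy xyS; rewrite /I (@eq_Rintegral _ _ _ _ _ (fun=> 0)).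
    by rewrite /Rintegral integral0.
  move=> z zxy.
  by rewrite /g indicE memNset ?mul0r//; apply: xyS; move: zxy; rewrite inE.
- by lra.
- by move=> x _; exact: cov.
Qed.

End SliceIntegral.

(** * The mollified gradient of an indicator *)

Section Flux.
Context {R : realType}.
Implicit Types (a b t p : R) (u v x y z : R * R).

Lemma integral_frame (u : R * R) (f : R * R -> \bar R) : norm2 u = 1 ->
  leb2.-integrable [set: R * R] f ->
  (\int[leb2]_x f x = \int[leb]_p \int[leb]_t f (frame u (p, t)))%E /\
  measurable_fun [set: R] (fun p => \int[leb]_t f (frame u (p, t)))%E.
Proof.
move=> u1 fi; have mf := measurable_int _ fi.
have mfr := measurable_frame u.
have mff : measurable_fun [set: R * R] (f \o frame u) by exact: measurableT_comp.
have inv : forall A, measurable A -> leb2 (frame u @^-1` A) = leb2 A.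
  by move=> A mA; exact: leb2_frame.
have ffi : leb2.-integrable [set: R * R] (f \o frame u).
  apply/integrableP; split => //; have /integrableP[_] := fi.
  rewrite -(ge0_integral_pushforward_inv mfr inv)//.
  exact: measurableT_comp.
have ffi' : (@leb R \x @leb R)%E.-integrable [set: R * R] (f \o frame u) := ffi.
split; last exact: (measurable_fubini_F ffi').
transitivity (\int[pushforward leb2 (frame u)]_x f x)%E.
  by apply: eq_measure_integral => A mA _; exact/esym/inv.
rewrite integral_pushforward//.
exact: (esym (integral12_prod_meas1 ffi')).
Qed.

Lemma interval_cover (A : set R) (e : R) : 0 < e -> (forall x y : R, A x -> A y -> `|x - y| <= e) ->
  exists c : R, forall x : R, A x -> c <= x <= c + e.
Proof.
move=> e0 Ae; have [A0|/set0P[a Aa]] := eqVneq A set0.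
  by exists 0 => x; rewrite A0.
have hA : has_inf A.
  split; first by exists a.
  by exists (a - e) => x Ax; have := Ae a x Aa Ax; rewrite ler_norml => /andP[_]; lra.
exists (inf A) => x Ax; apply/andP; split; first by apply: ge_inf => //; case: hA.
rewrite -lerBlDr; apply: lb_le_inf; first by exists a.
by move=> y Ay; have := Ae x y Ax Ay; rewrite ler_norml => /andP[_]; lra.
Qed.

Lemma frame_dot u z : norm2 u = 1 -> z = frame u (dot z u, dot z (rot90 u)).
Proof.
move=> u1; have : u.1 ^+ 2 + u.2 ^+ 2 = 1 by rewrite -sqr_norm2 u1 expr1n.
by case: z => z1 z2; rewrite frameE /dot/= => uu; congr pair;
  rewrite -[LHS]mulr1 -uu; ring.
Qed.

Lemma dot_frame u z : norm2 u = 1 -> dot (frame u z) u = z.1.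
Proof.
move=> u1; have uu : u.1 ^+ 2 + u.2 ^+ 2 = 1 by rewrite -sqr_norm2 u1 expr1n.
by rewrite frameE /dot/= -[RHS]mulr1 -uu; ring.
Qed.

Lemma dot_frame_rot90 u z : norm2 u = 1 -> dot (frame u z) (rot90 u) = z.2.
Proof.
move=> u1; have uu : u.1 ^+ 2 + u.2 ^+ 2 = 1 by rewrite -sqr_norm2 u1 expr1n.
by rewrite frameE /dot/= -[RHS]mulr1 -uu; ring.
Qed.

Lemma norm2_frame u z : norm2 u = 1 -> norm2 (frame u z) = norm2 z.
Proof.
move=> u1; have uu : u.1 ^+ 2 + u.2 ^+ 2 = 1 by rewrite -sqr_norm2 u1 expr1n.
by rewrite frameE /norm2/=; congr Num.sqrt; rewrite -[RHS]mulr1 -uu; ring.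
Qed.

Lemma frameB u z z' : frame u z - frame u z' = frame u (z - z').
Proof. by rewrite !frameE/=; congr pair => /=; ring. Qed.

Lemma continuous_frame_line u p : continuous (fun t => frame u (p, t)).
Proof.
move=> t; rewrite /frame/=; apply: cvgD; first exact: cvg_cst.
by apply: cvgZr_tmp; exact: cvg_id.
Qed.

Section Compact.
Variables (e : R) (Om : set (R * R)).
Hypotheses (e0 : 0 < e) (cOm : compact Om).

Lemma compact_plane_closed : closed Om.
Proof. by apply: compact_closed => //; exact: norm_hausdorff. Qed.

Lemma compact_plane_measurable : measurable Om.
Proof. exact: closed_measurable_plane compact_plane_closed. Qed.

Lemma compact_plane_bounded : exists2 M, 0 < M & forall z, Om z -> norm2 z < M.
Proof.
have [M [_ hM]] := compact_bounded cOm.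
exists (2 * (`|M| + 1) + 1); first by rewrite ltr_pwDr// mulr_ge0// addr_ge0.
move=> z Oz; have h : `|z| <= `|M| + 1.
  by apply: (hM (`|M| + 1)) => //; rewrite (le_lt_trans (ler_norm _))// ltrDl.
rewrite (le_lt_trans (norm2_le_sum _))//.
have z1 : `|z.1| <= `|z| by rewrite prod_normE le_max lexx.
have z2 : `|z.2| <= `|z| by rewrite prod_normE le_max lexx orbT.
lra.
Qed.

Lemma leb2_bounded (A : set (R * R)) M : measurable A -> (forall z, A z -> norm2 z <= M) ->
  (leb2 A < +oo)%E.
Proof.
move=> mA AM; apply: (@le_lt_trans _ _ (leb2 (`[- M, M]%classic `*` `[- M, M]%classic))).
  apply: le_measure; rewrite ?inE//; first exact: measurableX.
  move=> z /AM zM; split; rewrite /= in_itv/= -ler_norml.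
    exact: le_trans (norm_fst_le _) zM.
  exact: le_trans (norm_snd_le _) zM.
have -> : leb2 (`[- M, M]%classic `*` `[- M, M]%classic) =
   (leb `[(- M)%R, M]%classic * leb `[(- M)%R, M]%classic)%E by exact: product_measure1E.
by rewrite leb_itv/=; case: ifP; rewrite ?mule0 ?ltry.
Qed.

Lemma leb2_compact_lty : (leb2 Om < +oo)%E.
Proof.
have [M _ hM] := compact_plane_bounded.
by apply: (leb2_bounded (M := M)) compact_plane_measurable _ => z /hM/ltW.
Qed.

(** The derivatives of [mollified] are the opposites of the fluxes, since the
    integrand is differentiated with respect to [x]. *)
Definition flux x u : R := (\int[leb2]_(y in Om) dot (dbump e (y - x)) u)%R.
Definition mollified x : R := (\int[leb2]_(y in Om) bump e (y - x))%R.

Lemma measurable_dbump_sub x u : measurable_fun [set: R * R] (fun y => dot (dbump e (y - x)) u).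
Proof.
apply: (@measurableT_comp _ _ _ _ _ _ (fun z => dot (dbump e z) u)).
  by apply: continuous_measurable_plane; exact: continuous_dbump.
by apply: measurable_planeB => //; exact: measurable_cst.
Qed.

Lemma integrable_dbump x u :
  leb2.-integrable Om (EFin \o (fun y => dot (dbump e (y - x)) u)).
Proof.
apply: (bounded_integrable (C := 4 * e ^+ 3 * norm2 u)) => //.
- exact: compact_plane_measurable.
- exact: leb2_compact_lty.
- by apply: measurable_funTS; exact: measurable_dbump_sub.
- by move=> y _; rewrite (le_trans (normr_dot _ _))// ler_wpM2r ?norm2_ge0 ?norm_dbump.
Qed.

Lemma integrable_bump x : leb2.-integrable Om (EFin \o (fun y => bump e (y - x))).
Proof.
apply: (bounded_integrable (C := e ^+ 4)) => //.
- exact: compact_plane_measurable.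
- exact: leb2_compact_lty.
- apply: measurable_funTS; apply: (@measurableT_comp _ _ _ _ _ _ (bump e)).
    by apply: continuous_measurable_plane; exact: continuous_bump.
  by apply: measurable_planeB => //; exact: measurable_cst.
- by move=> y _; rewrite ger0_norm ?bump_ge0 ?bump_le.
Qed.

(** The flux is computed on the lines parallel to [rot90 v]; on each of them the
    section of [Om] starts or ends only near the members of the cover that the
    line meets, and a member of diameter less than [c i] is met by lines of
    measure at most [c i]. *)
Lemma flux_le x v n (F : nat -> set (R * R)) (c : nat -> R) (y : nat -> R * R) :
  norm2 v = 1 -> (forall i, 0 < c i) ->
  (forall i z z', F i z -> F i z' -> eucl_dist z z' < c i) ->
  (forall i z, F i z -> eucl_dist z (y i) < c i) ->
  boundary Om `<=` \bigcup_(i < n) F i ->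
  `|flux x (rot90 v)| <= \sum_(i < n) (bump e (y i - x) + 20 * e ^+ 3 * c i) * c i.
Proof.
move=> v1 c0 Fc Fy cov; set u := rot90 v.
have u1 : norm2 u = 1 by rewrite norm2_rot90.
pose h z := \1_Om z * dot (dbump e (z - x)) u.
have hE : EFin \o h = (EFin \o (fun z => dot (dbump e (z - x)) u)) \_ Om.
  apply/funext => z /=; rewrite patchE /h indicE; case: (z \in Om); rewrite ?mul1r ?mul0r//.
have hi : leb2.-integrable [set: R * R] (EFin \o h).
  rewrite hE -integrable_mkcond//; last exact: compact_plane_measurable.
  exact: integrable_dbump.
have fE : (flux x u)%:E = (\int[leb2]_z (h z)%:E)%E.
  rewrite /flux /Rintegral fineK; last first.
    by apply: integrable_fin_num; [exact: compact_plane_measurable|exact: integrable_dbump].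
  rewrite integral_mkcond; apply: eq_integral => z _; by rewrite -hE.
have [hfr mh] := integral_frame v1 hi.
rewrite -lee_fin -abse_EFin fE hfr.
have dle w w' d : eucl_dist w w' < d -> `|dot w v - dot w' v| <= d.
  move=> /ltW; apply: le_trans; rewrite -dotBl (le_trans (normr_dot _ _))//.
  by rewrite v1 mulr1 -eucl_distE.
(* The lines that meet [F i] have their first coordinate in an interval of
   length [c i]; [y i] is put in it too, even when [F i] is empty. *)
have Bex i : {B : R | (forall z, F i z -> B <= dot z v <= B + c i) /\
    B <= dot (y i) v <= B + c i}.
  apply: cid; pose A := [set p | p = dot (y i) v \/ exists2 z, F i z & p = dot z v].
  have [||B hB] := @interval_cover A (c i) => //.
    move=> p q [->|[z Fz ->]] [->|[w Fw ->]].
    - by rewrite subrr normr0 ltW.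
    - by rewrite distrC; apply: dle; exact: Fy.
    - by apply: dle; exact: Fy.
    - by apply: dle; exact: Fc Fz Fw.
  exists B; split; last by apply: hB; left.
  by move=> z Fz; apply: hB; right; exists z.
pose B i := `[projT1 (Bex i), projT1 (Bex i) + c i]%classic.
have mB i : measurable_fun [set: R] (\1_(B i) : R -> R).
  by apply: measurable_indic; exact: measurable_itv.
pose k i := bump e (y i - x) + 20 * e ^+ 3 * c i.
have k0 i : 0 <= k i by rewrite addr_ge0 ?bump_ge0// !mulr_ge0// ?exprn_ge0// ltW.
apply: (@le_trans _ _ (\int[leb]_p (\sum_(i < n) k i * \1_(B i) p)%:E)%E).
  apply: (le_trans (le_abse_integral _ _ _)) => //.
  apply: ge0_le_integral => //.
  - exact: measurableT_comp.
  - apply/measurable_EFinP; apply: measurable_sum => i; exact: measurable_funM.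
  move=> p _; pose s := [seq i <- iota 0 n | p \in B i].
  pose S := [set t | Om (frame v (p, t))].
  pose phi t := bump e ((p *: v - x) + t *: u).
  pose dphi t := dot (dbump e ((p *: v - x) + t *: u)) u.
  have frx t : frame v (p, t) - x = (p *: v - x) + t *: u.
    by rewrite /frame/= addrAC.
  have -> : (\int[leb]_t (h (frame v (p, t)))%:E = \int[leb]_t (\1_S t * dphi t)%:E)%E.
    by apply: eq_integral => t _; rewrite /h /dphi -frx !indicE.
  have [M M0 hM] := compact_plane_bounded.
  have yfr t : dot (frame v (p, t)) u = t by exact: dot_frame_rot90.
  have := @slice_integral _ S phi dphi (4 * e ^+ 3) M (fun i => dot (y i) u) c s.
  move=> /(_ _ _ M0 _ _ _ _ c0) H; apply: le_trans (H _ _ _ _ _ _ _) _.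
  - by apply: closed_comp compact_plane_closed => t _; exact: continuous_frame_line.
  - move=> t /hM; apply: le_lt_trans; rewrite -[t in X in X <= _]yfr.
    by rewrite (le_trans (normr_dot _ _))// u1 mulr1.
  - by move=> t; exact: bump_ge0.
  - by apply: (@continuous_line_comp _ (fun z => dot (dbump e z) u)); exact: continuous_dbump.
  - by move=> t; exact: is_derive_bump.
  - by move=> t; rewrite (le_trans (normr_dot _ _))// u1 mulr1 norm_dbump.
  - move=> t St nSt.
    have [i ni Fi] : (\bigcup_(i < n) F i) (frame v (p, t)).
      apply: cov; split; first by apply: subset_closure.
      move=> Ot; apply: nSt; exact: (@continuous_frame_line v p t).
    exists i; last first.
      by rewrite -[t in X in X < _]yfr -dotBl (le_lt_trans (normr_dot _ _))// u1 mulr1 -eucl_distE Fy.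
    rewrite mem_filter mem_iota/= ni andbT inE/B/= in_itv/=.
    by have := (projT2 (Bex i)).1 _ Fi; rewrite dot_frame.
  rewrite lee_fin big_filter -{1}(subn0 n) -/(index_iota 0 n) big_mkord [leRHS](bigID (fun i : 'I_n => p \in B i))/=.
  rewrite ler_wpDr ?sumr_ge0//; first by move=> i _; rewrite mulr_ge0.
  apply: ler_sum => i pB; rewrite indicE pB mulr1 /k /phi -frx.
  (* The error constant 20 is 16 from [slice_integral], with [L = 4 e^3], plus
     4 from moving the bump from the line to [y i]. *)
  have : bump e (frame v (p, dot (y i) u) - x) <= bump e (y i - x) + 4 * e ^+ 3 * c i.
    rewrite -lerBlDl (le_trans (ler_norm _))// (le_trans (bump_lipschitz _ _ e0))//.
    rewrite ler_wpM2l ?mulr_ge0 ?exprn_ge0 ?(ltW e0)//.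
    rewrite eucl_distE opprB addrA subrK [y i in X in _ - X](frame_dot _ v1) frameB norm2_frame//.
    rewrite (le_trans (norm2_le_sum _))//= subrr normr0 addr0.
    move: pB (projT2 (Bex i)).2; rewrite inE/B/= in_itv/= => /andP[? ?] /andP[? ?].
    by rewrite ler_norml; apply/andP; split; lra.
  by move=> ?; lra.
under eq_integral do rewrite -sumEFin.
rewrite ge0_integral_sum//.
- rewrite -sumEFin; apply: lee_sum => i _.
  under eq_integral do rewrite EFinM.
  rewrite ge0_integralZl//.
  + have lE : (\int[leb]_x (\1_(B i) x)%:E = (c i)%:E)%E.
      rewrite integral_indic ?setIT ?setTI; [|by []|exact: measurable_itv].
      transitivity (leb (B i)); first by [].
      rewrite /B leb_itv/= lte_fin ltrDl c0 -EFinB; congr EFin; ring.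
    rewrite [X in (_ * X)%E]lE.
    by rewrite -EFinM lee_fin.
  + by apply/measurable_EFinP; exact: mB.
  + by rewrite lee_fin.
- move=> i; apply/measurable_EFinP; exact: measurable_funM.
- by move=> i p _; rewrite lee_fin mulr_ge0.
Qed.

End Compact.
End Flux.

(** * Total variation of the mollified indicator *)

Section MollifiedVariation.
Context {R : realType}.
Implicit Types (a b t p : R) (u v x y z : R * R).

Lemma ge0_integral_shift2 x (f : R * R -> \bar R) : measurable_fun [set: R * R] f ->
  (forall z, 0 <= f z)%E -> (\int[leb2]_z f (z + x)%R = \int[leb2]_z f z)%E.
Proof.
move=> mf f0.
have msh : measurable_fun [set: R * R] (fun z : R * R => z + x).
  by apply: measurable_planeD => //; exact: measurable_cst.
rewrite (ge0_integral_leb2 (f := fun z => f (z + x)))//; last exact: measurableT_comp mf msh.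
rewrite (ge0_integral_leb2 mf f0).
rewrite -(@ge0_integral_shift _ x.1 (fun p => \int[leb]_y f (p, y))%E); last 2 first.
- exact: (@measurable_fun_fubini_tonelli_F _ _ _ _ R leb f mf f0).
- by move=> p; apply: integral_ge0.
apply: eq_integral => p _.
rewrite -(@ge0_integral_shift _ x.2 (fun q => f (p + x.1, q)))//.
apply: measurableT_comp => //; apply: measurable_fun_pair => //; exact: measurable_cst.
Qed.

Lemma measurable_bump e : measurable_fun [set: R * R] (bump e).
Proof. by apply: continuous_measurable_plane; exact: continuous_bump. Qed.

Definition bump_mass (e : R) : R := (\int[leb2]_z bump e z)%R.

Section Fixed.
Variable e : R.
Hypothesis e0 : 0 < e.

Lemma bump_massE : ((bump_mass e)%:E = \int[leb2]_z (bump e z)%:E)%E.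
Proof.
rewrite /bump_mass /Rintegral fineK// ge0_fin_numE; last first.
  by apply: integral_ge0 => z _; rewrite lee_fin bump_ge0.
pose B : set (R * R) := [set z | norm2 z <= e].
have mB : measurable B by apply: measurable_set_ler => //; exact: measurable_norm2.
have -> : (\int[leb2]_z (bump e z)%:E = \int[leb2]_(z in B) (bump e z)%:E)%E.
  rewrite [RHS]integral_mkcond; apply: eq_integral => z _ /=.
  rewrite patchE; case: ifPn => // /negP zB; rewrite bump_eq0// leNgt.
  by apply/negP => /ltW ez; apply: zB; rewrite inE.
apply: (@le_lt_trans _ _ (\int[leb2]_(z in B) (cst (e ^+ 4)%:E) z)%E).
  apply: ge0_le_integral => //.
  - by move=> z _; rewrite lee_fin bump_ge0.
  - by apply/measurable_EFinP; apply: measurable_funTS; exact: measurable_bump.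
  - by move=> z _; rewrite lee_fin bump_le.
rewrite integral_cst//.
rewrite lte_mul_pinfty ?lee_fin ?exprn_ge0 ?(ltW e0)//.
exact: (leb2_bounded mB (M := e)).
Qed.

Lemma bump_mass_gt0 : 0 < bump_mass e.
Proof.
rewrite -lte_fin bump_massE.
pose B : set (R * R) := `[- (e / 2), e / 2]%classic `*` `[- (e / 2), e / 2]%classic.
have mB : measurable B by apply: measurableX.
have lB : leb2 B = (e * e)%:E.
  transitivity (leb `[(- (e / 2))%R, (e / 2)%R]%classic * leb `[(- (e / 2))%R, (e / 2)%R]%classic)%E.
    exact: product_measure1E.
  have ee : - (e / 2) < e / 2 by rewrite (@lt_trans _ _ 0) ?oppr_lt0 ?divr_gt0.
  rewrite leb_itv/= lte_fin ee.
  by rewrite -EFinB -EFinM; congr EFin; lra.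
apply: (@lt_le_trans _ _ (\int[leb2]_(z in B) (cst (e ^+ 4 / 4)%:E) z)%E).
  by rewrite integral_cst// [X in (_ * X)%E]lB -EFinM lte_fin !mulr_gt0// ?invr_gt0// exprn_gt0.
apply: (@le_trans _ _ (\int[leb2]_(z in B) (bump e z)%:E)%E); last first.
  apply: ge0_subset_integral => //; last by move=> z _; rewrite lee_fin bump_ge0.
  by apply/measurable_EFinP; exact: measurable_bump.
apply: ge0_le_integral => //.
- by move=> z _; rewrite lee_fin divr_ge0// exprn_ge0// ltW.
- by apply/measurable_EFinP; apply: measurable_funTS; exact: measurable_bump.
move=> z [] /=; rewrite !in_itv/= -!ler_norml => z1 z2; rewrite lee_fin.
have sq w : `|w| <= e / 2 -> w ^+ 2 <= e ^+ 2 / 4.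
  move=> we; rewrite -real_normK ?num_real//.
  have -> : e ^+ 2 / 4 = (e / 2) ^+ 2 by rewrite expr_div_n; congr (_ / _); ring.
  by rewrite ler_sqr ?nnegrE// divr_ge0// ltW.
have := sq _ z1; have := sq _ z2 => h1 h2.
have -> : e ^+ 4 / 4 = (e ^+ 2 / 2) ^+ 2 by rewrite expr_div_n -exprM; congr (_ / _); ring.
rewrite /bump ler_sqr ?nnegrE ?pospart_ge0 ?divr_ge0 ?sqr_ge0//.
by rewrite /pospart le_max; apply/orP; right; lra.
Qed.

Lemma integral_bump_sub x : (\int[leb2]_z (bump e (z - x))%:E = (bump_mass e)%:E)%E.
Proof.
rewrite bump_massE -[RHS](@ge0_integral_shift2 (- x))//.
  by apply/measurable_EFinP; exact: measurable_bump.
by move=> z; rewrite lee_fin bump_ge0.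
Qed.

Variable Om : set (R * R).
Hypothesis cOm : compact Om.

Definition flux2 x : R * R := (flux e Om x (1, 0), flux e Om x (0, 1)).

Lemma fluxE x u : flux e Om x u = dot (flux2 x) u.
Proof.
have mOm := compact_plane_measurable cOm.
rewrite /dot/= /flux mulrC -RintegralZl//; last exact: integrable_dbump.
rewrite mulrC -RintegralZl//; last exact: integrable_dbump.
have iZ w c : leb2.-integrable Om (EFin \o (fun y => c * dot (dbump e (y - x)) w)).
  have := integrableZl mOm c (integrable_dbump e0 cOm x w).
  by apply: eq_integrable => // y _; rewrite /= EFinM.
rewrite -RintegralD//; apply: eq_Rintegral => y _.
by rewrite /dot/= !mulr1 !mulr0 addr0 add0r; ring.
Qed.

Lemma measurable_flux2 : measurable_fun [set: R * R] flux2.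
Proof.
have mOm := compact_plane_measurable cOm.
have mflux u : measurable_fun [set: R * R] (fun x => flux e Om x u).
  pose C := 4 * e ^+ 3 * norm2 u.
  have C0 : 0 <= C by rewrite mulr_ge0 ?norm2_ge0// mulr_ge0// exprn_ge0// ltW.
  pose F (w : (R * R) * (R * R)) : \bar R :=
    ((\1_Om w.2)%R * (dot (dbump e (w.2 - w.1)) u + C))%:E.
  have hC y x : 0 <= dot (dbump e (y - x)) u + C.
    rewrite -lerBlDr sub0r; apply: lerNnormlW; rewrite (le_trans (normr_dot _ _))//.
    by rewrite ler_wpM2r ?norm2_ge0 ?norm_dbump.
  have F0 w : (0 <= F w)%E by rewrite lee_fin mulr_ge0.
  have mF : measurable_fun setT F.
    apply/measurable_EFinP; apply: measurable_funM.
      by apply: measurableT_comp => //; exact: measurable_indic.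
    apply: measurable_funD => //.
    apply: (@measurableT_comp _ _ _ _ _ _ (fun z => dot (dbump e z) u)).
      by apply: continuous_measurable_plane; exact: continuous_dbump.
    exact: measurable_planeB.
  have := @measurable_fun_fubini_tonelli_F _ _ _ _ R leb2 F mF F0.
  move=> mI; have -> : (fun x => flux e Om x u) =
      (fun x => fine (fubini_F leb2 F x) - C * fine (leb2 Om)).
    apply/funext => x; rewrite /fubini_F/=.
    have -> : (\int[leb2]_y F (x, y) = \int[leb2]_(y in Om) (dot (dbump e (y - x)) u + C)%:E)%E.
      rewrite [RHS]integral_mkcond; apply: eq_integral => y _ /=.
      by rewrite patchE /F/= indicE; case: ifPn; rewrite ?mul1r ?mul0r.
    rewrite -/(Rintegral _ _ _) RintegralD//; last 2 first.
    - exact: integrable_dbump.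
    - apply: (bounded_integrable (C := C)) => //; first exact: leb2_compact_lty.
      by move=> y _; rewrite ger0_norm.
    by rewrite Rintegral_cst// addrK.
  apply: measurable_funB => //; exact: measurableT_comp.
by apply: measurable_fun_pair; exact: mflux.
Qed.

Lemma mollified_total x : (forall y, eucl_dist x y < e -> Om y) ->
  mollified e Om x = bump_mass e.
Proof.
move=> xOm; rewrite /mollified /Rintegral.
suff -> : (\int[leb2]_(y in Om) (bump e (y - x))%:E = (bump_mass e)%:E)%E by [].
rewrite -(integral_bump_sub x) integral_mkcond; apply: eq_integral => y _.
rewrite patchE; case: ifPn => // /negP yO; rewrite bump_eq0// -eucl_distE eucl_distC leNgt.
by apply/negP => /xOm yO'; apply: yO; rewrite inE.
Qed.

Lemma mollified_eq0 x : (forall y, eucl_dist x y < e -> ~ Om y) ->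
  mollified e Om x = 0.
Proof.
move=> xOm; rewrite /mollified (@eq_Rintegral _ _ _ _ _ (fun=> 0)).
  by rewrite /Rintegral integral0.
move=> y; rewrite inE => yO; rewrite bump_eq0// -eucl_distE eucl_distC leNgt.
by apply/negP => /xOm.
Qed.

Lemma flux2_eq0 x : (forall y, eucl_dist x y < e -> ~ Om y) -> flux2 x = 0.
Proof.
move=> xOm; suff h u : flux e Om x u = 0 by rewrite /flux2 !h.
rewrite /flux (@eq_Rintegral _ _ _ _ _ (fun=> 0)).
  by rewrite /Rintegral integral0.
move=> y; rewrite inE => yO; rewrite dbump_eq0// ?/dot ?mul0r ?addr0//.
by rewrite -eucl_distE eucl_distC leNgt; apply/negP => /xOm.
Qed.

(** The derivative of the mollified indicator is minus the flux, so this is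
    the fundamental theorem of calculus, after exchanging the integral along
    the line with the one over [Om]. *)
Lemma mollified_variation x u a b : a <= b ->
  (`|mollified e Om (x + a *: u) - mollified e Om (x + b *: u)|%:E <=
   \int[leb]_(t in `[a, b]) `|dot (flux2 (x + t *: u)) u|%:E)%E.
Proof.
move=> ab; have mOm := compact_plane_measurable cOm.
have lOm := leb2_compact_lty cOm.
pose D : set R := `[a, b]%classic; have mD : measurable D by exact: measurable_itv.
pose g (w : (R * R) * R) := dot (dbump e (w.1 - (x + w.2 *: u))) u.
have pw y : (\int[leb]_(t in D) (g (y, t))%:E =
    (bump e (y - (x + a *: u)) - bump e (y - (x + b *: u)))%:E)%E.
  pose F t := - bump e (y - (x + t *: u)).
  have yx t : y - (x + t *: u) = (y - x) + t *: (- u) by rewrite opprD addrA scalerN.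
  have dF t : is_derive t 1 F (g (y, t)).
    have -> : F = - (fun t => bump e ((y - x) + t *: (- u))).
      by apply/funext => s; rewrite /F yx.
    have -> : g (y, t) = - dot (dbump e ((y - x) + t *: (- u))) (- u).
      by rewrite /g/= yx /dot/=; ring.
    apply: is_deriveN; exact: is_derive_bump.
  have cg : continuous (fun t => g (y, t)).
    have -> : (fun t => g (y, t)) = (fun t => dot (dbump e ((y - x) + t *: (- u))) u).
      by apply/funext => t; rewrite /g/= yx.
    by apply: (@continuous_line_comp _ (fun z => dot (dbump e z) u)); exact: continuous_dbump.
  by rewrite (integral_FTC ab cg dF) /F; congr EFin; ring.
pose f (w : (R * R) * R) := \1_Om w.1 * \1_D w.2 * g w.
have mg : measurable_fun setT g.
  apply: (@measurableT_comp _ _ _ _ _ _ (fun z => dot (dbump e z) u)).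
    by apply: continuous_measurable_plane; exact: continuous_dbump.
  apply: measurable_planeB => //; apply: measurable_planeD; first exact: measurable_cst.
  by apply: measurable_planeZ => //; exact: measurable_cst.
have mf : measurable_fun setT f.
  apply: measurable_funM => //; apply: measurable_funM;
    by apply: measurableT_comp => //; exact: measurable_indic.
have gC w : `|g w| <= 4 * e ^+ 3 * norm2 u.
  by rewrite (le_trans (normr_dot _ _))// ler_wpM2r ?norm2_ge0 ?norm_dbump.
have fi : (leb2 \x @leb R)%E.-integrable [set: (R * R) * R] (EFin \o f).
  have -> : EFin \o f = (EFin \o f) \_ (Om `*` D).
    apply/funext => -[y t]; rewrite patchE; case: ifPn => //.
    rewrite notin_setE /f/= !indicE => yt.
    have [yO|yO] := boolP (y \in Om); have [tD|tD] := boolP (t \in D); rewrite ?mul0r ?mulr0 ?mul0r//.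
    by exfalso; apply: yt; split; rewrite -in_setE.
  rewrite -integrable_mkcond//; last exact: measurableX.
  apply: (bounded_integrable (C := 4 * e ^+ 3 * norm2 u)) => //.
  - exact: measurableX.
  - have pE : (leb2 \x @leb R)%E (Om `*` D) = (leb2 Om * leb D)%E by exact: product_measure1E.
    rewrite [X in (X < _)%E]pE.
    have -> : leb D = (b - a)%:E.
      rewrite /D leb_itv/= lte_fin -EFinB; case: ifPn => //.
      by rewrite -leNgt => ba; congr EFin; lra.
    by rewrite lte_mul_pinfty ?ge0_fin_numE// ltry.
  - exact: measurable_funTS.
  - move=> w _; rewrite /f !normrM !indicE.
    have C0 := le_trans (normr_ge0 _) (gC w).
    by case: (_ \in Om); case: (_ \in D); rewrite ?normr1 ?normr0 ?mul1r ?mul0r ?mulr0 ?mul0r.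
have E : ((mollified e Om (x + a *: u) - mollified e Om (x + b *: u))%:E =
    \int[leb]_(t in D) (flux e Om (x + t *: u) u)%:E)%E.
  rewrite /mollified -RintegralB//; last 2 first.
  - exact: integrable_bump.
  - exact: integrable_bump.
  rewrite /Rintegral fineK; last first.
    apply: integrable_fin_num => //.
    have := integrableB mOm (integrable_bump e cOm (x + a *: u)) (integrable_bump e cOm (x + b *: u)).
    by apply: eq_integrable.
  transitivity (\int[leb2]_y \int[leb]_t (f (y, t))%:E)%E.
    rewrite integral_mkcond; apply: eq_integral => y _; rewrite patchE /f/= indicE.
    case: ifPn => yO; last by rewrite integral0_eq// => t _; rewrite mul0r mul0r.
    rewrite -pw integral_mkcond; apply: eq_integral => t _.
    by rewrite patchE indicE; case: ifPn; rewrite ?mulr1 ?mulr0 ?mul1r ?mul0r.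
  rewrite (Fubini fi) [RHS]integral_mkcond; apply: eq_integral => t _.
  rewrite patchE /f/=; case: ifPn => tD; last first.
    by rewrite integral0_eq// => y _; rewrite [X in _ * X * _]indicE (negbTE tD) mulr0 mul0r.
  rewrite /flux /Rintegral fineK; last by apply: integrable_fin_num => //; exact: integrable_dbump.
  rewrite [RHS]integral_mkcond; apply: eq_integral => y _.
  by rewrite patchE !indicE tD mulr1; case: ifPn; rewrite ?mul1r ?mul0r.
rewrite -abse_EFin E; apply: (le_trans (le_abse_integral _ _ _)) => //.
  apply/measurable_EFinP/measurable_funTS.
  have -> : (fun t => flux e Om (x + t *: u) u) = (fun t => dot (flux2 (x + t *: u)) u).
    by apply/funext => t; rewrite fluxE.
  apply: measurable_dot; last exact: measurable_cst.
  apply: measurableT_comp; first exact: measurable_flux2.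
  apply: measurable_planeD; first exact: measurable_cst.
  by apply: measurable_planeZ => //; exact: measurable_cst.
by under eq_integral do rewrite abse_EFin fluxE.
Qed.

(** The norm of the gradient is its component along its own direction. *)
Lemma norm_flux2_le x n (F : nat -> set (R * R)) (c : nat -> R) (y : nat -> R * R) :
  (forall i, 0 < c i) ->
  (forall i z z', F i z -> F i z' -> eucl_dist z z' < c i) ->
  (forall i z, F i z -> eucl_dist z (y i) < c i) ->
  boundary Om `<=` \bigcup_(i < n) F i ->
  norm2 (flux2 x) <= \sum_(i < n) (bump e (y i - x) + 20 * e ^+ 3 * c i) * c i.
Proof.
move=> c0 Fc Fy cov; have [t [r [_ rE fE]]] := polar (flux2 x).
pose v : R * R := (sin t, - cos t).
have vE : rot90 v = dir t by rewrite /rot90/= opprK.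
have v1 : norm2 v = 1 by rewrite -norm2_rot90 vE norm2_dir.
have := flux_le e0 cOm x v1 c0 Fc Fy cov.
rewrite vE fluxE -rE fE dotZl.
have -> : dot (dir t) (dir t) = 1 by rewrite /dot/= -!expr2 cos2Dsin2.
by rewrite mulr1.
Qed.

(** By [flux_le], the gradient is at most the sum of the bumps centred in a cover
    of the boundary, weighted by the diameters. Each bump integrates to
    [bump_mass e] and the diameters sum to at most [H]; the error term is
    quadratic in the diameters and vanishes with the mesh of the cover. *)
Lemma integral_norm_flux2 (H : R) : (hausdorff1 (boundary Om) < H%:E)%E ->
  (\int[leb2]_x (norm2 (flux2 x))%:E <= (bump_mass e * H)%:E)%E.
Proof.
move=> OH; have [M M0 hM] := compact_plane_bounded cOm.
pose B : set (R * R) := [set z | norm2 z <= M + e].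
have mB : measurable B by apply: measurable_set_ler => //; exact: measurable_norm2.
have lB : (leb2 B < +oo)%E by exact: (leb2_bounded mB (M := M + e)).
pose m := fine (leb2 B).
have mE : leb2 B = m%:E by rewrite fineK// ge0_fin_numE.
have m0 : 0 <= m by rewrite fine_ge0.
have cbd : compact (boundary Om).
  rewrite /boundary; have clO : closure Om = Om by apply/esym/closure_id; exact: compact_plane_closed.
  rewrite clO setDE; apply: compact_closedI => //.
  by apply: open_closedC; exact: open_interior.
have H0 : 0 <= H by rewrite -lee_fin ltW// (le_lt_trans (hausdorff1_ge0 _) OH).
apply/lee_addgt0Pr => d d0; rewrite -EFinD.
(* This mesh makes the total error at most [d]. *)
pose q := d / (20 * e ^+ 3 * m * H + 1).
have K0 : 0 <= 20 * e ^+ 3 * m * H by rewrite !mulr_ge0 ?exprn_ge0 ?(ltW e0).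
have q0 : 0 < q by rewrite divr_gt0// ltr_wpDl.
have [n [F [c [oF Fc cq cov cH]]]] := hausdorff1_finite_cover cbd OH q0.
have c0 i : 0 < c i by case/andP: (cq i).
have /choice[y Fy] : forall i, exists y, forall z, F i z -> eucl_dist z y < c i.
  move=> i.
  have [F0|/set0P[w Fw]] := eqVneq (F i) set0; first by exists 0 => z; rewrite F0.
  by exists w => z Fz; exact: Fc Fz Fw.
pose k x := \sum_(i < n) (bump e (y i - x) + 20 * e ^+ 3 * c i * \1_B x) * c i.
have e30 : 0 <= 20 * e ^+ 3 by rewrite mulr_ge0// exprn_ge0// ltW.
have t0 i x : 0 <= bump e (y i - x) + 20 * e ^+ 3 * c i * \1_B x.
  by rewrite addr_ge0 ?bump_ge0// !mulr_ge0// ltW.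
have Bf x : norm2 (flux2 x) <= k x.
  have [xB|xB] := boolP (x \in B).
    have -> : k x = \sum_(i < n) (bump e (y i - x) + 20 * e ^+ 3 * c i) * c i.
      by apply: eq_bigr => i _; rewrite indicE xB mulr1.
    exact: (norm_flux2_le x c0 Fc Fy cov).
  rewrite flux2_eq0 ?norm20 ?sumr_ge0//; first by move=> i _; rewrite mulr_ge0// ltW.
  move=> z xz Oz; move: xB; rewrite notin_setE; apply.
  have : eucl_dist x 0 <= eucl_dist x z + eucl_dist z 0 by exact: eucl_dist_triangle.
  rewrite !eucl_distE !subr0 /B/= => h; rewrite (le_trans h)// addrC.
  by rewrite lerD// ltW// ?hM// -eucl_distE.
have mbump i : measurable_fun [set: R * R] (fun x => bump e (y i - x)).
  apply: (@measurableT_comp _ _ _ _ _ _ (bump e)); first exact: measurable_bump.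
  by apply: measurable_planeB => //; exact: measurable_cst.
have mBi : measurable_fun [set: R * R] (\1_B : R * R -> R) by exact: measurable_indic.
have mt i : measurable_fun [set: R * R] (fun x => bump e (y i - x) + 20 * e ^+ 3 * c i * \1_B x).
  by apply: measurable_funD => //; apply: measurable_funM.
apply: (@le_trans _ _ (\int[leb2]_x (k x)%:E)%E).
  apply: ge0_le_integral => //.
  - by move=> x _; rewrite lee_fin norm2_ge0.
  - apply/measurable_EFinP; apply: measurableT_comp; [exact: measurable_norm2|exact: measurable_flux2].
  - by apply/measurable_EFinP; apply: measurable_sum => i; apply: measurable_funM.
  - by move=> x _; rewrite lee_fin.
have bE i : (\int[leb2]_x (bump e (y i - x))%:E = (bump_mass e)%:E)%E.
  by rewrite -(integral_bump_sub (y i)); apply: eq_integral => x _; rewrite -bumpN opprB.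
have tE i : (\int[leb2]_x (bump e (y i - x) + 20 * e ^+ 3 * c i * \1_B x)%:E =
    (bump_mass e + 20 * e ^+ 3 * c i * m)%:E)%E.
  under eq_integral do rewrite EFinD.
  rewrite ge0_integralD//; last 4 first.
  - by move=> x _; rewrite lee_fin bump_ge0.
  - exact/measurable_EFinP.
  - by move=> x _; rewrite lee_fin !mulr_ge0// ltW.
  - by apply/measurable_EFinP; apply: measurable_funM.
  rewrite bE EFinD; congr (_ + _)%E.
  under eq_integral do rewrite EFinM.
  rewrite ge0_integralZl//; last 2 first.
  - exact/measurable_EFinP.
  - by rewrite lee_fin mulr_ge0// ltW.
  have iB : (\int[leb2]_x (\1_B x)%:E = m%:E)%E by rewrite integral_indic// setIT.
  by rewrite [X in (_ * X)%E]iB -EFinM.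
have -> : (\int[leb2]_x (k x)%:E = (\sum_(i < n) (bump_mass e + 20 * e ^+ 3 * c i * m) * c i)%:E)%E.
  under eq_integral do rewrite -sumEFin.
  rewrite ge0_integral_sum//; last 2 first.
  - by move=> i; apply/measurable_EFinP; apply: measurable_funM.
  - by move=> i x _; rewrite lee_fin mulr_ge0// ltW.
  rewrite -sumEFin; apply: eq_bigr => i _.
  under eq_integral do rewrite EFinM.
  rewrite ge0_integralZr//; last 3 first.
  - exact/measurable_EFinP.
  - by move=> x _; rewrite lee_fin.
  - by rewrite lee_fin ltW.
  by rewrite [X in (X * _)%E]tE.
rewrite lee_fin; apply: (@le_trans _ _ (\sum_(i < n) (bump_mass e + 20 * e ^+ 3 * q * m) * c i)).
  apply: ler_sum => i _; rewrite ler_wpM2r// ?(ltW (c0 i))// lerD2l ler_wpM2r// ler_wpM2l//.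
  by case/andP: (cq i) => _ /ltW.
rewrite -mulr_sumr.
have P0 : 0 <= bump_mass e + 20 * e ^+ 3 * q * m.
  apply: addr_ge0; first exact: ltW bump_mass_gt0.
  by apply: mulr_ge0 => //; apply: mulr_ge0 => //; exact: ltW.
apply: (le_trans (ler_wpM2l P0 cH)); rewrite mulrDl lerD2l.
have -> : 20 * e ^+ 3 * q * m * H = q * (20 * e ^+ 3 * m * H) by ring.
rewrite /q mulrAC ler_pdivrMr ?ltr_wpDl// ler_wpM2l ?(ltW d0)//.
by rewrite lerDl.
Qed.

End Fixed.
End MollifiedVariation.

(** * Lines through the interior against the length of the boundary *)

Section LinesHausdorff.
Context {R : realType}.
Implicit Types (a b t p : R) (u v x y z l : R * R).

Section FixedScale.
Variables (e : R) (Om : set (R * R)).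
Hypotheses (e0 : 0 < e) (cOm : compact Om).

Lemma mollified_line_far x u : norm2 u = 1 ->
  exists2 T, 0 < T & forall s, T <= `|s| -> mollified e Om (x + s *: u) = 0.
Proof.
move=> u1; have [M M0 hM] := compact_plane_bounded cOm.
exists (norm2 x + (M + e)); first by rewrite ltr_wpDl ?norm2_ge0// addr_gt0.
move=> s sT; apply: mollified_eq0 => // y xy Oy.
have : norm2 (s *: u) <= norm2 (x + s *: u - y) + norm2 y + norm2 x.
  have {1}-> : s *: u = (x + s *: u - y) + y + - x by rewrite subrK addrAC subrr add0r.
  by rewrite (le_trans (norm2D _ _))// norm2N lerD2r norm2D.
rewrite norm2Z u1 mulr1; move: xy; rewrite eucl_distE; have := hM _ Oy; lra.
Qed.

Definition variation x u : \bar R :=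
  (\int[leb]_t `|dot (flux2 e Om (x + t *: u)) u|%:E)%E.

Let mvar x u : measurable_fun [set: R] (fun t => `|dot (flux2 e Om (x + t *: u)) u|%:E%E).
Proof.
apply/measurable_EFinP; apply: measurableT_comp => //; apply: measurable_dot.
  apply: measurableT_comp; first exact: measurable_flux2.
  apply: measurable_planeD; first exact: measurable_cst.
  by apply: measurable_planeZ => //; exact: measurable_cst.
exact: measurable_cst.
Qed.

(** The mollified indicator starts from 0, reaches its maximum and returns to
    0. *)
Lemma variation_ge2 x u t : norm2 u = 1 -> mollified e Om (x + t *: u) = bump_mass e ->
  ((2 * bump_mass e)%:E <= variation x u)%E.
Proof.
move=> u1 tZ; have [T T0 hT] := mollified_line_far x u1.
pose a : R := - (T + `|t|); pose b : R := T + `|t|.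
have at_ : a <= t by rewrite /a lerNl (le_trans (ler_norm _))// normrN lerDr ltW.
have tb : t <= b by rewrite /b (le_trans (ler_norm _))// lerDr ltW.
have aT : T <= `|a| by rewrite /a normrN (ger0_norm (addr_ge0 (ltW T0) (normr_ge0 t))) lerDl.
have bT : T <= `|b| by rewrite /b (ger0_norm (addr_ge0 (ltW T0) (normr_ge0 t))) lerDl.
apply: (@le_trans _ _ (\int[leb]_(s in `[a, b]) `|dot (flux2 e Om (x + s *: u)) u|%:E)%E); last first.
  by apply: ge0_subset_integral.
rewrite (@ge0_integral_itv_split _ a t b) ?at_//.
have Z0 := ltW (bump_mass_gt0 e0).
have -> : 2 * bump_mass e = bump_mass e + bump_mass e by ring.
rewrite EFinD; apply: leeD.
  apply: le_trans (mollified_variation e0 cOm x u at_).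
  by rewrite lee_fin tZ (hT _ aT) ?sub0r ?normrN ?ger0_norm.
apply: le_trans (mollified_variation e0 cOm x u tb).
by rewrite lee_fin tZ (hT _ bT) ?subr0 ?ger0_norm.
Qed.

(** The mollified indicator reaches its maximum twice, with a zero in between. *)
Lemma variation_ge4 x u t1 t2 t3 : norm2 u = 1 -> t1 < t2 < t3 ->
  mollified e Om (x + t1 *: u) = bump_mass e ->
  mollified e Om (x + t2 *: u) = 0 ->
  mollified e Om (x + t3 *: u) = bump_mass e ->
  ((4 * bump_mass e)%:E <= variation x u)%E.
Proof.
move=> u1 /andP[/ltW t12 /ltW t23] t1Z t20 t3Z; have [T T0 hT] := mollified_line_far x u1.
pose a : R := - (T + `|t1|); pose b : R := T + `|t3|.
have at_ : a <= t1 by rewrite /a lerNl (le_trans (ler_norm _))// normrN lerDr ltW.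
have tb : t3 <= b by rewrite /b (le_trans (ler_norm _))// lerDr ltW.
have aT : T <= `|a| by rewrite /a normrN (ger0_norm (addr_ge0 (ltW T0) (normr_ge0 t1))) lerDl.
have bT : T <= `|b| by rewrite /b (ger0_norm (addr_ge0 (ltW T0) (normr_ge0 t3))) lerDl.
apply: (@le_trans _ _ (\int[leb]_(s in `[a, b]) `|dot (flux2 e Om (x + s *: u)) u|%:E)%E); last first.
  by apply: ge0_subset_integral.
rewrite (@ge0_integral_itv_split _ a t1 b) ?at_ ?(le_trans t12) ?(le_trans t23)//.
rewrite (@ge0_integral_itv_split _ t1 t2 b) ?t12 ?(le_trans t23)//.
rewrite (@ge0_integral_itv_split _ t2 t3 b) ?t23//.
have Z0 := ltW (bump_mass_gt0 e0).
have -> : 4 * bump_mass e = bump_mass e + (bump_mass e + (bump_mass e + bump_mass e)) by ring.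
rewrite !EFinD; apply: leeD; [|apply: leeD; [|apply: leeD]].
- apply: le_trans (mollified_variation e0 cOm x u at_).
  by rewrite lee_fin t1Z (hT _ aT) ?sub0r ?normrN ?ger0_norm.
- apply: le_trans (mollified_variation e0 cOm x u t12).
  by rewrite lee_fin t1Z t20 ?subr0 ?ger0_norm.
- apply: le_trans (mollified_variation e0 cOm x u t23).
  by rewrite lee_fin t3Z t20 ?sub0r ?normrN ?ger0_norm.
- apply: le_trans (mollified_variation e0 cOm x u tb).
  by rewrite lee_fin t3Z (hT _ bT) ?subr0 ?ger0_norm.
Qed.

Definition line_variation l : \bar R :=
  (\int[leb]_t (\1_`[0%R, pi] l.1 *
     `|dot (flux2 e Om (frame (dir l.1) (l.2, t))) (rot90 (dir l.1))|)%:E)%E.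

Let F3 (w : (R * R) * R) : \bar R := (\1_`[0%R, pi] w.1.1 *
     `|dot (flux2 e Om (frame (dir w.1.1) (w.1.2, w.2))) (rot90 (dir w.1.1))|)%:E%E.

Let mind : measurable_fun [set: R] (\1_`[0%R, pi] : R -> R).
Proof. by apply: measurable_indic; exact: measurable_itv. Qed.

Let mF3 : measurable_fun setT F3.
Proof.
apply/measurable_EFinP; apply: measurable_funM.
  by apply: measurableT_comp => //; apply: measurableT_comp.
apply: measurableT_comp => //.
have mdir : measurable_fun [set: (R * R) * R] (fun w => dir w.1.1).
  by apply: measurable_dir; apply: measurableT_comp.
apply: measurable_dot; last exact: measurable_rot90.
apply: measurableT_comp; first exact: measurable_flux2.
rewrite /frame/=; apply: measurable_planeD; apply: measurable_planeZ => //.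
- exact: measurableT_comp.
- exact: measurable_rot90.
Qed.

Lemma measurable_line_variation : measurable_fun [set: R * R] line_variation.
Proof.
apply: (@measurable_fun_fubini_tonelli_F _ _ _ _ R leb F3 mF3) => w.
by rewrite lee_fin mulr_ge0.
Qed.

Lemma line_variation_ge0 l : (0 <= line_variation l)%E.
Proof. by apply: integral_ge0 => t _; rewrite lee_fin mulr_ge0. Qed.

Lemma line_variationE l : 0 <= l.1 <= pi ->
  line_variation l = variation (l.2 *: dir l.1) (rot90 (dir l.1)).
Proof.
move=> l1; apply: eq_integral => t _; by rewrite indicE mem_set ?mul1r.
Qed.

(** Integrating the variations along all lines amounts to integrating, over
    the plane, the component of the gradient in every direction; the integral
    over the directions gives twice the norm of the gradient. *)
Lemma integral_line_variation (H : R) : (hausdorff1 (boundary Om) < H%:E)%E ->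
  (\int[leb2]_l line_variation l <= (2 * bump_mass e * H)%:E)%E.
Proof.
move=> OH; rewrite ge0_integral_leb2; last 2 first.
- exact: measurable_line_variation.
- exact: line_variation_ge0.
pose G (w : R * (R * R)) : \bar R :=
  (\1_`[0%R, pi] w.1 * `|dot (flux2 e Om w.2) (rot90 (dir w.1))|)%:E%E.
have mG : measurable_fun setT G.
  apply/measurable_EFinP; apply: measurable_funM.
    by apply: measurableT_comp => //; apply: measurableT_comp.
  apply: measurableT_comp => //; apply: measurable_dot.
    by apply: measurableT_comp => //; exact: measurable_flux2.
  by apply: measurable_rot90; apply: measurable_dir.
have G0 w : (0 <= G w)%E by rewrite lee_fin mulr_ge0.
have -> : (\int[leb]_t \int[leb]_p line_variation (t, p) =
    \int[leb]_t \int[leb2]_x G (t, x))%E.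
  apply: eq_integral => t _; rewrite /line_variation/=.
  rewrite -(@ge0_integral_frame _ (dir t) (fun x => G (t, x))) ?norm2_dir//.
  apply: measurableT_comp => //; apply: measurable_fun_pair => //; exact: measurable_cst.
rewrite (@fubini_tonelli _ _ _ _ R leb leb2 G mG G0).
have -> : (\int[leb2]_x \int[leb]_t G (t, x) = \int[leb2]_x (2%:E * (norm2 (flux2 e Om x))%:E))%E.
  apply: eq_integral => x _; set f := flux2 e Om x.
  transitivity (\int[leb]_(t in `[0%R, pi]) `|dot (f.2, - f.1)%R (dir t)|%:E)%E.
    rewrite [RHS]integral_mkcond; apply: eq_integral => t _.
    rewrite patchE /G/= indicE; case: ifPn; rewrite ?mul0r// mul1r => _.
    by congr (`|_|%:E)%E; rewrite /dot/= -/f; ring.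
  rewrite integral_norm_dot_dir EFinM; congr (_ * (_%:E))%E.
  by rewrite /norm2/= sqrrN addrC.
rewrite ge0_integralZl//; last 2 first.
- apply/measurable_EFinP; apply: measurableT_comp; [exact: measurable_norm2|exact: measurable_flux2].
- by move=> x _; rewrite lee_fin norm2_ge0.
rewrite -mulrA EFinM lee_wpmul2l ?lee_fin//.
exact: integral_norm_flux2.
Qed.

End FixedScale.

(** [O] collects lines along which the set is met, left, and met again, with a
    margin [r0]; such lines cross the boundary at least four times. *)
Lemma lines_core_le (Om : set (R * R)) (O : set (R * R)) (r0 e H : R) :
  compact Om -> measurable O ->
  (forall l, O l -> 0 <= l.1 <= pi /\ exists t1 t2 t3, [/\ t1 < t2 < t3,
     forall y, eucl_dist (frame (dir l.1) (l.2, t1)) y < r0 -> Om y,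
     forall y, eucl_dist (frame (dir l.1) (l.2, t2)) y < r0 -> ~ Om y &
     forall y, eucl_dist (frame (dir l.1) (l.2, t3)) y < r0 -> Om y]) ->
  0 < e <= r0 -> (hausdorff1 (boundary Om) < H%:E)%E ->
  (leb2 (lines (core Om e)°) + leb2 O <= H%:E)%E.
Proof.
move=> cOm mO hO /andP[e0 er] OH.
pose C := lines (core Om e)°.
have mC : measurable C by apply: measurable_lines; exact: open_interior.
have Z0 := bump_mass_gt0 e0; set Z := bump_mass e in Z0 *.
have fr (t p s : R) : frame (dir t) (p, s) = p *: dir t + s *: rot90 (dir t) by [].
have u1 (t : R) : norm2 (rot90 (dir t)) = 1 by rewrite norm2_rot90 norm2_dir.
have VC l : C l -> ((2 * Z)%:E <= line_variation e Om l)%E.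
  move=> [l1 [x xC xl]]; rewrite line_variationE//.
  apply: (@variation_ge2 e Om e0 cOm _ _ (dot x (rot90 (dir l.1)))) => //.
  rewrite -xl -fr -frame_dot ?norm2_dir//.
  apply: mollified_total => // y xy.
  by have := interior_subset xC; apply.
have VO l : O l -> ((4 * Z)%:E <= line_variation e Om l)%E.
  move=> /hO[l1 [t1 [t2 [t3 [t123 h1 h2 h3]]]]]; rewrite line_variationE//.
  apply: (@variation_ge4 e Om e0 cOm _ _ t1 t2 t3) => //.
  - by apply: mollified_total => // y ye; apply: h1; exact: lt_le_trans ye er.
  - by apply: mollified_eq0 => // y ye; apply: h2; exact: lt_le_trans ye er.
  - by apply: mollified_total => // y ye; apply: h3; exact: lt_le_trans ye er.
have mi (A : set (R * R)) : measurable A -> measurable_fun [set: R * R] (fun x => (2 * Z * \1_A x)%:E).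
  by move=> mA; apply/measurable_EFinP; apply: measurable_funM => //; exact: measurable_indic.
have i0 (A : set (R * R)) x : (0 <= (2 * Z * \1_A x)%:E)%E.
  by rewrite lee_fin mulr_ge0// mulr_ge0// ltW.
have iE (A : set (R * R)) : measurable A ->
    (\int[leb2]_x (2 * Z * \1_A x)%:E = (2 * Z)%:E * leb2 A)%E.
  move=> mA; under eq_integral do rewrite EFinM.
  rewrite ge0_integralZl//; last 2 first.
  - by apply/measurable_EFinP; exact: measurable_indic.
  - by rewrite lee_fin mulr_ge0// ltW.
  have iA : (\int[leb2]_x (\1_A x)%:E = leb2 A)%E by rewrite integral_indic// setIT.
  by rewrite [X in (_ * X)%E]iA.
have K : ((2 * Z)%:E * (leb2 C + leb2 O) <= (2 * Z)%:E * H%:E)%E.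
  rewrite -EFinM; apply: le_trans (integral_line_variation e0 cOm OH).
  rewrite ge0_muleDr// -!iE// -ge0_integralD//; try exact: mi; try by move=> x _; exact: i0.
  apply: ge0_le_integral => //.
  - by move=> x _; rewrite adde_ge0.
  - by apply: emeasurable_funD; exact: mi.
  - exact: measurable_line_variation.
  move=> l _; rewrite !indicE -EFinD.
  have [lO|lO] := boolP (l \in O).
    apply: le_trans (VO l _); last by rewrite -in_setE.
    by rewrite lee_fin; case: (l \in C) => /=; rewrite ?mulr1 ?mulr0; lra.
  rewrite mulr0 addr0; have [lC|lC] := boolP (l \in C).
    by rewrite mulr1; apply: VC; rewrite -in_setE.
  by rewrite mulr0; exact: line_variation_ge0.
by move: K; rewrite lee_pmul2l// lte_fin mulr_gt0.
Qed.

(** The cores exhaust the interior as the scale of the mollifier tends to 0.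
    The set [O] is meant for equality cases: it must be null when the
    perimeter equals the measure of the lines that meet the interior. *)
Lemma lines_le_hausdorff (Om : set (R * R)) (O : set (R * R)) (r0 : R) :
  compact Om -> measurable O -> 0 < r0 ->
  (forall l, O l -> 0 <= l.1 <= pi /\ exists t1 t2 t3, [/\ t1 < t2 < t3,
     forall y, eucl_dist (frame (dir l.1) (l.2, t1)) y < r0 -> Om y,
     forall y, eucl_dist (frame (dir l.1) (l.2, t2)) y < r0 -> ~ Om y &
     forall y, eucl_dist (frame (dir l.1) (l.2, t3)) y < r0 -> Om y]) ->
  (leb2 (lines Om°) + leb2 O <= hausdorff1 (boundary Om))%E.
Proof.
move=> cOm mO r00 hO.
have [->|Hfin] := eqVneq (hausdorff1 (boundary Om)) +oo%E; first by rewrite leey.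
have H0 := hausdorff1_ge0 (boundary Om).
have Hfn : hausdorff1 (boundary Om) \is a fin_num by rewrite ge0_fin_numE// ltey.
apply/lee_addgt0Pr => d d0; rewrite -(fineK Hfn) -EFinD; set H := (_ + d).
have OH : (hausdorff1 (boundary Om) < H%:E)%E.
  by rewrite -(fineK Hfn) lte_fin ltrDl.
pose C n := lines (core Om (r0 / n.+1%:R))°.
have Cn n : (leb2 (C n) + leb2 O <= H%:E)%E.
  apply: lines_core_le OH => //; first exact: hO.
  by rewrite divr_gt0//= ler_pdivrMr// ler_peMr ?(ltW r00)// ler1n.
have cvgC : leb2 (C n) @[n --> \oo] --> leb2 (\bigcup_n C n).
  apply: nondecreasing_cvg_mu.
  - by move=> n; apply: measurable_lines; exact: open_interior.
  - by apply: bigcup_measurable => n _; apply: measurable_lines; exact: open_interior.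
  - move=> m n mn; apply/subsetPset => l [l1 [x xC xl]]; split => //; exists x => //.
    apply: interiorS xC => z zc y zy; apply: zc; apply: (lt_le_trans zy).
    by rewrite ler_pM2l// lef_pV2 ?posrE// ler_nat.
have CE : \bigcup_n C n = lines Om°.
  apply/seteqP; split => l.
    move=> [n _ [l1 [x xC xl]]]; split => //; exists x => //.
    apply: interiorS xC => z; apply; rewrite eucl_distxx divr_gt0//.
  move=> [l1 [x xO xl]].
  have /nbhs_euclP[r rr hr] := xO.
  have r2 : 0 < r / (2 * r0) by rewrite divr_gt0// mulr_gt0.
  have [n _ hn] := near_infty_natSinv_lt (PosNum r2).
  exists n => //; split => //; exists x => //.
  apply/nbhs_euclP; exists (r / 2); first by rewrite divr_gt0.
  move=> z xz y zy; apply: hr.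
  have := eucl_dist_triangle z x y => h; apply: (le_lt_trans h).
  have : eucl_dist z y < r / 2.
    apply: (lt_le_trans zy); have := hn n (leqnn n); rewrite /= => /ltW hn'.
    have -> : r / 2 = r0 * (r / (2 * r0)) by field; rewrite gt_eqF.
    by rewrite ler_pM2l.
  by lra.
rewrite -CE.
have : (leb2 (C n) + leb2 O)%E @[n --> \oo] --> (leb2 (\bigcup_n C n) + leb2 O)%E.
  apply: cvgeD => //; last exact: cvg_cst.
  by apply: ge0_adde_def; rewrite inE measure_ge0.
by move=> /cvge_to_le; apply; exact: nearW.
Qed.

End LinesHausdorff.

(** * The equilibrium measure of a disc *)

Section DiscMeasure.
Context {R : realType}.
Implicit Types (s t p q h : R) (u v x y z l c : R * R).

(** For [|t| < s] this is [pi] times the arcsine density; outside it vanishes,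
    because a square root of a negative number and the inverse of 0 are 0. *)
Definition arcsine s t : R := (Num.sqrt (s ^+ 2 - t ^+ 2))^-1.

Lemma arcsine_ge0 s t : 0 <= arcsine s t.
Proof. by rewrite invr_ge0 sqrtr_ge0. Qed.

Lemma measurable_inv : measurable_fun [set: R] (@GRing.inv R).
Proof.
have m0 : measurable [set 0 : R] by exact: measurable_set1.
have -> : [set: R] = [set 0] `|` ~` [set 0] by rewrite setUv.
apply/measurable_funU => //; first exact: measurableC.
split.
  apply: (@eq_measurable_fun _ _ _ _ _ (cst 0 : R -> R)); last exact: measurable_cst.
  by move=> x; rewrite inE => ->; rewrite invr0.
apply: open_continuous_measurable_fun.
  by apply: closed_openC; apply: accessible_closed_set1; apply: hausdorff_accessible; exact: norm_hausdorff.
by move=> x; rewrite inE => /eqP x0; exact: inv_continuous.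
Qed.

Lemma measurable_arcsine s : measurable_fun [set: R] (arcsine s).
Proof.
apply: measurableT_comp; first exact: measurable_inv.
apply: measurableT_comp; first exact: (continuous_measurable_fun (@sqrt_continuous R)).
by apply: measurable_funB => //; exact: measurable_funX.
Qed.

Lemma arcsine_eq0 s t : 0 <= s -> s <= `|t| -> arcsine s t = 0.
Proof.
move=> s0 st; rewrite /arcsine ler0_sqrtr ?invr0// subr_le0 -(real_normK (num_real t)).
by rewrite ler_sqr// nnegrE.
Qed.

Lemma is_derive_asin_scale s t : 0 < s -> `|t| < s ->
  is_derive t 1 (fun t => asin (t / s)) (arcsine s t).
Proof.
move=> s0 ts; have ts1 : -1 < t / s < 1.
  by rewrite ltr_pdivlMr// ltr_pdivrMr// mulN1r mul1r -ltr_norml.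
have d1 : is_derive t 1 (fun t => t / s) s^-1.
  by apply: trigger_derive; rewrite /GRing.scale/=; ring.
have := @is_derive1_comp _ asin (fun t => t / s) t _ _ (is_derive1_asin ts1) d1.
move=> h; apply: (is_derive_eq h); rewrite /arcsine.
have -> : s ^+ 2 - t ^+ 2 = s ^+ 2 * (1 - (t / s) ^+ 2) by field; rewrite gt_eqF.
by rewrite sqrtrM ?sqr_ge0// sqrtr_sqr gtr0_norm// invfM mulrC.
Qed.

Lemma integral_arcsine_itv s f : 0 < s -> 0 < f < pi / 2 ->
  (\int[leb]_(t in `[(- (s * sin f))%R, (s * sin f)%R]) (arcsine s t)%:E = (2 * f)%:E)%E.
Proof.
move=> s0 /andP[f0 fp]; set a := s * sin f.
have pi0 := @pi_gt0 R.
have sf0 : 0 < sin f by apply: sin_gt0_pihalf; rewrite f0.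
have sf1 : sin f < 1.
  have f_in : f \in `[- (pi / 2), pi / 2] by rewrite in_itv/=; apply/andP; split; lra.
  have p_in : pi / 2 \in `[- (pi / 2), pi / 2 : R] by rewrite in_itv/=; apply/andP; split; lra.
  by rewrite -(sin_pihalf R) ltr_sin.
have a0 : 0 < a by rewrite mulr_gt0.
have as_ : a < s by rewrite gtr_pMr.
have dF t : t \in `[- a, a] -> is_derive t 1 (fun t => asin (t / s)) (arcsine s t).
  rewrite in_itv/= -ler_norml => ta; apply: is_derive_asin_scale => //.
  exact: le_lt_trans ta as_.
have cF t : t \in `[- a, a] -> {for t, continuous (fun t => asin (t / s))}.
  move=> ta; apply: differentiable_continuous; apply/derivable1_diffP.
  by have := dF t ta => ?; exact: ex_derive.
have aa : - a < a by lra.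
rewrite integral_leb//; last by apply: measurable_funTS; exact: measurable_arcsine.
rewrite (@continuous_FTC2 _ _ (fun t => asin (t / s))) //.
- have as1 : a / s = sin f by rewrite /a mulrC mulKf// gt_eqF.
  rewrite mulNr as1 -sinN !sinK ?in_itv/=; last 2 first.
  + by apply/andP; split; lra.
  + by apply/andP; split; lra.
  by rewrite -EFinB; congr EFin; ring.
- apply: continuous_in_subspaceT => t; rewrite inE/= in_itv/= -ler_norml => ta.
  have ts : 0 < s ^+ 2 - t ^+ 2.
    rewrite subr_gt0 -(real_normK (num_real t)) ltr_sqr ?nnegrE// ?(ltW s0)//.
    exact: le_lt_trans ta as_.
  apply: cvgV; first by rewrite gt_eqF// sqrtr_gt0.
  apply: continuous_cvg; first exact: sqrt_continuous.
  apply: cvgB; first exact: cvg_cst.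
  by under eq_fun do rewrite expr2; rewrite expr2; apply: cvgM; exact: cvg_id.
- split.
  + move=> t ta; have := dF t; rewrite (subset_itv_oo_cc ta) => /(_ isT) ?; exact: ex_derive.
  + by apply: cvg_at_right_filter; apply: cF; rewrite in_itv/= lexx ltW.
  + by apply: cvg_at_left_filter; apply: cF; rewrite in_itv/= lexx ltW.
- move=> t ta; have := dF t; rewrite (subset_itv_oo_cc ta) => /(_ isT) ?.
  by rewrite derive1E derive_val.
Qed.

(** The density is unbounded at the end points, so the integral is reached
    from the intervals [[- s sin f, s sin f]], with [f] increasing to [pi /
    2]. *)
Lemma integral_arcsine s : 0 < s -> (\int[leb]_t (arcsine s t)%:E = pi%:E)%E.
Proof.
move=> s0; have pi0 := @pi_gt0 R.
pose f (n : nat) : R := pi / 2 * (1 - n.+2%:R^-1).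
have n1 (n : nat) : 0 < (n.+2%:R^-1 : R) < 1.
  by rewrite invr_gt0 ltr0n/= invf_lt1 ?ltr1n.
have fb n : 0 < f n < pi / 2.
  have /andP[h1 h2] := n1 n; rewrite /f; apply/andP; split.
    by rewrite mulr_gt0 ?subr_gt0// divr_gt0.
  by rewrite gtr_pMr ?divr_gt0// ltrBlDr ltrDl.
pose F (n : nat) : set R := `[- (s * sin (f n)), s * sin (f n)]%classic.
have fmono m n : (m <= n)%N -> f m <= f n.
  by move=> mn; rewrite ler_pM2l ?divr_gt0// lerD2l lerN2 lef_pV2 ?posrE// ler_nat !ltnS.
have fin n : f n \in `[- (pi / 2), pi / 2].
  by rewrite in_itv/=; have /andP[h1 h2] := fb n; apply/andP; split; lra.
have cvgF : (\int[leb]_(t in F n) (arcsine s t)%:E)%E @[n --> \oo] -->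
    (\int[leb]_(t in \bigcup_n F n) (arcsine s t)%:E)%E.
  apply: ge0_nondecreasing_set_cvg_integral.
  - move=> m n mn; apply/subsetPset => t; rewrite /F/= !in_itv/= -!ler_norml => /le_trans; apply.
    by rewrite ler_pM2l// leNgt ltr_sin// -leNgt; exact: fmono.
  - by move=> n; exact: measurable_itv.
  - by move=> n; apply/measurable_EFinP/measurable_funTS; exact: measurable_arcsine.
  - by move=> n t _; rewrite lee_fin arcsine_ge0.
have UE : (\int[leb]_(t in \bigcup_n F n) (arcsine s t)%:E = \int[leb]_t (arcsine s t)%:E)%E.
  rewrite integral_mkcond; apply: eq_integral => t _; rewrite patchE.
  case: ifPn => //; rewrite notin_setE => tF; congr EFin; apply/esym/arcsine_eq0; first exact: ltW.
  rewrite leNgt; apply/negP => ts; apply: tF.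
  have t1 : -1 <= `|t| / s < 1.
    by rewrite ltr_pdivrMr// mul1r ts andbT (le_trans _ (divr_ge0 _ _)) ?(ltW s0)// lerN10.
  have t1' : -1 <= `|t| / s <= 1 by case/andP: t1 => -> /ltW.
  have := asin_ltpi2 t1; rewrite -subr_gt0 => d0.
  have d2 : 0 < (pi / 2 - asin (`|t| / s)) / (pi / 2) by rewrite divr_gt0// divr_gt0.
  have [n _ hn] := near_infty_natSinv_lt (PosNum d2).
  exists n => //; rewrite /F/= in_itv/= -ler_norml mulrC -ler_pdivrMr//.
  rewrite -[leLHS]asinK ?in_itv// leNgt ltr_sin//; last first.
    by rewrite in_itv/= asin_geNpi2// asin_lepi2.
  rewrite -leNgt; have := hn n.+1 (leqnSn n); rewrite /= ltr_pdivlMr ?divr_gt0// => h; rewrite /f.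
  by move: h; set k := n.+2%:R^-1; set g := asin _; lra.
rewrite UE in cvgF; move: cvgF; under eq_fun do rewrite integral_arcsine_itv//.
move=> cvgF; apply: (cvg_unique _ cvgF) => //.
apply: cvg_EFin; first exact: nearW.
have -> : fine \o (fun n : nat => (2 * f n)%:E)%E = (fun n => pi * (1 - n.+2%:R^-1)).
  by apply/funext => n /=; rewrite /f; field.
have {2}-> : (pi : R) = pi * (1 - 0) by rewrite subr0 mulr1.
apply: cvgM; first exact: cvg_cst.
apply: cvgB; first exact: cvg_cst.
have := @cvg_harmonic R; rewrite -(cvg_shiftS (@harmonic R)); exact.
Qed.

(** The equilibrium density [1 / (2 pi r sqrt(r^2 - |z - c|^2))] of the disc
    for the Riesz kernel; the square root and the inverse of 0 being 0, it
    vanishes outside the open disc. *)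
Definition disc_density c (r : R) z : R :=
  (2 * pi * r)^-1 * arcsine r (norm2 (z - c)).

Lemma disc_density_ge0 c (r : R) z : 0 <= r -> 0 <= disc_density c r z.
Proof.
by move=> r0; rewrite mulr_ge0 ?arcsine_ge0// invr_ge0 mulr_ge0// mulr_ge0// pi_ge0.
Qed.

Lemma measurable_disc_density c (r : R) : measurable_fun [set: R * R] (disc_density c r).
Proof.
apply: measurable_funM => //; apply: measurableT_comp; first exact: measurable_arcsine.
apply: measurableT_comp; first exact: measurable_norm2.
by apply: measurable_planeB => //; exact: measurable_cst.
Qed.

(** On a line at distance [|q|] from the centre, the radial density of the
    disc is the arcsine density of the chord, whose half-length is a square
    root that vanishes when the line misses the disc. *)
Lemma arcsine_norm2 (r : R) q t : arcsine r (norm2 (q, t)) = arcsine (Num.sqrt (r ^+ 2 - q ^+ 2)) t.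
Proof.
rewrite /arcsine sqr_norm2/=; have [qr|rq] := leP 0 (r ^+ 2 - q ^+ 2).
  by rewrite sqr_sqrtr// opprD addrA.
by rewrite (ltr0_sqrtr rq) expr0n/= !ler0_sqrtr//; have := sqr_ge0 t; lra.
Qed.

(** The chord at distance [q] from the centre carries an arcsine density, whose
    mass is [pi] whatever the length of the chord; so every orthogonal projection
    of the disc measure on a line is uniform. *)
Lemma integral_disc_slice (r : R) q : 0 < r ->
  (\int[leb]_t ((2 * pi * r)^-1 * arcsine r (norm2 (q, t)))%:E =
   ((2 * r)^-1 * \1_`]- r, r[ q)%:E)%E.
Proof.
move=> r0; have pi0 := @pi_gt0 R.
under eq_integral do rewrite arcsine_norm2 EFinM.
rewrite ge0_integralZl//; last 3 first.
- by apply/measurable_EFinP; exact: measurable_arcsine.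
- by move=> t _; rewrite lee_fin arcsine_ge0.
- by rewrite lee_fin invr_ge0 mulr_ge0// ?mulr_ge0// ltW.
rewrite indicE; have [qr|qr] := boolP (q \in `]- r, r[%classic).
  have s0 : 0 < Num.sqrt (r ^+ 2 - q ^+ 2).
    move: qr; rewrite inE/= in_itv/= -ltr_norml => qr.
    rewrite sqrtr_gt0 subr_gt0 -(real_normK (num_real q)) ltr_sqr ?nnegrE//.
    exact: ltW.
  rewrite [X in (_ * X)%E](integral_arcsine s0) -EFinM; congr EFin.
  have pn : pi != 0 :> R by rewrite gt_eqF.
  by rewrite /= mulr1 (mulrAC 2 pi r) invfM -mulrA mulVf ?mulr1.
rewrite [X in (_ * X)%E]integral0_eq ?mule0 ?mulr0// => t _.
rewrite ler0_sqrtr ?arcsine_eq0//.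
rewrite subr_le0 -(real_normK (num_real q)) ler_sqr ?nnegrE// ?(ltW r0)//.
by rewrite leNgt ltr_norml; apply/negP => qr'; move: qr; rewrite notin_setE/= in_itv/= qr'.
Qed.

Lemma integral_disc_density (r : R) c (th : R) (g : R -> R) : 0 < r ->
  measurable_fun [set: R] g -> (forall q, 0 <= g q) ->
  (\int[leb2]_z (g (dot z (dir th)) * disc_density c r z)%:E =
   (2 * r)^-1%:E * \int[leb]_(q in `](- r)%R, r[) (g (q + dot c (dir th)))%:E)%E.
Proof.
move=> r0 mg g0; set n := dir th.
have n1 : norm2 n = 1 by exact: norm2_dir.
have mgd : measurable_fun [set: R * R] (fun z => (g (dot z n) * disc_density c r z)%:E).
  apply/measurable_EFinP; apply: measurable_funM; last exact: measurable_disc_density.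
  by apply: measurableT_comp => //; apply: measurable_dot => //; exact: measurable_cst.
have gd0 z : (0 <= (g (dot z n) * disc_density c r z)%:E)%E.
  by rewrite lee_fin mulr_ge0// disc_density_ge0// ltW.
rewrite -(@ge0_integral_shift2 _ c)// (@ge0_integral_frame _ n)//; last first.
  apply: measurableT_comp mgd _; apply: measurable_planeD => //; exact: measurable_cst.
rewrite -ge0_integralZl//; last 3 first.
- apply/measurable_EFinP/measurable_funTS; apply: measurableT_comp => //; exact: measurable_funD.
- by move=> q _; rewrite lee_fin.
- by rewrite lee_fin invr_ge0 mulr_ge0// ltW.
rewrite [RHS]integral_mkcond; apply: eq_integral => q _.
transitivity (\int[leb]_t ((g (q + dot c n))%:E * ((2 * pi * r)^-1 * arcsine r (norm2 (q, t)))%:E))%E.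
  apply: eq_integral => t _; rewrite -EFinM; congr EFin.
  by rewrite dotDl dot_frame// /disc_density addrK norm2_frame.
rewrite ge0_integralZl//; last 3 first.
- apply/measurable_EFinP; apply: measurable_funM => //.
  apply: measurableT_comp; first exact: measurable_arcsine.
  apply: measurableT_comp; first exact: measurable_norm2.
  by apply: measurable_fun_pair => //; exact: measurable_cst.
- move=> t _; rewrite lee_fin mulr_ge0 ?arcsine_ge0// invr_ge0 mulr_ge0// ?(ltW r0)//.
  by rewrite mulr_ge0// pi_ge0.
- by rewrite lee_fin.
rewrite [X in (_ * X)%E]integral_disc_slice// patchE indicE.
by case: ifPn => _; rewrite ?mulr0 ?mule0// mulr1 -!EFinM mulrC.
Qed.

Definition disc_measure c (r : {posnum R}) (A : set (R * R)) : \bar R :=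
  (\int[leb2]_(z in A) (disc_density c r%:num z)%:E)%E.

Section Instances.
Variables (c : R * R) (r : {posnum R}).
Local Notation mu := (disc_measure c r).

Let mu0 : mu set0 = 0%E.
Proof. by rewrite /disc_measure integral_set0. Qed.

Let mu_ge0 A : (0 <= mu A)%E.
Proof. by apply: integral_ge0 => z _; rewrite lee_fin disc_density_ge0. Qed.

Let mu_sigma : semi_sigma_additive mu.
Proof.
move=> F mF tF mUF; rewrite /disc_measure; apply: cvg_toP.
  apply: ereal_nondecreasing_is_cvgn => m n mn.
  apply: lee_sum_nneg_natr => // k _ _.
  exact: mu_ge0.
rewrite ge0_integral_bigcup//.
- by apply/measurable_EFinP/measurable_funTS; exact: measurable_disc_density.
- by move=> z _; rewrite lee_fin disc_density_ge0.
Qed.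

HB.instance Definition _ := isMeasure.Build _ _ _ mu mu0 mu_ge0 mu_sigma.

Let mu_setT : mu setT = 1%E.
Proof.
rewrite /disc_measure; have := @integral_disc_density r%:num c 0 (fun=> 1) _ _ _.
move=> /(_ _ _ (fun=> ler01)) h; under eq_integral do rewrite -[disc_density _ _ _]mul1r.
rewrite h//; have -> : (\int[leb]_(q in `](- r%:num)%R, r%:num[) 1%:E = (2 * r%:num)%:E)%E.
  rewrite integral_cst//= mul1e leb_itv/= lte_fin.
  have -> : - r%:num < r%:num :> R by rewrite gtrN.
  by rewrite -EFinB; congr EFin; ring.
by rewrite -EFinM mulVf// mulf_neq0.
Qed.

HB.instance Definition _ := @Measure_isProbability.Build _ _ R mu mu_setT.

End Instances.

(** A uniform projection on an interval of length [2 r] has density [1 / (2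
    r)]. *)
Lemma disc_measure_through c (r : {posnum R}) h l : 0 < h ->
  (disc_measure c r (through h l) <= (h / r%:num)%:E)%E.
Proof.
move=> h0; case: l => th p.
have r0 : 0 < r%:num :> R by [].
have [thp|nth] := boolP (0 <= th <= pi); last first.
  have -> : through h (th, p) = set0.
    by rewrite -subset0 => z [/= thp]; rewrite thp in nth.
  by rewrite measure0 lee_fin divr_ge0// ltW.
pose g q : R := \1_`]p - h, p + h[ q.
have mg : measurable_fun [set: R] g by apply: measurable_indic; exact: measurable_itv.
have -> : disc_measure c r (through h (th, p)) =
    (\int[leb2]_z (g (dot z (dir th)) * disc_density c r%:num z)%:E)%E.
  rewrite /disc_measure integral_mkcond; apply: eq_integral => z _; rewrite patchE.
  have zE : (z \in through h (th, p)) = (dot z (dir th) \in `]p - h, p + h[%classic).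
    apply/idP/idP; rewrite !inE/= in_itv/=.
      by move=> [_] /=; rewrite ltr_norml => /andP[? ?]; apply/andP; split; lra.
    move=> /andP[? ?]; split => //=; rewrite ltr_norml; apply/andP; split; lra.
  by rewrite /g indicE zE; case: ifP; rewrite ?mul1r ?mul0r.
rewrite integral_disc_density//.
apply: (@le_trans _ _ ((2 * r%:num)^-1%:E * (2 * h)%:E)%E); last first.
  by rewrite -EFinM lee_fin le_eqVlt; apply/orP; left; apply/eqP; field.
rewrite lee_wpmul2l ?lee_fin ?invr_ge0//.
set d := dot c (dir th).
apply: (@le_trans _ _ (\int[leb]_q (g (q + d))%:E)%E).
  apply: ge0_subset_integral => //.
  apply/measurable_EFinP; apply: measurableT_comp => //; exact: measurable_funD.
  by move=> q _; rewrite lee_fin.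
rewrite (@ge0_integral_shift _ d (fun q => (g q)%:E)); last 2 first.
- exact/measurable_EFinP.
- by move=> q; rewrite lee_fin.
rewrite /g integral_indic// setIT.
have -> : (2 * h)%:E = leb `]p - h, p + h[%classic.
  rewrite leb_itv/= lte_fin; have -> : p - h < p + h by lra.
  by rewrite -EFinB; congr EFin; ring.
by [].
Qed.

Lemma disc_measure_disc c (r : {posnum R}) :
  disc_measure c r [set x | eucl_dist c x < r%:num] = 1%E.
Proof.
transitivity (disc_measure c r setT); last exact: probability_setT.
rewrite /disc_measure [LHS]integral_mkcond; apply: eq_integral => z _.
rewrite patchE; case: ifPn => //; rewrite notin_setE => zr; congr EFin.
apply/esym; rewrite /disc_density arcsine_eq0 ?mulr0//.
rewrite ger0_norm ?norm2_ge0// -eucl_distE eucl_distC leNgt; apply/negP => zr'.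
exact: zr.
Qed.

(** One factor of the square in [strip_energyE] is bounded by [h / r]; the
    other one has total integral [2 h pi], since every point is close to lines
    of this measure. *)
Lemma energy_disc_measure c (r : {posnum R}) :
  (energy (disc_measure c r) <= (pi / (2 * r%:num))%:E)%E.
Proof.
apply: energy_le_strip_energy => h h0; rewrite strip_energyE.
set mu := disc_measure c r.
have [_ sw] := @integral_strip_swap _ h mu (fun=> 1%E) (measurable_cst _) (fun=> lee01).
have mt : (\int[leb2]_l mu (through h l) = (2 * h * pi)%:E)%E.
  under eq_integral do rewrite -[mu _]mul1e.
  rewrite -[LHS]sw; transitivity (\int[disc_measure c r]_x (2 * h * pi)%:E)%E.
    apply: eq_integral => x _; rewrite integral_cst; last exact: measurable_strip.
    by rewrite mul1e -(leb2_stripI_diag x h0) setIid.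
  rewrite integral_cst// [X in (_ * X)%E](_ : _ = 1%E) ?mule1//.
  exact: probability_setT.
apply: (@le_trans _ _ (((2 * h) ^- 2)%:E * \int[leb2]_l ((h / r%:num)%:E * mu (through h l)))%E).
  rewrite lee_wpmul2l ?lee_fin ?invr_ge0 ?sqr_ge0//; apply: ge0_le_integral => //.
  - by move=> l _; rewrite mule_ge0.
  - by apply: emeasurable_funM; exact: measurable_mu_through.
  - by apply: emeasurable_funM => //; exact: measurable_mu_through.
  - by move=> l _; rewrite lee_wpmul2r// disc_measure_through.
rewrite ge0_integralZl//; last 2 first.
- exact: measurable_mu_through.
- by rewrite lee_fin divr_ge0// ltW.
rewrite [X in (_ * (_ * X))%E]mt -!EFinM lee_fin le_eqVlt; apply/orP; left; apply/eqP.
by field; rewrite !gt_eqF.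
Qed.

End DiscMeasure.

(** * The outer measure of Hausdorff, and circles *)

Section Hausdorff.
Context {R : realType}.
Implicit Types (A B : set (R * R)) (d : R).

Lemma eucl_diam0 : eucl_diam set0 = 0%E :> \bar R.
Proof.
apply/eqP; rewrite eq_le eucl_diam_ge0 andbT.
by apply: eucl_diam_le.
Qed.

Lemma le_hausdorff1_pre A B d : A `<=` B -> (hausdorff1_pre d A <= hausdorff1_pre d B)%E.
Proof.
move=> AB; apply: le_ereal_inf => _ [F [BF Fd] <-]; exists F => //.
by split => //; exact: subset_trans BF.
Qed.

Lemma hausdorff1_pre_le A d : 0 < d -> (hausdorff1_pre d A <= hausdorff1 A)%E.
Proof. by move=> d0; apply: ereal_sup_ubound; exists d. Qed.

Lemma hausdorff1_le_pre A (x : \bar R) :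
  (forall d, 0 < d -> (hausdorff1_pre d A <= x)%E) -> (hausdorff1 A <= x)%E.
Proof. by move=> Ax; apply: ub_ereal_sup => _ [d d0 <-]; exact: Ax. Qed.

Lemma le_hausdorff1 A B : A `<=` B -> (hausdorff1 A <= hausdorff1 B)%E.
Proof.
move=> AB; apply: hausdorff1_le_pre => d d0.
exact: le_trans (le_hausdorff1_pre d AB) (hausdorff1_pre_le B d0).
Qed.

Lemma hausdorff1_pre_bigcup (A : nat -> set (R * R)) d :
  (hausdorff1_pre d (\bigcup_n A n) <= \sum_(0 <= n <oo) hausdorff1_pre d (A n))%E.
Proof.
have [[i Ai]|/forallNP Afin] := pselect (exists i, hausdorff1_pre d (A i) = +oo%E).
  rewrite (@eseries_pinfty _ _ _ i)// ?leey// => n _.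
  by rewrite -ltNye (lt_le_trans _ (hausdorff1_pre_ge0 _ _)).
apply/lee_addgt0Pr => e e0.
rewrite (le_trans _ (epsilon_trick _ (fun n => hausdorff1_pre_ge0 d (A n)) (ltW e0)))//.
have /choice[F PF] : forall n, exists F : nat -> set (R * R),
    [/\ A n `<=` \bigcup_i F i, forall i, (eucl_diam (F i) <= d%:E)%E &
     (\sum_(0 <= i <oo) eucl_diam (F i) <= hausdorff1_pre d (A n) + (e / (2 ^ n.+1)%:R)%:E)%E].
  move=> n; have en : 0 < e / (2 ^ n.+1)%:R by rewrite divr_gt0// ltr0n expn_gt0.
  have fn : hausdorff1_pre d (A n) \is a fin_num.
    by rewrite ge0_fin_numE ?hausdorff1_pre_ge0// ltey; exact/eqP/Afin.
  have [_ [F [AF Fd] <-] h] := lb_ereal_inf_adherent en fn.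
  by exists F; split => //; exact: ltW.
pose G (k : nat * nat) := F k.1 k.2.
apply: (@le_trans _ _ (\esum_(k in setT) eucl_diam (G k))%E).
  have /card_esym/ppcard_eqP[f] := card_nat2.
  apply: ereal_inf_lbound; exists (G \o f) => /=.
    split; last by move=> i; have [_ h _] := PF (f i).1; exact: h.
    move=> x [n _ Anx]; have [/(_ _ Anx)[i _ Fx] _ _] := PF n.
    by exists (f^-1%FUN (n, i)) => //=; rewrite /G invK ?inE.
  rewrite nneseries_esumT; last by move=> n; exact: eucl_diam_ge0.
  by apply/esym; apply: (@reindex_esum _ _ _ [set: nat]); exact: bij.
have -> : (\esum_(k in setT) eucl_diam (G k) = \sum_(0 <= n <oo) \sum_(0 <= i <oo) eucl_diam (F n i))%E.
  have -> : [set: nat * nat] = [set: nat] `*`` (fun=> [set: nat]).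
    by apply/seteqP; split => // -[].
  rewrite -(@esum_esum _ _ _ _ _ (fun n i => eucl_diam (F n i))); last by move=> *; exact: eucl_diam_ge0.
  rewrite nneseries_esumT; last by move=> n; apply: nneseries_ge0 => i _ _; exact: eucl_diam_ge0.
  apply: eq_esum => n _; rewrite nneseries_esumT// => i; exact: eucl_diam_ge0.
apply: lee_nneseries => [n _ _|n _]; first by apply: nneseries_ge0 => i _ _; exact: eucl_diam_ge0.
by have [] := PF n.
Qed.

Lemma hausdorff10 : hausdorff1 set0 = 0%E :> \bar R.
Proof.
apply/eqP; rewrite eq_le hausdorff1_ge0 andbT; apply: hausdorff1_le_pre => d d0.
apply: ereal_inf_lbound; exists (fun=> set0); last first.
  by apply: eseries0 => i _ _; exact: eucl_diam0.
by split => [//|i]; rewrite eucl_diam0 lee_fin ltW.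
Qed.

Lemma hausdorff1_bigcup : sigma_subadditive (@hausdorff1 R).
Proof.
move=> A; apply: hausdorff1_le_pre => d d0; apply: (le_trans (hausdorff1_pre_bigcup _ _)).
by apply: lee_nneseries => n *; [exact: hausdorff1_pre_ge0|exact: hausdorff1_pre_le].
Qed.

HB.instance Definition _ := isOuterMeasure.Build R (R * R)%type (@hausdorff1 R)
  hausdorff10 hausdorff1_ge0 le_hausdorff1 hausdorff1_bigcup.

Lemma hausdorff1U A B : (hausdorff1 (A `|` B) <= hausdorff1 A + hausdorff1 B)%E.
Proof. exact: (outer_measureU2 (@hausdorff1 R)). Qed.

Lemma hausdorff1_null_bigcup (A : nat -> set (R * R)) :
  (forall n, hausdorff1 (A n) = 0%E) -> hausdorff1 (\bigcup_n A n) = 0%E.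
Proof.
move=> A0; apply/eqP; rewrite eq_le hausdorff1_ge0 andbT.
by apply: (le_trans (hausdorff1_bigcup A)); rewrite eseries0// => n _ _; exact: A0.
Qed.

(** A cover by sets of small diameter splits into covers of two sets at
    positive distance. *)
Lemma hausdorff1_separated A B d : 0 < d ->
  (forall x y, A x -> B y -> d <= eucl_dist x y) ->
  (hausdorff1 A + hausdorff1 B <= hausdorff1 (A `|` B))%E.
Proof.
move=> d0 AB.
have key a : 0 < a -> (hausdorff1_pre a A + hausdorff1_pre a B <= hausdorff1 (A `|` B))%E.
  move=> a0; pose q := Num.min a (d / 2).
  have q0 : 0 < q by rewrite lt_min a0 divr_gt0.
  have qd : q < d by rewrite gt_min; apply/orP; right; lra.
  have qa : q <= a by rewrite ge_min lexx.
  apply: le_trans (hausdorff1_pre_le _ q0); apply: le_ereal_inf_tmp => _ [F [ABF Fq] <-].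
  pose P i : bool := `[< exists2 x, A x & F i x >].
  pose FA i := if P i then F i else set0.
  pose FB i := if P i then set0 else F i.
  have Fa i : (eucl_diam (F i) <= a%:E)%E by rewrite (le_trans (Fq i))// lee_fin.
  apply: (@le_trans _ _ (\sum_(0 <= i <oo) eucl_diam (FA i) + \sum_(0 <= i <oo) eucl_diam (FB i))%E).
    apply: leeD; apply: ereal_inf_lbound.
    - exists FA => //; split.
        move=> x Ax; have [i _ Fx] := ABF x (or_introl Ax); exists i => //.
        by rewrite /FA ifT//; apply/asboolP; exists x.
      by move=> i; rewrite /FA; case: ifP => _ //; rewrite eucl_diam0 lee_fin ltW.
    - exists FB => //; split.
        move=> x Bx; have [i _ Fx] := ABF x (or_intror Bx); exists i => //.
        rewrite /FB ifF//; apply/negP => /asboolP[y Ay Fy].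
        have := eucl_diam_ge Fy Fx; move/le_trans => /(_ _ (Fq i)); rewrite lee_fin.
        by apply/negP; rewrite -ltNge (lt_le_trans qd)// AB.
      by move=> i; rewrite /FB; case: ifP => _ //; rewrite eucl_diam0 lee_fin ltW.
  rewrite -nneseriesD; try by move=> *; exact: eucl_diam_ge0.
  apply: lee_nneseries => [i _ _|i _]; first by rewrite adde_ge0// eucl_diam_ge0.
  by rewrite /FA /FB; case: ifP => _; rewrite eucl_diam0 ?adde0 ?add0e.
have pre_mono a b C : 0 < a -> a <= b -> (hausdorff1_pre b C <= hausdorff1_pre a C)%E.
  move=> a0 ab; apply: le_ereal_inf => _ [F [CF Fa] <-]; exists F => //; split => // i.
  by rewrite (le_trans (Fa i))// lee_fin.
have [->|fAB] := eqVneq (hausdorff1 (A `|` B)) +oo%E; first exact: leey.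
have finle C : C `<=` A `|` B -> hausdorff1 C \is a fin_num.
  move=> CAB; rewrite ge0_fin_numE ?hausdorff1_ge0//.
  by rewrite (le_lt_trans (le_hausdorff1 CAB))// ltey.
have finpre C a : C `<=` A `|` B -> 0 < a -> hausdorff1_pre a C \is a fin_num.
  move=> CAB a0; rewrite ge0_fin_numE ?hausdorff1_pre_ge0//.
  by rewrite (le_lt_trans (hausdorff1_pre_le _ a0))// -ge0_fin_numE ?hausdorff1_ge0// finle.
have fA := finle A (@subsetUl _ _ _); have fB := finle B (@subsetUr _ _ _).
rewrite -leeBrDr//; apply: hausdorff1_le_pre => a a0; rewrite leeBrDr//.
rewrite addeC -leeBrDr; last exact: finpre.
apply: hausdorff1_le_pre => b b0; rewrite leeBrDr; last exact: finpre.
have m0 : 0 < Num.min a b by rewrite lt_min a0.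
rewrite addeC; apply: le_trans (key _ m0).
by apply: leeD; apply: pre_mono => //; rewrite ge_min lexx ?orbT.
Qed.

Lemma norm2_dirB (s t : R) : norm2 (dir s - dir t) <= `|s - t|.
Proof.
rewrite /norm2/=; have -> : (cos s - cos t) ^+ 2 + (sin s - sin t) ^+ 2 = (2 * sin ((s - t) / 2)) ^+ 2.
  have h : cos (s - t) = 1 - 2 * sin ((s - t) / 2) ^+ 2.
    have {1}-> : s - t = (s - t) / 2 + (s - t) / 2 by field.
    by rewrite cosD -!expr2 cos2sin2; ring.
  have -> : (2 * sin ((s - t) / 2)) ^+ 2 = 2 - 2 * cos (s - t) by rewrite h; ring.
  rewrite cosB.
  transitivity ((cos s ^+ 2 + sin s ^+ 2) + (cos t ^+ 2 + sin t ^+ 2) - 2 * (cos s * cos t + sin s * sin t)).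
    by ring.
  by rewrite !cos2Dsin2.
rewrite sqrtr_sqr normrM gtr0_norm//.
wlog st : s t / 0 <= s - t.
  move=> h; have [|/ltW] := leP 0 (s - t); first exact: h.
  move=> ts; rewrite distrC.
  have -> : (s - t) / 2 = - ((t - s) / 2) by ring.
  by rewrite sinN normrN; apply: h; lra.
have st2 : 0 <= (s - t) / 2 by rewrite divr_ge0.
rewrite (ger0_norm st).
have [h|h] := leP 0 (sin ((s - t) / 2)).
  by rewrite ger0_norm//; have := sin_le_id st2; lra.
rewrite ltr0_norm//; have [h1|h1] := leP ((s - t) / 2) pi.
  by have := @sin_ge0_pi R ((s - t) / 2); rewrite st2 h1 => /(_ isT); lra.
have := @pi_ge2 R; have := sin_geN1 ((s - t) / 2); lra.
Qed.

Lemma circle_param (c x : R * R) (r : R) : 0 <= r -> eucl_dist c x = r ->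
  exists2 t, 0 <= t <= 2 * pi & x = c + r *: dir t.
Proof.
move=> r0; rewrite eucl_distC eucl_distE => xr.
have [t [s [/andP[t0 tp] sE E]]] := polar (x - c); rewrite xr in sE.
have xE : x = c + s *: dir t by rewrite -E addrC subrK.
have [s0|s0] := leP 0 s.
  exists t; first by rewrite t0; lra.
  by rewrite xE -sE ger0_norm.
(* The polar form uses signed radii with angles in the upper half circle. *)
exists (t + pi); first by apply/andP; split; have := @pi_ge0 R; lra.
rewrite xE -sE ltr0_norm// /dir cosDpi sinDpi; congr (_ + _).
by congr pair => /=; rewrite /GRing.scale/=; ring.
Qed.

(** Circles are covered by small arcs, no longer than their angle. *)
Lemma hausdorff1_circle (c : R * R) (r : R) : 0 < r ->
  (hausdorff1 [set x | eucl_dist c x = r] <= (2 * pi * r)%:E)%E.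
Proof.
move=> r0; have pi0 := @pi_gt0 R; apply: hausdorff1_le_pre => d d0.
pose L := 2 * pi * r; have L0 : 0 < L by rewrite !mulr_gt0.
have [n _ hn] := near_infty_natSinv_lt (PosNum (divr_gt0 d0 L0)).
have {hn} := hn n (leqnn n) => /=; set N : R := n.+1%:R => hn.
have N0 : 0 < N by rewrite ltr0n.
have LN : L / N < d by rewrite mulrC -ltr_pdivlMr.
pose w := 2 * pi / N; have w0 : 0 < w by rewrite divr_gt0// mulr_gt0.
pose F i : set (R * R) := if (i < n.+1)%N then
  [set x | exists2 t, i%:R * w <= t <= i.+1%:R * w & x = c + r *: dir t] else set0.
have Fd i : (eucl_diam (F i) <= (r * w)%:E)%E.
  rewrite /F; case: ifP => _; last by rewrite eucl_diam0 lee_fin mulr_ge0// ltW.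
  apply: eucl_diam_le; first by rewrite mulr_ge0// ltW.
  move=> x y [s /andP[s1 s2] ->] [t /andP[t1 t2] ->].
  rewrite eucl_distE opprD addrACA subrr add0r -scalerBr norm2Z (gtr0_norm r0) ler_pM2l//.
  rewrite (le_trans (norm2_dirB _ _))//.
  move: s1 s2 t1 t2; rewrite -natr1 mulrDl mul1r => ? ? ? ?.
  by rewrite ler_norml; apply/andP; split; lra.
have rw : r * w = L / N by rewrite /w /L mulrA (mulrC r).
apply: (@le_trans _ _ (\sum_(0 <= i <oo) eucl_diam (F i))%E).
  apply: ereal_inf_lbound; exists F => //; split; last first.
    by move=> i; rewrite (le_trans (Fd i))// lee_fin rw ltW.
  move=> x /= /(circle_param (ltW r0))[t /andP[t0 t2p] ->].
  have tw0 : 0 <= t / w by rewrite divr_ge0// ltW.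
  have [t2|tlt] := eqVneq t (2 * pi).
    exists n => //; rewrite /F ltnSn; exists t => //.
    have -> : t = n.+1%:R * w by rewrite t2 /w -/N mulrCA divff ?mulr1// gt_eqF.
    by rewrite lexx andbT ler_pM2r// ler_nat.
  have tN : t / w < N.
    by rewrite ltr_pdivrMr// /w mulrCA divff ?mulr1 ?gt_eqF// lt_neqAle tlt.
  have /andP[k1 k2] := Num.Theory.truncn_itv tw0.
  set k := Num.truncn (t / w) in k1 k2.
  have kn : (k < n.+1)%N by rewrite -(ltr_nat R) (le_lt_trans k1).
  exists k => //; rewrite /F kn; exists t => //.
  by rewrite -ler_pdivlMr// k1 -ler_pdivrMr// ltW.
rewrite (nneseries_split 0 n.+1); last by move=> *; exact: eucl_diam_ge0.
rewrite [X in (_ + X)%E]eseries0 ?adde0; last first.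
  by move=> i; rewrite add0n => ni _; rewrite /F ltnNge ni eucl_diam0.
rewrite add0n; apply: (@le_trans _ _ (\sum_(0 <= i < n.+1) (r * w)%:E)%E).
  by apply: lee_sum.
rewrite sumEFin lee_fin big_const_nat iter_addr_0 subn0 -[_ *+ _]mulr_natr -/N rw mulfVK// gt_eqF//.
Qed.

End Hausdorff.

(** * Lower bounds on the capacitary energy *)

Section LowerBound.
Context {R : realType}.
Implicit Types (Om U A : set (R * R)) (t p h : R) (x y : R * R).

Lemma areaE A : measurable A -> area A = leb2 A.
Proof.
move=> mA; rewrite /area /leb2 /product_measure1.
rewrite ge0_integral_leb//.
exact: (@measurable_fun_xsection _ _ _ _ _ leb).
Qed.

Lemma boundary_closed (T : topologicalType) (A : set T) : closed A -> boundary A = A `\` A°.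
Proof. by move=> cA; rewrite /boundary -(closure_id _).1. Qed.

Section Compact.
Variable Om : set (R * R).
Hypothesis cOm : compact Om.

Let clOm : closed Om := compact_plane_closed cOm.
Let mOm : measurable Om := compact_plane_measurable cOm.

Lemma compact_boundary : compact (boundary Om).
Proof.
rewrite boundary_closed// setDE; apply: compact_closedI => //.
by apply: open_closedC; exact: open_interior.
Qed.

(** Sets of diameter [c i < q] have area at most [4 (c i)^2], which is at most
    [4 q (c i)]; the [c i] sum to at most [H] and [q] is arbitrary. *)
Lemma leb2_hausdorff_null : (hausdorff1 Om < +oo)%E -> leb2 Om = 0%E.
Proof.
move=> Hfin; have Hfn : hausdorff1 Om \is a fin_num by rewrite ge0_fin_numE ?hausdorff1_ge0.
pose H := fine (hausdorff1 Om) + 1.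
have OH : (hausdorff1 Om < H%:E)%E by rewrite -(fineK Hfn) lte_fin ltrDl.
have H0 : 0 < H by rewrite ltr_wpDl// fine_ge0 ?hausdorff1_ge0.
apply/eqP; rewrite eq_le measure_ge0 andbT; apply/lee_addgt0Pr => d d0; rewrite add0e.
pose q := d / (4 * H).
have q0 : 0 < q by rewrite divr_gt0// mulr_gt0.
have [n [F [c [oF Fc cq cov cH]]]] := hausdorff1_finite_cover cOm OH q0.
have mF i : measurable (F i) by exact: open_measurable_plane.
have FE i : (leb2 (F i) <= (4 * c i ^+ 2)%:E)%E.
  have /andP[c0 _] := cq i.
  have [F0|/set0P[w Fw]] := eqVneq (F i) set0.
    by rewrite F0 measure0 lee_fin mulr_ge0// sqr_ge0.
  pose I (s : R) : set R := `[s - c i, s + c i]%classic.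
  have -> : (4 * c i ^+ 2)%:E = leb2 (I w.1 `*` I w.2).
    transitivity (leb (I w.1) * leb (I w.2))%E; last first.
      by apply/esym; apply: product_measure1E; exact: measurable_itv.
    rewrite /I !leb_itv/= !lte_fin.
    have -> : w.1 - c i < w.1 + c i by lra.
    have -> : w.2 - c i < w.2 + c i by lra.
    by rewrite -!EFinB -EFinM; congr EFin; ring.
  apply: le_measure; rewrite ?inE//; first by apply: measurableX; exact: measurable_itv.
  move=> z Fz; have := Fc i z w Fz Fw; rewrite eucl_distE => /ltW zw.
  have z1 := le_trans (norm_fst_le (z - w)) zw; have z2 := le_trans (norm_snd_le (z - w)) zw.
  move: z1 z2; rewrite /= !ler_norml => /andP[? ?] /andP[? ?].
  by split; rewrite /I/= in_itv/=; apply/andP; split; lra.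
apply: (@le_trans _ _ (\sum_(i < n) leb2 (F i))%E).
  apply: (@le_trans _ _ (leb2 (\big[setU/set0]_(i < n) F i))); last exact: (Boole_inequality leb2).
  apply: le_measure; rewrite ?inE//; first exact: bigsetU_measurable.
  by rewrite bigcup_mkord in cov *.
apply: (@le_trans _ _ (\sum_(i < n) (4 * q * c i)%:E)%E).
  apply: lee_sum => i _; apply: (le_trans (FE i)); rewrite lee_fin.
  have /andP[c0 /ltW cqi] := cq i.
  by rewrite expr2 mulrA ler_wpM2r ?(ltW c0)// ler_wpM2l.
rewrite sumEFin lee_fin -mulr_sumr.
apply: (@le_trans _ _ (4 * q * H)); first by rewrite ler_wpM2l// mulr_ge0// ltW.
by rewrite /q le_eqVlt; apply/orP; left; apply/eqP; field; rewrite gt_eqF.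
Qed.

Lemma riesz_energyE :
  riesz_energy Om = ereal_inf [set energy mu | mu in [set mu : probability (R * R)%type R | mu Om = 1%E]].
Proof.
rewrite /riesz_energy; apply: congr1; apply: eq_imagel => mu mu1.
have mk := @measurable_riesz_kernel R.
transitivity (\int[mu]_(x in Om) \int[mu]_y riesz_kernel x y)%E.
  apply: eq_integral => x _; apply: (ge0_integral_full mOm mu1); last by move=> y; exact: riesz_kernel_ge0.
  have mp : measurable_fun [set: R * R] (fun y : R * R => (x, y)).
    by apply: measurable_fun_pair => //; exact: measurable_cst.
  exact: (measurableT_comp mk mp).
apply: (ge0_integral_full mOm mu1).
  apply: (@measurable_fun_fubini_tonelli_F _ _ _ _ R mu (fun z => riesz_kernel z.1 z.2) mk).
  by move=> z; exact: riesz_kernel_ge0.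
by move=> x; apply: integral_ge0 => y _; exact: riesz_kernel_ge0.
Qed.

Hypothesis Hfin : (hausdorff1 (boundary Om) < +oo)%E.

Lemma finite_energy_interior (mu : probability (R * R)%type R) :
  mu Om = 1%E -> (energy mu < +oo)%E -> mu Om° = 1%E.
Proof.
move=> mu1 Efin.
have mB : measurable (boundary Om).
  by apply: closed_measurable_plane; apply: compact_plane_closed; exact: compact_boundary.
have mI : measurable Om° by apply: open_measurable_plane; exact: open_interior.
have B0 : mu (boundary Om) = 0%E by apply: finite_energy_null => //; exact: compact_boundary.
have : mu Om = (mu Om° + mu (boundary Om))%E.
  have OE : Om = Om° `|` boundary Om.
    by rewrite boundary_closed// setDUK//; exact: interior_subset.
  rewrite {1}OE measureU//.
  by rewrite boundary_closed// setIDA setIC -setIDA setDv setI0.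
by rewrite B0 adde0 mu1.
Qed.

(** Testing with affine densities on the lines bounds the capacitary energy
    itself, since measures of finite energy live on the interior. *)
Lemma riesz_energy_test (a b : R -> R) (J : R) :
  measurable_fun [set: R] a -> measurable_fun [set: R] b ->
  (forall t y, 0 <= t <= pi -> Om° y -> 0 <= a t + b t * dot y (dir t)) ->
  (forall y, Om° y -> (\int[leb]_(t in `[0%R, pi]) (a t + b t * dot y (dir t))%:E = J%:E)%E) ->
  ((2 * J)%:E - \int[leb2]_(l in lines Om°) ((a l.1 + b l.1 * l.2) ^+ 2)%:E <= riesz_energy Om)%E.
Proof.
move=> ma mb ab0 abJ; rewrite riesz_energyE; apply: le_ereal_inf_tmp => _ [mu mu1 <-].
have [->|Ei] := eqVneq (energy mu) +oo%E; first exact: leey.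
have Efin : (energy mu < +oo)%E by rewrite ltey.
have := energy_test (open_interior _) (finite_energy_interior mu1 Efin) ma mb ab0 abJ.
set I := (\int[_]_(_ in _) _)%E.
have I0 : (0 <= I)%E by apply: integral_ge0 => l _; rewrite lee_fin sqr_ge0.
have [->|In] := eqVneq I +oo%E; first by rewrite addeNy leNye.
by rewrite leeBlDr// ge0_fin_numE// ltey.
Qed.

Lemma leb2_lines_lty : (leb2 (lines Om°) < +oo)%E.
Proof.
have := @lines_le_hausdorff R Om set0 1 cOm measurable0 ltr01.
by rewrite measure0 adde0 => h; apply: le_lt_trans (h _) Hfin.
Qed.

Lemma leb2_lines_gt0 : Om° !=set0 -> (0 < leb2 (lines Om°))%E.
Proof.
move=> [x xO]; have /nbhs_euclP[r r0 hr] : nbhs x Om° by apply: open_nbhs_nbhs; split => //; exact: open_interior.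
have r2 : 0 < r / 2 by rewrite divr_gt0.
have sub : strip (r / 2) x `<=` lines Om°.
  apply: strip_sub_lines => y xy; apply: hr; rewrite (lt_trans xy)//; lra.
apply: (@lt_le_trans _ _ (leb2 (strip (r / 2) x))); last first.
  apply: le_measure; rewrite ?inE//; [exact: measurable_strip|].
  by apply: measurable_lines; exact: open_interior.
by rewrite -[X in leb2 X]setIid leb2_stripI_diag// lte_fin mulr_gt0 ?pi_gt0// mulr_gt0.
Qed.

(** The constant [pi / W] is the best constant test: it makes [2 J] minus the
    energy of the test, [2 pi k - k^2 W] for a constant [k], maximal. *)
Lemma riesz_energy_ge_lines : Om° !=set0 ->
  ((pi ^+ 2 / fine (leb2 (lines Om°)))%:E <= riesz_energy Om)%E.
Proof.
move=> O0; set W := fine _.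
have Wfn : leb2 (lines Om°) \is a fin_num by rewrite ge0_fin_numE ?measure_ge0 ?leb2_lines_lty.
have W0 : 0 < W by rewrite fine_gt0// leb2_lines_gt0// leb2_lines_lty.
have pi0 := @pi_gt0 R.
have := @riesz_energy_test (fun=> pi / W) (fun=> 0) (pi / W * pi) _ _ _ _.
move=> h; apply: le_trans (h _ _ _ _) => //.
- rewrite (eq_integral (cst ((pi / W) ^+ 2)%:E)); last by move=> l _; rewrite /= mul0r addr0.
  rewrite integral_cst; last by apply: measurable_lines; exact: open_interior.
  rewrite [X in (_ - _ * X)%E](_ : _ = W%:E); last by rewrite /W fineK.
  rewrite -EFinM -EFinB lee_fin le_eqVlt; apply/orP; left; apply/eqP.
  by field; rewrite gt_eqF.
- by move=> t y _ _; rewrite mul0r addr0 divr_ge0 ?pi_ge0// ltW.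
- move=> y _; rewrite (eq_integral (cst (pi / W)%:E)); last by move=> l _; rewrite /= mul0r addr0.
  have lpi : leb `[0%R, pi]%classic = (pi : R)%:E.
    by rewrite leb_itv/= lte_fin pi0 oppr0 adde0.
  by rewrite integral_cst ?[X in (_ * X)%E]lpi.
Qed.

End Compact.

Lemma admissible_interior Om : admissible Om -> Om° !=set0.
Proof.
move=> [cOm aOm HOm]; apply/set0P/eqP => O0; move: aOm.
rewrite areaE; last exact: compact_plane_measurable.
rewrite leb2_hausdorff_null ?ltxx//.
by move: HOm; rewrite boundary_closed ?O0 ?setD0//; exact: compact_plane_closed.
Qed.

End LowerBound.

(** * Convexity of optimal sets *)

Section Rigidity.
Context {R : realType}.
Implicit Types (t p s h : R) (x y z l v : R * R).

Lemma leb2_open_lines_gt0 (N : set (R * R)) l : open N -> N l -> 0 <= l.1 <= pi ->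
  (0 < leb2 (N `&` [set l : R * R | (0 <= l.1 <= pi)%R]))%E.
Proof.
move=> oN Nl /andP[t0 tp]; have pi0 := @pi_gt0 R.
have /nbhs_euclP[r r0 hr] : nbhs l N by exact: open_nbhs_nbhs.
pose e : R := Num.min (r / 2) (pi / 2).
have e0 : 0 < e by rewrite lt_min !divr_gt0.
have er : e <= r / 2 by rewrite ge_min lexx.
have ep : e <= pi / 2 by rewrite ge_min lexx orbT.
(* The angles of a neighbourhood of [l] have to stay in [[0, pi]], even when
   [l.1] is an end point. *)
have [a [aP1 aP2 aP3 aP4]] : exists a : R, [/\ 0 <= a, a + e <= pi, l.1 - e <= a & a <= l.1].
  have [h|h] := leP l.1 (pi / 2); [exists l.1|exists (l.1 - e)]; split; lra.
pose B : set (R * R) := `]a, a + e[%classic `*` `]l.2, l.2 + e[%classic.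
have mB : measurable B by apply: measurableX; exact: measurable_itv.
have mN : measurable (N `&` [set l | 0 <= l.1 <= pi]).
  by apply: measurableI; [exact: open_measurable_plane|exact: measurable_angles].
apply: (@lt_le_trans _ _ (leb2 B)).
  have -> : leb2 B = (leb `]a, (a + e)%R[%classic * leb `]l.2, (l.2 + e)%R[%classic)%E.
    by apply: product_measure1E; exact: measurable_itv.
  have a1 : a < a + e by lra.
  have l1 : l.2 < l.2 + e by lra.
  rewrite !leb_itv/= !lte_fin a1 l1 -!EFinB -EFinM lte_fin mulr_gt0//; lra.
apply: le_measure; rewrite ?inE// => z [] /=; rewrite !in_itv/= => /andP[z1 z2] /andP[z3 z4].
split; last by rewrite /=; apply/andP; split; lra.
apply: hr; rewrite eucl_distE (le_lt_trans (norm2_le_sum _))//=.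
have h1 : `|l.1 - z.1| < e by rewrite ltr_norml; apply/andP; split; lra.
have h2 : `|l.2 - z.2| < e by rewrite ltr_norml; apply/andP; split; lra.
lra.
Qed.

Lemma continuous_dot_rot90_dir v : continuous (fun l : R * R => dot v (rot90 (dir l.1))).
Proof.
move=> l.
have c1 : (fun l : R * R => cos l.1) @ l --> cos l.1.
  by apply: continuous_cvg; [exact: continuous_cos|exact: cvg_fst].
have s1 : (fun l : R * R => - sin l.1) @ l --> - sin l.1.
  by apply: cvgN; apply: continuous_cvg; [exact: continuous_sin|exact: cvg_fst].
by apply: cvgD; apply: cvgM => //; exact: cvg_cst.
Qed.

Lemma rot90K v : rot90 (rot90 v) = - v.
Proof. by case: v. Qed.

Lemma rot90Z (a : R) v : rot90 (a *: v) = a *: rot90 v.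
Proof. by rewrite /rot90/=; congr pair; rewrite /= /GRing.scale/= mulrN. Qed.

Variable Om : set (R * R).
Hypotheses (cOm : compact Om) (Hfin : (hausdorff1 (boundary Om) < +oo)%E).
Hypothesis HW : (hausdorff1 (boundary Om) <= leb2 (lines Om°))%E.

Let clOm : closed Om := compact_plane_closed cOm.

(** If a point [z] of the segment were missing, all lines close to the one
    through [x] and [y] would pass well inside [Om] near [x] and [y] and well
    outside near [z]. These lines have positive measure, which contradicts the
    equality between the perimeter and the measure of the lines that meet the
    interior. *)
Lemma optimal_segment_dir x t (k s : R) : Om° x -> Om° (x + k *: rot90 (dir t)) ->
  0 <= t <= pi -> 0 < k -> 0 <= s <= 1 -> Om (x + (s * k) *: rot90 (dir t)).
Proof.
move=> Ux Uy tpi k0 /andP[s0 s1]; set y := x + k *: _ in Uy; set z := x + _.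
apply: contrapT => nz.
have Ox : Om x by exact: interior_subset.
have Oy : Om y by exact: interior_subset.
have {}s0 : 0 < s.
  by rewrite lt_neqAle s0 andbT; apply/eqP => s0'; apply: nz; rewrite /z -s0' mul0r scale0r addr0.
have {}s1 : s < 1.
  by rewrite lt_neqAle s1 andbT; apply/eqP => s1'; apply: nz; rewrite /z s1' mul1r.
have /nbhs_euclP[rx rx0 hx] : nbhs x Om by exact: Ux.
have /nbhs_euclP[ry ry0 hy] : nbhs y Om by exact: Uy.
have /nbhs_euclP[rz rz0 hz] : nbhs z (~` Om).
  by apply: open_nbhs_nbhs; split => //; exact: closed_openC.
pose r : R := Num.min (rx / 2) (Num.min (ry / 2) (rz / 2)).
have r0 : 0 < r by rewrite !lt_min !divr_gt0.
have rrx : r <= rx / 2 by rewrite ge_min lexx.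
have rry : r <= ry / 2 by rewrite !ge_min lexx orbT.
have rrz : r <= rz / 2 by rewrite !ge_min lexx !orbT.
pose v := rot90 (dir t).
(* The last condition in [N] fixes the orientation, so that [x], [z], [y] come
   in this order along nearby lines. *)
pose near w : set (R * R) := [set l | `|dot w (dir l.1) - l.2| < r].
pose N := near x `&` near y `&` near z `&` [set l | 0 < dot v (rot90 (dir l.1))].
pose O := N `&` [set l | 0 <= l.1 <= pi].
have oN : open N.
  apply: openI; [apply: openI; [apply: openI|]|]; try exact: open_near_line.
  by apply: (@open_comp _ _ (fun l : R * R => dot v (rot90 (dir l.1))) [set u : R | 0 < u]);
    [move=> l _; exact: continuous_dot_rot90_dir|exact: open_gt].
have vn : dot v (dir t) = 0 by rewrite /v /dot/= mulNr mulrC addNr.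
have vv : dot v v = 1.
  by rewrite /v /dot/= mulrNN -!expr2 addrC cos2Dsin2.
have Nl : N (t, dot x (dir t)).
  have d0 w : dot (x + w *: v) (dir t) = dot x (dir t) by rewrite dotDl dotZl vn mulr0 addr0.
  split; last by rewrite /= -/v vv.
  split; last by rewrite /near/= /z d0 subrr normr0.
  by split; rewrite /near/= ?/y ?d0 subrr normr0.
have O0 := leb2_open_lines_gt0 oN Nl tpi.
have mO : measurable O.
  by apply: measurableI; [exact: open_measurable_plane|exact: measurable_angles].
have Oprop l : O l -> 0 <= l.1 <= pi /\ exists t1 t2 t3, [/\ t1 < t2 < t3,
     forall w, eucl_dist (frame (dir l.1) (l.2, t1)) w < r -> Om w,
     forall w, eucl_dist (frame (dir l.1) (l.2, t2)) w < r -> ~ Om w &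
     forall w, eucl_dist (frame (dir l.1) (l.2, t3)) w < r -> Om w].
  move=> [[[[nx ny] nzl] pos] lpi]; split => //.
  pose m := rot90 (dir l.1); exists (dot x m), (dot z m), (dot y m).
  have nearw w w' : near w l -> eucl_dist (frame (dir l.1) (l.2, dot w m)) w' < r ->
      eucl_dist w w' < 2 * r.
    move=> nw ww'; apply: (le_lt_trans (eucl_dist_triangle (frame (dir l.1) (l.2, dot w m)) _ _)).
    have : eucl_dist w (frame (dir l.1) (l.2, dot w m)) < r.
      rewrite eucl_distE {1}(frame_dot w (norm2_dir l.1)) frameB norm2_frame ?norm2_dir//.
      by rewrite (le_lt_trans (norm2_le_sum _))//= subrr normr0 addr0.
    lra.
  split.
  - have zE : dot z m = dot x m + s * k * dot v m by rewrite /z dotDl dotZl.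
    have yE : dot y m = dot x m + k * dot v m by rewrite /y dotDl dotZl.
    have p1 : 0 < k * dot v m by rewrite mulr_gt0.
    by rewrite zE yE -mulrA; apply/andP; split; nra.
  - by move=> w /(nearw _ _ nx) h; apply: hx; apply: lt_le_trans h _; lra.
  - by move=> w /(nearw _ _ nzl) h; apply: hz; apply: lt_le_trans h _; lra.
  - by move=> w /(nearw _ _ ny) h; apply: hy; apply: lt_le_trans h _; lra.
have := lines_le_hausdorff cOm mO r0 Oprop => h.
have := le_trans h HW; apply/negP; rewrite -ltNge lteDl//.
by rewrite ge0_fin_numE ?measure_ge0//; exact: leb2_lines_lty.
Qed.

Lemma optimal_segment x y s : Om° x -> Om° y -> 0 <= s <= 1 -> Om (x + s *: (y - x)).
Proof.
move=> Ux Uy s01; have [t [r [tpi rE E]]] := polar (rot90 (y - x)).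
have yx : y - x = - r *: rot90 (dir t).
  have -> : y - x = - rot90 (rot90 (y - x)) by rewrite rot90K opprK.
  by rewrite E rot90Z scaleNr.
have yE : y = x + (- r) *: rot90 (dir t) by rewrite -yx addrC subrK.
have xE : x = y + r *: rot90 (dir t) by rewrite yE -addrA -scalerDl addNr scale0r addr0.
have [r0|r0|r0] := ltgtP r 0.
- rewrite yx scalerA; apply: optimal_segment_dir => //; first by rewrite -yE.
  by rewrite oppr_gt0.
- have -> : x + s *: (y - x) = y + ((1 - s) * r) *: rot90 (dir t).
    rewrite yx xE scalerA -addrA -scalerDl; congr (_ + _ *: _); ring.
  apply: optimal_segment_dir => //; first by rewrite -xE.
  by case/andP: s01 => ? ?; apply/andP; split; lra.
- by rewrite yx r0 oppr0 scale0r scaler0 addr0; exact: interior_subset.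
Qed.

(** Translating a segment with ends in the interior by a small vector keeps
    its ends in the interior. *)
Lemma optimal_convex x y s : Om° x -> Om° y -> 0 <= s <= 1 -> Om° (x + s *: (y - x)).
Proof.
move=> Ux Uy s01.
have /nbhs_euclP[rx rx0 hx] : nbhs x Om° by apply: open_nbhs_nbhs; split => //; exact: open_interior.
have /nbhs_euclP[ry ry0 hy] : nbhs y Om° by apply: open_nbhs_nbhs; split => //; exact: open_interior.
apply/nbhs_euclP; exists (Num.min rx ry); first by rewrite lt_min rx0.
move=> w; rewrite eucl_distE lt_min => /andP[w1 w2].
pose d := w - (x + s *: (y - x)).
have -> : w = (x + d) + s *: ((y + d) - (x + d)).
  by rewrite opprD addrACA subrr addr0 -addrA (addrC d) addrA /d addrC subrK.
apply: optimal_segment => //.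
- by apply: hx; rewrite eucl_distE opprD addrA subrr sub0r norm2N -norm2N opprB.
- by apply: hy; rewrite eucl_distE opprD addrA subrr sub0r norm2N -norm2N opprB.
Qed.

End Rigidity.

(** * Support functions of a bounded convex open set *)

Section AngularIntegral.
Context {R : realType}.
Implicit Types (f g : R -> R) (a b c t : R).

Lemma lipschitz_continuous f (K : R) : (forall s t, f s <= f t + K * `|s - t|) -> continuous f.
Proof.
move=> fK t; have K0 : 0 <= K.
  by have := fK 1 0; have := fK 0 1; rewrite subr0 sub0r normrN normr1; lra.
have K1 : 0 < K + 1 by lra.
apply/cvgrPdist_le => e e0; near=> s.
have st : `|t - s| <= e / (K + 1).
  by near: s; apply: cvgr_dist_le => //; exact: divr_gt0.
have Ks : K * `|t - s| <= e.
  apply: (le_trans (ler_wpM2l K0 st)); rewrite mulrA ler_pdivrMr// mulrC ler_wpM2l ?(ltW e0)//.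
  by rewrite lerDl.
have := fK t s; have := fK s t; rewrite (distrC s) => h1 h2.
by rewrite ler_norml; apply/andP; split; lra.
Unshelve. all: end_near. Qed.

Lemma continuous_leb_integrable a b f : continuous f ->
  leb.-integrable `[a, b] (EFin \o f).
Proof.
move=> cf; have := @continuous_compact_integrable R f `[a, b] (@segment_compact _ a b)
  (continuous_subspaceT cf).
move=> /integrableP[_ fi]; apply/integrableP; split.
  by apply/measurable_EFinP; apply: measurable_funTS; exact: continuous_measurable_fun.
rewrite ge0_integral_leb//.
apply: measurable_funTS; apply: measurableT_comp => //; apply/measurable_EFinP.
exact: continuous_measurable_fun.
Qed.

Lemma ge0_integral_oo_cc a b (f : R -> \bar R) : measurable_fun [set: R] f ->
  (forall t, 0 <= f t)%E ->
  (\int[leb]_(t in `]a, b[) f t = \int[leb]_(t in `[a, b]) f t)%E.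
Proof.
move=> mf f0; rewrite !ge0_integral_leb//; do ?exact: measurable_funTS.
by rewrite integral_itv_bndoo//; exact: measurable_funTS.
Qed.

Definition angular f : R := \int[leb]_(t in `[0, pi]) f t.

Lemma angularE f : continuous f ->
  (\int[leb]_(t in `[0%R, pi]) (f t)%:E = (angular f)%:E)%E.
Proof.
move=> cf; rewrite /angular /Rintegral fineK//; apply: integrable_fin_num => //.
exact: continuous_leb_integrable.
Qed.

Lemma angularD f g : continuous f -> continuous g ->
  angular (fun t => f t + g t) = angular f + angular g.
Proof. by move=> cf cg; apply: RintegralD => //; exact: continuous_leb_integrable. Qed.

Lemma angularZ c f : continuous f -> angular (fun t => c * f t) = c * angular f.
Proof. by move=> cf; apply: RintegralZl => //; exact: continuous_leb_integrable. Qed.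

Lemma angular_FTC (F f : R -> R) : continuous f -> (forall x : R, is_derive x 1 F (f x)) ->
  angular f = F pi - F 0.
Proof.
move=> cf dF; apply: EFin_inj; rewrite -angularE//.
exact: integral_FTC (@pi_ge0 R) cf dF.
Qed.

Lemma eq_angular f g : (forall t, 0 <= t <= pi -> f t = g t) -> angular f = angular g.
Proof. by move=> fg; apply: eq_Rintegral => t; rewrite inE/= in_itv/=; exact: fg. Qed.

Lemma angular_cst c : angular (fun=> c) = c * pi.
Proof.
have dF (t : R) : is_derive t 1 (fun t => c * t) c.
  by apply: trigger_derive; rewrite /GRing.scale/=; ring.
by rewrite (angular_FTC (fun t => cvg_cst c) dF) mulr0 subr0.
Qed.

Let cs := @continuous_sin R.
Let cc := @continuous_cos R.

Lemma continuous_mul f g : continuous f -> continuous g -> continuous (fun t => f t * g t).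
Proof. by move=> cf cg t; apply: cvgM; [exact: cf|exact: cg]. Qed.

Lemma continuous_add f g : continuous f -> continuous g -> continuous (fun t => f t + g t).
Proof. by move=> cf cg t; apply: cvgD; [exact: cf|exact: cg]. Qed.

Lemma continuous_opp f : continuous f -> continuous (fun t => - f t).
Proof. by move=> cf t; apply: cvgN; exact: cf. Qed.

Lemma angular_cos2 : angular (fun t => cos t * cos t) = pi / 2.
Proof.
have dF (t : R) : is_derive t 1 (fun t => (t + sin t * cos t) / 2) (cos t * cos t).
  apply: trigger_derive; rewrite /GRing.scale/=; rewrite !mulr0 add0r.
  by move: (cos2Dsin2 t); rewrite !expr2; lra.
have cf : continuous (fun t : R => cos t * cos t) by exact: continuous_mul.
by rewrite (angular_FTC cf dF) sinpi sin0 !mul0r !addr0 mul0r subr0.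
Qed.

Lemma angular_sin2 : angular (fun t => sin t * sin t) = pi / 2.
Proof.
have dF (t : R) : is_derive t 1 (fun t => (t - sin t * cos t) / 2) (sin t * sin t).
  apply: trigger_derive; rewrite /GRing.scale/=; rewrite !mulr0 add0r.
  by move: (cos2Dsin2 t); rewrite !expr2; lra.
have cf : continuous (fun t : R => sin t * sin t) by exact: continuous_mul.
by rewrite (angular_FTC cf dF) sinpi sin0 !mul0r !subr0 mul0r subr0.
Qed.

Lemma angular_sincos : angular (fun t => sin t * cos t) = 0.
Proof.
have dF (t : R) : is_derive t 1 (fun t => sin t ^+ 2 / 2) (sin t * cos t).
  apply: trigger_derive; rewrite /GRing.scale/=; by field.
have cf : continuous (fun t : R => sin t * cos t) by exact: continuous_mul.
by rewrite (angular_FTC cf dF) sinpi sin0 expr0n/= mul0r subr0.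
Qed.

Lemma angular_eq0 f : continuous f -> (forall t, 0 <= t <= pi -> 0 <= f t) ->
  angular f <= 0 -> forall t, 0 <= t <= pi -> f t = 0.
Proof.
move=> cf f0 If t /andP[t0 tp]; apply/eqP; rewrite eq_le f0 ?t0// andbT leNgt; apply/negP => ft.
have pi0 := @pi_gt0 R.
have : \forall s \near t, f t / 2 < f s.
  have := cf t; move/cvgr_gt; apply; lra.
move=> /nbhs_ballP[d /= d0 hd].
pose e : R := Num.min (d / 2) (pi / 2).
have e0 : 0 < e by rewrite lt_min !divr_gt0.
have er : e <= d / 2 by rewrite ge_min lexx.
have ep : e <= pi / 2 by rewrite ge_min lexx orbT.
have [a [aP1 aP2 aP3 aP4]] : exists a : R, [/\ 0 <= a, a + e <= pi, t - e <= a & a <= t].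
  have [h|h] := leP t (pi / 2); [exists t|exists (t - e)]; split; lra.
move: If; rewrite -lee_fin -angularE//; apply/negP; rewrite -ltNge.
apply: (@lt_le_trans _ _ (\int[leb]_(s in `[a, (a + e)%R]) (cst (f t / 2)%:E) s)%E).
  have le : leb `[a, (a + e)%R]%classic = e%:E.
    by rewrite leb_itv/= lte_fin ltrDl e0 -EFinB; congr EFin; ring.
  by rewrite integral_cst// [X in (_ * X)%E]le -EFinM lte_fin mulr_gt0// divr_gt0.
apply: (@le_trans _ _ (\int[leb]_(s in `[a, (a + e)%R]) (f s)%:E)%E).
  have sub s : `[a, a + e]%classic s -> 0 <= s <= pi /\ `|t - s| < d.
    rewrite /= in_itv/= => /andP[s1 s2]; split; first by apply/andP; split; lra.
    by rewrite ltr_norml; apply/andP; split; lra.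
  apply: ge0_le_integral => //.
  - by move=> s _; rewrite lee_fin divr_ge0// ltW.
  - by apply/measurable_EFinP/measurable_funTS; exact: continuous_measurable_fun.
  - by move=> s /sub[_ /hd]; rewrite lee_fin => /ltW.
apply: ge0_subset_integral => //.
- by apply/measurable_EFinP/measurable_funTS; exact: continuous_measurable_fun.
- by move=> s; rewrite /= !in_itv/= => /andP[s1 s2]; apply/andP; split; lra.
Qed.

End AngularIntegral.

Section SupportFunctions.
Context {R : realType}.
Implicit Types (t p s : R) (x y z l v : R * R).
Variables (U : set (R * R)) (M : R).
Hypotheses (oU : open U) (U0 : U !=set0) (hM : forall x, U x -> norm2 x <= M).
Hypothesis cU : forall x y s, U x -> U y -> 0 <= s <= 1 -> U (x + s *: (y - x)).

Definition shadow t : set R := [set dot x (dir t) | x in U].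
Definition upper t : R := sup (shadow t).
Definition lower t : R := inf (shadow t).

Lemma shadow_has_sup t : has_sup (shadow t).
Proof.
split; first by case: U0 => x Ux; exists (dot x (dir t)), x.
exists M => _ [x Ux <-]; rewrite (le_trans (ler_norm _))// (le_trans (normr_dot_dir _ _))//.
exact: hM.
Qed.

Lemma shadow_has_inf t : has_inf (shadow t).
Proof.
split; first by case: U0 => x Ux; exists (dot x (dir t)), x.
exists (- M) => _ [x Ux <-]; apply: lerNnormlW; rewrite (le_trans (normr_dot_dir _ _))//.
exact: hM.
Qed.

Lemma upper_ge t x : U x -> dot x (dir t) <= upper t.
Proof. by move=> Ux; apply: sup_ubound; [exact: (shadow_has_sup t).2|exists x]. Qed.

Lemma lower_le t x : U x -> lower t <= dot x (dir t).
Proof. by move=> Ux; apply: ge_inf; [exact: (shadow_has_inf t).2|exists x]. Qed.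

Lemma dot_dir_near x s t : U x -> `|dot x (dir s) - dot x (dir t)| <= M * `|s - t|.
Proof.
move=> Ux; rewrite dotC (dotC _ (dir t)) -dotBl (le_trans (normr_dot _ _))// mulrC.
by apply: ler_pM; rewrite ?norm2_ge0//; [exact: hM|exact: norm2_dirB].
Qed.

Lemma continuous_upper : continuous upper.
Proof.
apply: (@lipschitz_continuous _ _ M) => s t; apply: sup_le_ub.
  by case: (shadow_has_sup s).
move=> _ [x Ux <-]; have := dot_dir_near s t Ux; rewrite ler_norml => /andP[_].
by have := upper_ge t Ux; lra.
Qed.

Lemma continuous_lower : continuous lower.
Proof.
have cN : continuous (fun t => - lower t).
  apply: (@lipschitz_continuous _ _ M) => s t.
  suff : lower t - M * `|s - t| <= lower s by lra.
  apply: lb_le_inf; first by case: (shadow_has_inf s).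
  move=> _ [x Ux <-]; have := dot_dir_near s t Ux; rewrite ler_norml => /andP[+ _].
  by have := lower_le t Ux; lra.
have -> : lower = (fun t => - - lower t) by apply/funext => t; rewrite opprK.
exact: continuous_opp.
Qed.

(** The projection is an interval by convexity, and it is open because [U] is. *)
Lemma shadowE t : shadow t = `]lower t, upper t[%classic.
Proof.
apply/seteqP; split => [_ [x Ux <-]|p]; rewrite /= in_itv/=.
  have /nbhs_euclP[r r0 hr] : nbhs x U by exact: open_nbhs_nbhs.
  have step s : `|s| < r -> U (x + s *: dir t).
    move=> sr; apply: hr; rewrite eucl_distC eucl_distE addrC addKr norm2Z norm2_dir mulr1.
    exact: sr.
  have dd s : dot (x + s *: dir t) (dir t) = dot x (dir t) + s.
    by rewrite dotDl dotZl /(dot (dir t))/= -!expr2 cos2Dsin2 mulr1.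
  have r2 : `|r / 2| < r by rewrite gtr0_norm ?divr_gt0//; lra.
  have r2' : `|- (r / 2)| < r by rewrite normrN.
  have := upper_ge t (step _ r2); have := lower_le t (step _ r2').
  by rewrite !dd => h1 h2; apply/andP; split; lra.
move=> /andP[lp pu].
have [_ [x Ux <-] xp] := inf_lt (shadow_has_inf t).1 lp.
have [_ [y Uy <-] py] := sup_gt (shadow_has_sup t).1 pu.
set a := dot x _ in xp; set b := dot y _ in py.
have ab : 0 < b - a by lra.
exists (x + ((p - a) / (b - a)) *: (y - x)).
  apply: cU => //; rewrite divr_ge0 ?(ltW ab)//=; last lra.
  by rewrite ler_pdivrMr// mul1r; lra.
rewrite dotDl dotZl dotBl -/a -/b divfK ?gt_eqF//; lra.
Qed.

Lemma lower_lt_upper t : lower t < upper t.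
Proof.
case: U0 => x Ux; have : shadow t (dot x (dir t)) by exists x.
by rewrite shadowE/= in_itv/= => /andP[]; exact: lt_trans.
Qed.

Lemma integral_lines (F : R * R -> \bar R) : measurable_fun [set: R * R] F ->
  (forall l, 0 <= F l)%E ->
  (\int[leb2]_(l in lines U) F l =
   \int[leb]_(t in `[0%R, pi]) \int[leb]_(p in `[(lower t), (upper t)]) F (t, p))%E.
Proof.
move=> mF F0; have mL := measurable_lines oU.
rewrite integral_mkcond ge0_integral_leb2; last 2 first.
- by apply/(measurable_restrictT _ mL); exact: measurable_funTS.
- by move=> l; rewrite patchE; case: ifP.
rewrite [RHS]integral_mkcond; apply: eq_integral => t _; rewrite patchE.
have mFt : measurable_fun [set: R] (fun p => F (t, p)).
  by apply: measurableT_comp => //; apply: measurable_fun_pair => //; exact: measurable_cst.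
case: ifPn => tpi; last first.
  apply: integral0_eq => p _; rewrite patchE; case: ifPn => //; rewrite inE => -[/= tpi' _].
  by move: tpi; rewrite notin_setE/= in_itv/= tpi'.
have {}tpi : 0 <= t <= pi by move: tpi; rewrite inE/= in_itv.
rewrite -ge0_integral_oo_cc// [RHS]integral_mkcond; apply: eq_integral => p _; rewrite !patchE.
have -> // : ((t, p) \in lines U) = (p \in `]lower t, upper t[%classic).
rewrite -shadowE; apply/idP/idP; rewrite !inE.
  by move=> [_ [x Ux xp]]; exists x.
by move=> [x Ux xp]; split => //; exists x.
Qed.

End SupportFunctions.

(** * Optimal sets are discs *)

Lemma integral_leb_cst (R : realType) (a b c : R) : a <= b ->
  (\int[leb]_(t in `[a, b]) c%:E = (c * (b - a))%:E)%E.
Proof.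
move=> ab; have le : leb `[a, b]%classic = (b - a)%:E.
  rewrite leb_itv/= lte_fin -EFinB; case: ltP => // ba; congr EFin.
  by have /eqP -> : a == b; [rewrite eq_le ab|rewrite subrr].
by rewrite integral_cst// [X in (_ * X)%E]le EFinM.
Qed.

Section OptimalDisc.
Context {R : realType}.
Implicit Types (t p s h : R) (x y z l : R * R).
Variable Om : set (R * R).
Hypotheses (cOm : compact Om) (Hfin : (hausdorff1 (boundary Om) < +oo)%E).
Hypothesis O0 : Om° !=set0.
Hypothesis HW : (hausdorff1 (boundary Om) <= leb2 (lines Om°))%E.

Let U := Om°.
Let W := fine (leb2 (lines U)).
Hypothesis HE : (riesz_energy Om <= (pi ^+ 2 / W)%:E)%E.

Let oU : open U. Proof. exact: open_interior. Qed.
Let cU x y s : U x -> U y -> 0 <= s <= 1 -> U (x + s *: (y - x)).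
Proof. exact: optimal_convex. Qed.
Let clOm : closed Om := compact_plane_closed cOm.
Let pi0 : 0 < pi :> R := @pi_gt0 R.

Local Notation u := (upper U).
Local Notation lo := (lower U).
Let w t : R := u t - lo t.

Let bounded : exists2 M, 0 < M & forall x, U x -> norm2 x <= M.
Proof.
have [M M0 hM] := compact_plane_bounded cOm; exists M => // x Ux.
by rewrite ltW// hM//; exact: interior_subset.
Qed.

Let cu : continuous u.
Proof. by have [M M0 hM] := bounded; exact: (continuous_upper O0 hM). Qed.

Let cl : continuous lo.
Proof. by have [M M0 hM] := bounded; exact: (continuous_lower O0 hM). Qed.

Let lu t : lo t < u t.
Proof. by have [M M0 hM] := bounded; exact: (lower_lt_upper oU O0 hM cU). Qed.

Let U_itv t x : U x -> lo t < dot x (dir t) < u t.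
Proof.
move=> Ux; have [M M0 hM] := bounded.
have : shadow U t (dot x (dir t)) by exists x.
by rewrite (shadowE oU O0 hM cU)/= in_itv.
Qed.

Let cw : continuous w.
Proof. by apply: continuous_add => //; exact: continuous_opp. Qed.

Let w0 t : 0 < w t. Proof. by rewrite subr_gt0. Qed.

Let WE : W = angular w.
Proof.
have [M M0 hM] := bounded; apply: EFin_inj; rewrite -angularE// /W fineK; last first.
  by rewrite ge0_fin_numE ?measure_ge0//; exact: leb2_lines_lty.
transitivity (\int[leb2]_(l in lines U) 1%E)%E.
  by rewrite integral_cst ?mul1e//; exact: measurable_lines.
rewrite (integral_lines oU O0 hM cU)//; apply: eq_integral => t _.
by rewrite integral_leb_cst ?mul1r// ltW.
Qed.

Let W0 : 0 < W.
Proof. by rewrite fine_gt0// leb2_lines_gt0// leb2_lines_lty. Qed.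

(** The integral of [(a t + b t p)^2] over [p] between [lo t] and [u t]. *)
Definition affine_energy (a b : R -> R) t : R :=
  a t ^+ 2 * (u t - lo t) + a t * b t * (u t ^+ 2 - lo t ^+ 2) +
  b t ^+ 2 * (u t ^+ 3 - lo t ^+ 3) / 3.

Lemma integral_lines_affine (a b : R -> R) : continuous a -> continuous b ->
  (\int[leb2]_(l in lines U) ((a l.1 + b l.1 * l.2) ^+ 2)%:E =
   (angular (affine_energy a b))%:E)%E.
Proof.
move=> ca cb; have [M M0 hM] := bounded.
rewrite (integral_lines oU O0 hM cU); last 2 first.
- apply/measurable_EFinP; apply: measurable_funX; apply: measurable_funD.
    by apply: measurableT_comp => //; exact: continuous_measurable_fun.
  by apply: measurable_funM => //; apply: measurableT_comp => //; exact: continuous_measurable_fun.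
- by move=> l; rewrite lee_fin sqr_ge0.
rewrite -angularE; last first.
  have cX (f : R -> R) k : continuous f -> continuous (fun t => f t ^+ k).
    move=> cf; elim: k => [|k IH]; first by move=> t; exact: cvg_cst.
    have -> : (fun t => f t ^+ k.+1) = (fun t => f t * f t ^+ k).
      by apply/funext => t; rewrite exprS.
    exact: continuous_mul.
  rewrite /affine_energy; apply: continuous_add; [apply: continuous_add|].
  - by apply: continuous_mul; [exact: cX|exact: cw].
  - apply: continuous_mul; first exact: continuous_mul.
    by apply: continuous_add; [exact: cX|apply: continuous_opp; exact: cX].
  - apply: continuous_mul; last by move=> t; exact: cvg_cst.
    apply: continuous_mul; first exact: cX.
    by apply: continuous_add; [exact: cX|apply: continuous_opp; exact: cX].
apply: eq_integral => t _ /=; set a1 := a t; set b1 := b t.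
have dF (p : R) : is_derive p 1
    (fun p => a1 ^+ 2 * p + a1 * b1 * p ^+ 2 + b1 ^+ 2 / 3 * p ^+ 3) ((a1 + b1 * p) ^+ 2).
  by apply: trigger_derive; rewrite /GRing.scale/=; field.
have cF : continuous (fun p => (a1 + b1 * p) ^+ 2).
  move=> p; rewrite /continuous_at; under eq_fun do rewrite expr2; rewrite expr2.
  have h : (fun p : R => a1 + b1 * p) @ p --> a1 + b1 * p.
    by apply: cvgD; [exact: cvg_cst|apply: cvgM; [exact: cvg_cst|exact: cvg_id]].
  exact: cvgM.
rewrite (integral_FTC (ltW (lu t)) cF dF) /affine_energy -/a1 -/b1; congr EFin.
by field.
Qed.

Lemma optimal_test (a b : R -> R) (J : R) : continuous a -> continuous b ->
  (forall t y, 0 <= t <= pi -> U y -> 0 <= a t + b t * dot y (dir t)) ->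
  (forall y, U y -> angular (fun t => a t + b t * dot y (dir t)) = J) ->
  2 * J - angular (affine_energy a b) <= pi ^+ 2 / W.
Proof.
move=> ca cb ab0 abJ; rewrite -lee_fin; apply: le_trans HE.
rewrite EFinB -integral_lines_affine//; apply: riesz_energy_test => //.
- exact: continuous_measurable_fun.
- exact: continuous_measurable_fun.
move=> y Uy; rewrite -(abJ y Uy) -angularE//.
apply: continuous_add => //; apply: continuous_mul => //.
by apply: continuous_add; apply: continuous_mul => //;
  do ?[exact: continuous_cos|exact: continuous_sin|by move=> t; exact: cvg_cst].
Qed.

(** Equality in the Cauchy-Schwarz inequality between the width and its
    inverse: the shape has constant width. *)
Lemma optimal_width t : 0 <= t <= pi -> w t = W / pi.
Proof.
move=> tpi.
have ci : continuous (fun t => (w t)^-1).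
  by move=> s; apply: cvgV; [rewrite gt_eqF|exact: cw].
pose Q := angular (fun t => (w t)^-1).
have key : Q <= pi ^+ 2 / W.
  have aE : angular (affine_energy (fun t => (w t)^-1) (fun=> 0)) = Q.
    apply: eq_angular => s _; rewrite /affine_energy -/(w s) mulr0 expr0n/= !mul0r !addr0.
    by rewrite expr2 mulfVK// gt_eqF.
  have := @optimal_test (fun t => (w t)^-1) (fun=> 0) Q ci (fun t => cvg_cst _) _ _.
  rewrite aE => h; suff : 2 * Q - Q <= pi ^+ 2 / W by lra.
  apply: h.
    by move=> s y _ _; rewrite mul0r addr0 invr_ge0 ltW.
  by move=> y _; apply: eq_angular => s _; rewrite mul0r addr0.
pose c := pi / W.
have c0 : 0 < c by rewrite divr_gt0.
(* This function is [(1 - c w)^2 / w], and its integral is [Q - pi^2 / W]. *)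
pose f t := (w t)^-1 + ((- 2 * c) + c ^+ 2 * w t).
have fE s : f s = (1 - c * w s) ^+ 2 / w s by rewrite /f; field; rewrite gt_eqF.
have ccst (k : R) : continuous (fun _ : R => k) by move=> s; exact: cvg_cst.
have cf2 : continuous (fun t => c ^+ 2 * w t) by exact: continuous_mul.
have cf1 : continuous (fun t => (- 2 * c) + c ^+ 2 * w t) by exact: continuous_add.
have cf : continuous f by exact: continuous_add.
have If : angular f <= 0.
  rewrite /f angularD// angularD// angularZ// angular_cst -WE -/Q.
  have -> : c ^+ 2 * W = pi ^+ 2 / W by rewrite /c; field; rewrite gt_eqF.
  have -> : - 2 * c * pi = - 2 * (pi ^+ 2 / W) by rewrite /c; field; rewrite gt_eqF.
  lra.
have := angular_eq0 cf _ If tpi.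
rewrite fE => h; have /eqP : (1 - c * w t) ^+ 2 / w t = 0.
  by apply: h => s _; rewrite fE divr_ge0 ?sqr_ge0// ltW.
rewrite mulf_eq0 invr_eq0 (gt_eqF (w0 t)) orbF sqrf_eq0 subr_eq0 => /eqP cw1.
have -> : w t = c * w t / c by rewrite mulrC mulKf// gt_eqF.
by rewrite -cw1 /c div1r invf_div.
Qed.

Let r := W / (2 * pi).
Let r0 : 0 < r. Proof. by rewrite divr_gt0// mulr_gt0. Qed.
Let Wr : W = 2 * pi * r. Proof. by rewrite /r mulrC divfK// gt_eqF// mulr_gt0. Qed.

Let m t : R := (u t + lo t) / 2.
Let cm : continuous m.
Proof.
apply: continuous_mul; last by move=> t; exact: cvg_cst.
exact: continuous_add.
Qed.

Let half_width t : 0 <= t <= pi -> (u t - lo t) / 2 = r.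
Proof.
move=> /optimal_width; rewrite /w => ->; rewrite /r invfM.
by rewrite -!mulrA (mulrC 2^-1).
Qed.

Let uE t : 0 <= t <= pi -> u t = m t + r.
Proof. by move=> /half_width <-; rewrite /m; field. Qed.

Let loE t : 0 <= t <= pi -> lo t = m t - r.
Proof. by move=> /half_width <-; rewrite /m; field. Qed.

Let A : R * R := (2 / pi * angular (fun t => m t * cos t), 2 / pi * angular (fun t => m t * sin t)).
Let v t : R := dot A (dir t) - m t.
Let cA (y : R * R) : continuous (fun t => dot y (dir t)).
Proof.
by apply: continuous_add; apply: continuous_mul => //;
  do ?[exact: continuous_cos|exact: continuous_sin|by move=> t; exact: cvg_cst].
Qed.
Let cv : continuous v.
Proof. by apply: continuous_add => //; exact: continuous_opp. Qed.

Let ccos : continuous (@cos R) := @continuous_cos R.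
Let csin : continuous (@sin R) := @continuous_sin R.

Let v_cos : angular (fun t => v t * cos t) = 0.
Proof.
have -> : (fun t => v t * cos t) = (fun t => A.1 * (cos t * cos t) +
    (A.2 * (sin t * cos t) + -1 * (m t * cos t))).
  by apply/funext => t; rewrite /v /dot/=; ring.
have c1 : continuous (fun t : R => cos t * cos t) by exact: continuous_mul.
have c2 : continuous (fun t : R => sin t * cos t) by exact: continuous_mul.
have c3 : continuous (fun t => m t * cos t) by exact: continuous_mul.
have ccst (k : R) : continuous (fun _ : R => k) by move=> s; exact: cvg_cst.
have c4 (k : R) f : continuous f -> continuous (fun t : R => k * f t) by exact: continuous_mul.
rewrite angularD//; [|exact: c4|by apply: continuous_add; exact: c4].
rewrite angularD//; [|exact: c4|exact: c4].
rewrite !angularZ// angular_cos2 angular_sincos /A/=.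
move: (angular _) (angular _) pi pi0 => I1 I2 P P0; by field; rewrite gt_eqF.
Qed.

Let v_sin : angular (fun t => v t * sin t) = 0.
Proof.
have -> : (fun t => v t * sin t) = (fun t => A.1 * (sin t * cos t) +
    (A.2 * (sin t * sin t) + -1 * (m t * sin t))).
  by apply/funext => t; rewrite /v /dot/=; ring.
have c1 : continuous (fun t : R => sin t * sin t) by exact: continuous_mul.
have c2 : continuous (fun t : R => sin t * cos t) by exact: continuous_mul.
have c3 : continuous (fun t => m t * sin t) by exact: continuous_mul.
have ccst (k : R) : continuous (fun _ : R => k) by move=> s; exact: cvg_cst.
have c4 (k : R) f : continuous f -> continuous (fun t : R => k * f t) by exact: continuous_mul.
rewrite angularD//; [|exact: c4|by apply: continuous_add; exact: c4].
rewrite angularD//; [|exact: c4|exact: c4].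
rewrite !angularZ// angular_sin2 angular_sincos /A/=.
move: (angular _) (angular _) pi pi0 => I1 I2 P P0; by field; rewrite gt_eqF.
Qed.

Let v_bounded : exists2 K, 0 <= K & forall t, `|v t| <= K.
Proof.
have [M M0 hM] := bounded; exists (norm2 A + M); first by rewrite addr_ge0 ?norm2_ge0// ltW.
move=> t; rewrite (le_trans (ler_normB _ _))//; apply: lerD; first exact: normr_dot_dir.
have h1 : u t <= M.
  apply: sup_le_ub; first by case: (shadow_has_sup O0 hM t).
  move=> _ [x Ux <-]; rewrite (le_trans (ler_norm _))// (le_trans (normr_dot_dir _ _))//.
  exact: hM.
have h2 : - M <= lo t.
  apply: lb_le_inf; first by case: (shadow_has_inf O0 hM t).
  move=> _ [x Ux <-]; apply: lerNnormlW; rewrite (le_trans (normr_dot_dir _ _))//.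
  exact: hM.
have := lu t; rewrite /m ler_norml => h3; apply/andP; split; lra.
Qed.

(** Perturbing the constant density by the part of the midpoint function that
    is orthogonal to translations shows that this part vanishes. *)
Lemma optimal_midpoint t : 0 <= t <= pi -> m t = dot A (dir t).
Proof.
have [K K0 vK] := v_bounded.
pose S := angular (fun t => v t * v t).
have cvv : continuous (fun t => v t * v t) by exact: continuous_mul.
(* The size [q] of the perturbation has to be at most [1 / (K r)], for the test
   to be nonnegative, and small enough for its linear effect to beat the
   quadratic one. *)
pose q := (K * r + r ^+ 2 + 1)^-1.
have Kr : 0 <= K * r by rewrite mulr_ge0// ltW.
have r20 : 0 < r ^+ 2 by rewrite exprn_gt0.
have den0 : 0 < K * r + r ^+ 2 + 1 by lra.
have q0 : 0 < q by rewrite invr_gt0.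
have qK : q * (K * r) <= 1 by rewrite mulrC ler_pdivrMr//; lra.
have qr : q * r ^+ 2 <= 1 by rewrite mulrC ler_pdivrMr//; lra.
(* On the line [(t, p)] the test is [(1 + q v(t) (p - m(t))) / (2 r)]. *)
pose a t := (2 * r)^-1 * (1 + - (q * (v t * m t))).
pose b t := (2 * r)^-1 * (q * v t).
have ccst (k : R) : continuous (fun _ : R => k) by move=> s; exact: cvg_cst.
have c4 (k : R) f : continuous f -> continuous (fun t : R => k * f t) by exact: continuous_mul.
have ca : continuous a.
  apply: (c4 (2 * r)^-1); apply: continuous_add => //; apply: continuous_opp; apply: (c4 q).
  exact: continuous_mul.
have cb : continuous b by apply: (c4 (2 * r)^-1); exact: (c4 q).
have r2i : 0 <= (2 * r)^-1 by rewrite invr_ge0 mulr_ge0// ltW.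
have pos s y : 0 <= s <= pi -> U y -> 0 <= a s + b s * dot y (dir s).
  move=> sp Uy; have := U_itv s Uy; rewrite uE// loE// => /andP[h1 h2].
  have -> : a s + b s * dot y (dir s) = (2 * r)^-1 * (1 + q * (v s * (dot y (dir s) - m s))).
    by rewrite /a /b; ring.
  rewrite mulr_ge0// -lerBlDl sub0r; apply: lerNnormlW.
  rewrite normrM (gtr0_norm q0) normrM (le_trans _ qK)// ler_pM2l//.
  by apply: ler_pM => //; rewrite ler_norml; apply/andP; split; lra.
have JE y : U y -> angular (fun t => a t + b t * dot y (dir t)) = (2 * r)^-1 * (pi + q * S).
  move=> Uy.
  have -> : (fun t => a t + b t * dot y (dir t)) = (fun t => (2 * r)^-1 * (1 + q * (v t * v t +
      ((y - A).1 * (v t * cos t) + (y - A).2 * (v t * sin t))))).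
    by apply/funext => s; rewrite /a /b /v /dot/=; ring.
  have c1 : continuous (fun t => (y - A).1 * (v t * cos t)) by apply: c4; exact: continuous_mul.
  have c2 : continuous (fun t => (y - A).2 * (v t * sin t)) by apply: c4; exact: continuous_mul.
  have c3 : continuous (fun t => (y - A).1 * (v t * cos t) + (y - A).2 * (v t * sin t)).
    exact: continuous_add.
  have c5 : continuous (fun t => v t * v t + ((y - A).1 * (v t * cos t) + (y - A).2 * (v t * sin t))).
    exact: continuous_add.
  rewrite angularZ; last by apply: continuous_add => //; exact: c4.
  rewrite angularD//; last exact: c4.
  rewrite angular_cst mul1r angularZ// angularD// angularD// angularZ; last exact: continuous_mul.
  rewrite angularZ; last exact: continuous_mul.
  by rewrite v_cos v_sin !mulr0 !addr0.
have EE : angular (affine_energy a b) = pi / (2 * r) + q ^+ 2 * r / 6 * S.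
  rewrite (@eq_angular _ _ (fun t => (2 * r)^-1 + q ^+ 2 * r / 6 * (v t * v t))).
    rewrite angularD//; last exact: c4.
    by rewrite angular_cst angularZ// mulrC.
  move=> s sp; rewrite /affine_energy uE// loE// /a /b.
  by field; rewrite gt_eqF.
have := optimal_test ca cb pos JE; rewrite EE Wr => h.
have S0 : S <= 0.
  rewrite leNgt; apply/negP => S0; move: h; apply/negP; rewrite -ltNge.
  have -> : 2 * ((2 * r)^-1 * (pi + q * S)) - (pi / (2 * r) + q ^+ 2 * r / 6 * S) =
      pi ^+ 2 / (2 * pi * r) + q * S / (6 * r) * (6 - q * r ^+ 2).
    by move: pi pi0 => P P0; field; rewrite !gt_eqF.
  rewrite ltrDl mulr_gt0//; last by lra.
  by apply: divr_gt0; apply: mulr_gt0.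
move=> tpi; have := angular_eq0 cvv (fun s _ => sqr_ge0 (v s)) S0 tpi.
by move/eqP; rewrite mulf_eq0 orbb subr_eq0 => /eqP ->.
Qed.

Lemma optimal_sub_disc x : U x -> eucl_dist A x < r.
Proof.
move=> Ux; rewrite eucl_distC eucl_distE.
have [t [s [tpi <- E]]] := polar (x - A).
have dE : dot x (dir t) = m t + s.
  rewrite optimal_midpoint// -[x](subrK A) E dotDl dotZl addrC; congr (_ + _).
  by rewrite /dot/= -!expr2 cos2Dsin2 mulr1.
have := U_itv t Ux; rewrite dE uE// loE// => /andP[h1 h2].
by rewrite ltr_norml; apply/andP; split; lra.
Qed.

(** The squared distance from [x] to a point of the circle is at most
    [2 r^2 - 2 r p], where [p] is the coordinate of [x - A] in the direction
    of that point. *)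
Let near_pole t (k e : R) x : k ^+ 2 = 1 -> 0 < e -> U x ->
  r - e ^+ 2 / (2 * r) < k * dot (x - A) (dir t) -> norm2 (x - (A + (k * r) *: dir t)) < e.
Proof.
move=> k1 e0 Ux xe; have := optimal_sub_disc Ux; rewrite eucl_distC eucl_distE => xr.
have xr2 : norm2 (x - A) ^+ 2 < r ^+ 2 by rewrite ltr_sqr ?nnegrE ?norm2_ge0// ltW.
rewrite -ltr_sqr ?nnegrE ?norm2_ge0 ?(ltW e0)//.
have -> : norm2 (x - (A + (k * r) *: dir t)) ^+ 2 =
    norm2 (x - A) ^+ 2 - 2 * r * (k * dot (x - A) (dir t)) + k ^+ 2 * r ^+ 2 * (cos t ^+ 2 + sin t ^+ 2).
  by rewrite !sqr_norm2 /dot/= /GRing.scale/=; ring.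
rewrite k1 cos2Dsin2 mul1r mulr1.
have : 2 * r * (r - e ^+ 2 / (2 * r)) < 2 * r * (k * dot (x - A) (dir t)).
  by rewrite ltr_pM2l// mulr_gt0.
have -> : 2 * r * (r - e ^+ 2 / (2 * r)) = 2 * r ^+ 2 - e ^+ 2 by field; rewrite gt_eqF.
lra.
Qed.

(** Each point [z] of the disc lies on a diameter; near both ends of it there
    are points of the convex set [U], hence near [z] too, and [Om] is closed. *)
Lemma disc_sub_optimal : eucl_cball A r `<=` Om.
Proof.
move=> z zr; have [M M0 hM] := bounded.
apply: clOm => B /nbhs_euclP[e e0 hB].
have [t [k [tpi kE E]]] := polar (z - A).
have kr : `|k| <= r by rewrite kE -eucl_distE eucl_distC.
have e2 : 0 < e ^+ 2 / (2 * r) by apply: divr_gt0; [exact: exprn_gt0|exact: mulr_gt0].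
have mE := optimal_midpoint tpi.
have [x Ux xe] : exists2 x, U x & norm2 (x - (A + (1 * r) *: dir t)) < e.
  have ut : u t - e ^+ 2 / (2 * r) < u t by rewrite ltrBlDr ltrDl.
  have [_ [x Ux <-] h] := sup_gt (shadow_has_sup O0 hM t).1 ut.
  exists x => //; apply: near_pole => //; first by rewrite expr1n.
  by rewrite mul1r dotBl; move: h; rewrite uE// mE; lra.
have [y Uy ye] : exists2 y, U y & norm2 (y - (A + (-1 * r) *: dir t)) < e.
  have lt_ : lo t < lo t + e ^+ 2 / (2 * r) by rewrite ltrDl.
  have [_ [y Uy <-] h] := inf_lt (shadow_has_inf O0 hM t).1 lt_.
  exists y => //; apply: near_pole => //; first by rewrite sqrrN expr1n.
  by rewrite mulN1r dotBl; move: h; rewrite loE// mE; lra.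
move: kr; rewrite ler_norml => /andP[k1 k2].
pose s := (r - k) / (2 * r).
have s01 : 0 <= s <= 1.
  have r2 : 0 < 2 * r by exact: mulr_gt0.
  apply/andP; split; first by apply: divr_ge0; [lra|exact: ltW].
  by rewrite /s ler_pdivrMr// mul1r; lra.
exists (x + s *: (y - x)); split; first by apply: interior_subset; exact: cU.
apply: hB; rewrite eucl_distC eucl_distE.
have -> : x + s *: (y - x) - z = (1 - s) *: (x - (A + (1 * r) *: dir t)) + s *: (y - (A + (-1 * r) *: dir t)).
  have zE : z = A + ((1 - s) * r - s * r) *: dir t.
    rewrite -[LHS](subrK A) E addrC; congr (_ + _ *: _).
    by rewrite /s; field; rewrite gt_eqF.
  rewrite zE; congr pair; rewrite /= /GRing.scale/=; ring.
case/andP: s01 => s0 s1.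
rewrite (le_lt_trans (norm2D _ _))// !norm2Z !ger0_norm//; last by lra.
move: xe ye; set d1 := norm2 _; set d2 := norm2 _ => d1e d2e.
have me : Num.max d1 d2 < e by rewrite gt_max d1e.
have l1 : d1 <= Num.max d1 d2 by rewrite le_max lexx.
have l2 : d2 <= Num.max d1 d2 by rewrite le_max lexx orbT.
have s1' : 0 <= 1 - s by lra.
have := ler_wpM2l s1' l1; have := ler_wpM2l s0 l2; lra.
Qed.

Lemma optimal_disc : exists (c : R * R) (s : R), [/\ 0 < s,
  leb2 (lines Om°) = (2 * pi * s)%:E,
  forall x, Om° x -> eucl_dist c x < s & eucl_cball c s `<=` Om].
Proof.
exists A, r; split => //; first last.
- exact: disc_sub_optimal.
- exact: optimal_sub_disc.
by rewrite -Wr /W fineK// ge0_fin_numE ?measure_ge0// leb2_lines_lty.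
Qed.

End OptimalDisc.

(** * The functional on discs and its minimizers *)

Section Functional.
Context {R : realType}.
Implicit Types (r s lambda : R) (c x y z : R * R) (Om : set (R * R)).

Definition disc c r : set (R * R) := [set x | eucl_dist c x < r].
Definition circle c r : set (R * R) := [set x | eucl_dist c x = r].

Lemma open_disc c r : open (disc c r).
Proof.
apply/open_euclP => x; rewrite /disc/= => cx; exists (r - eucl_dist c x); first by rewrite subr_gt0.
by move=> y xy; rewrite (le_lt_trans (eucl_dist_triangle x _ _))// -ltrBrDl.
Qed.

Lemma closed_cball c r : closed (eucl_cball c r).
Proof.
rewrite -[eucl_cball c r]setCK; apply: open_closedC; apply/open_euclP => x.
rewrite /eucl_cball/= => /negP; rewrite -ltNge => cx.
exists (eucl_dist c x - r); first by rewrite subr_gt0.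
move=> y xy; apply/negP; rewrite -ltNge.
have := eucl_dist_triangle y c x; rewrite (eucl_distC y); lra.
Qed.

Lemma compact_cball c r : compact (eucl_cball c r).
Proof.
pose I a : set R := `[a - r, a + r]%classic.
apply: (@subclosed_compact _ _ (I c.1 `*` I c.2)).
- exact: closed_cball.
- by apply: compact_setX; exact: segment_compact.
move=> x; rewrite /eucl_cball/= eucl_distE => cx.
have := le_trans (norm_fst_le _) cx; have := le_trans (norm_snd_le _) cx.
rewrite /= !ler_norml => /andP[? ?] /andP[? ?].
by split; rewrite /I/= in_itv/=; apply/andP; split; lra.
Qed.

Lemma disc_sub_interior c r Om : disc c r `<=` Om -> disc c r `<=` Om°.
Proof. by move=> sub; rewrite -open_subsetE//; exact: open_disc. Qed.

Lemma leb2_cball_gt0 c r : 0 < r -> (0 < leb2 (eucl_cball c r))%E.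
Proof.
move=> r0; pose I a : set R := `[a, a + r / 2]%classic.
have lI a : leb (I a) = (r / 2)%:E.
  have r2 : a < a + r / 2 by rewrite ltrDl divr_gt0.
  by rewrite /I leb_itv/= lte_fin r2 -EFinB; congr EFin; ring.
apply: (@lt_le_trans _ _ (leb2 (I c.1 `*` I c.2))).
  have -> : leb2 (I c.1 `*` I c.2) = (leb (I c.1) * leb (I c.2))%E.
    by apply: product_measure1E; exact: measurable_itv.
  by rewrite !lI -EFinM lte_fin mulr_gt0// divr_gt0.
apply: le_measure; rewrite ?inE//.
- by apply: measurableX; exact: measurable_itv.
- by apply: closed_measurable_plane; exact: closed_cball.
move=> x [x1 x2]; move: x1 x2; rewrite /I/= !in_itv/= => /andP[? ?] /andP[? ?].
rewrite /eucl_cball/= eucl_distE (le_trans (norm2_le_sum _))//=.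
have h1 : `|c.1 - x.1| <= r / 2 by rewrite ler_norml; apply/andP; split; lra.
have h2 : `|c.2 - x.2| <= r / 2 by rewrite ler_norml; apply/andP; split; lra.
lra.
Qed.

Lemma boundary_sub_circle c r Om : closed Om -> disc c r `<=` Om ->
  boundary Om `<=` circle c r `|` (Om `\` eucl_cball c r).
Proof.
move=> clOm sub x; rewrite boundary_closed// => -[Ox nOx].
have [xr|xr] := leP (eucl_dist c x) r; last first.
  by right; split => //; apply/negP; rewrite -ltNge.
left; apply/eqP; rewrite eq_le xr leNgt; apply/negP => xr'.
by apply: nOx; apply: (disc_sub_interior sub).
Qed.

Lemma cball_boundary c r : boundary (eucl_cball c r) `<=` circle c r.
Proof.
move=> x bx; have sub : disc c r `<=` eucl_cball c r by move=> y /ltW.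
by have [//|[Ox nx]] := boundary_sub_circle (@closed_cball c r) sub bx; have [] := nx; case: bx => Cx _; exact: closed_cball Cx.
Qed.

Lemma hausdorff1_cball_boundary c r : 0 < r ->
  (hausdorff1 (boundary (eucl_cball c r)) <= (2 * pi * r)%:E)%E.
Proof.
move=> r0; apply: le_trans (hausdorff1_circle c r0).
by apply: le_hausdorff1; exact: cball_boundary.
Qed.

Lemma admissible_cball c r : 0 < r -> admissible (eucl_cball c r).
Proof.
move=> r0; split.
- exact: compact_cball.
- rewrite areaE; first exact: leb2_cball_gt0.
  by apply: closed_measurable_plane; exact: closed_cball.
- by rewrite (le_lt_trans (hausdorff1_cball_boundary c r0))// ltry.
Qed.

Lemma riesz_energy_le_disc c r Om : 0 < r -> compact Om -> disc c r `<=` Om ->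
  (riesz_energy Om <= (pi / (2 * r))%:E)%E.
Proof.
move=> r0 cOm sub; pose p := PosNum r0.
apply: le_trans (energy_disc_measure c p); rewrite riesz_energyE//.
apply: ereal_inf_lbound; exists (disc_measure c p) => //=.
apply/eqP; rewrite eq_le probability_le1/=; last exact: compact_plane_measurable.
rewrite -(disc_measure_disc c p); apply: le_measure; rewrite ?inE//.
  by apply: open_measurable_plane; exact: open_disc.
exact: compact_plane_measurable.
Qed.

(** Stated for sets that contain the disc, so as to apply to all sets
    equivalent to a closed ball. *)
Lemma functional_le_disc lambda c r Om : 0 < lambda -> 0 < r -> compact Om -> disc c r `<=` Om ->
  (hausdorff1 (boundary Om) <= (2 * pi * r)%:E)%E ->
  (functional lambda Om <= (2 * r / pi * (pi ^+ 2 - lambda))%:E)%E.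
Proof.
move=> l0 r0 cOm sub Hr; have pi0 := @pi_gt0 R.
have I0 : (0 <= riesz_energy Om)%E.
  rewrite riesz_energyE//; apply: le_ereal_inf_tmp => _ [mu _ <-]; exact: energy_ge0.
have Ile := riesz_energy_le_disc r0 cOm sub.
have k0 : 0 < pi / (2 * r) by rewrite divr_gt0// mulr_gt0.
have Iinv : ((2 * r / pi)%:E <= (riesz_energy Om)^-1)%E.
  have -> : ((2 * r / pi)%:E = ((pi / (2 * r))%:E)^-1)%E.
    by rewrite inver gt_eqF// invf_div.
  by rewrite lee_pV2// !inE// lee_fin ltW.
have -> : 2 * r / pi * (pi ^+ 2 - lambda) = 2 * pi * r - lambda * (2 * r / pi).
  by move: pi pi0 => P P0; field; rewrite gt_eqF.
rewrite /functional EFinB (EFinM lambda); apply: leeB => //.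
by apply: lee_wpmul2l => //; rewrite lee_fin ltW.
Qed.

Section Admissible.
Variable Om : set (R * R).
Hypothesis aOm : admissible Om.

Let cOm : compact Om. Proof. by case: aOm. Qed.
Let Hfin : (hausdorff1 (boundary Om) < +oo)%E. Proof. by case: aOm. Qed.
Let O0 : Om° !=set0 := admissible_interior aOm.
Let H : R := fine (hausdorff1 (boundary Om)).
Let W : R := fine (leb2 (lines Om°)).

Let HE : hausdorff1 (boundary Om) = H%:E.
Proof. by rewrite fineK// ge0_fin_numE// hausdorff1_ge0. Qed.

Let WE : leb2 (lines Om°) = W%:E.
Proof. by rewrite fineK// ge0_fin_numE ?measure_ge0// leb2_lines_lty. Qed.

Let W0 : 0 < W. Proof. by rewrite -lte_fin -WE leb2_lines_gt0. Qed.

Let WH : W <= H.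
Proof.
rewrite -lee_fin -WE -HE -[leLHS]adde0 -(measure0 leb2).
by apply: (lines_le_hausdorff (r0 := 1)) => //; exact: measurable0.
Qed.

Let H0 : 0 < H := lt_le_trans W0 WH.
Let pi0 : 0 < pi :> R := @pi_gt0 R.

Lemma hausdorff1_boundary_gt0 : (0 < hausdorff1 (boundary Om))%E.
Proof. by rewrite HE lte_fin. Qed.

Let Iinv_le : ((riesz_energy Om)^-1 <= (W / pi ^+ 2)%:E)%E.
Proof.
have k0 : 0 < pi ^+ 2 / W by rewrite divr_gt0// exprn_gt0.
have kI := riesz_energy_ge_lines cOm Hfin O0.
have -> : ((W / pi ^+ 2)%:E = ((pi ^+ 2 / W)%:E)^-1)%E by rewrite inver gt_eqF// invf_div.
rewrite lee_pV2// !inE; last by rewrite lee_fin ltW.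
by apply: le_trans kI; rewrite lee_fin ltW.
Qed.

Lemma functional_ge lambda : 0 < lambda ->
  (hausdorff1 (boundary Om) * (1 - lambda / pi ^+ 2)%:E <= functional lambda Om)%E.
Proof.
move=> l0; rewrite /functional HE -EFinM.
have -> : H * (1 - lambda / pi ^+ 2) = H - lambda * (H / pi ^+ 2) by ring.
rewrite EFinB (EFinM lambda); apply: leeB => //; apply: lee_wpmul2l; first by rewrite lee_fin ltW.
apply: le_trans Iinv_le _; rewrite lee_fin; apply: ler_wpM2r => //.
by rewrite invr_ge0; exact: exprn_ge0 (ltW pi0).
Qed.

(** At the critical parameter, vanishing of the functional forces equality in
    all the inequalities between perimeter, lines and energy. *)
Lemma critical_optimal : functional (lambda0U R) Om = 0%E ->
  exists (c : R * R) (r : R), [/\ 0 < r,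
  hausdorff1 (boundary Om) = (2 * pi * r)%:E, leb2 (lines Om°) = (2 * pi * r)%:E,
  forall x, Om° x -> eucl_dist c x < r & eucl_cball c r `<=` Om].
Proof.
have p2 : 0 < pi ^+ 2 :> R by rewrite exprn_gt0.
have I0 : (0 <= (riesz_energy Om)^-1)%E.
  rewrite inve_ge0; apply: le_trans (riesz_energy_ge_lines cOm Hfin O0).
  by rewrite lee_fin ltW// divr_gt0.
have If : (riesz_energy Om)^-1%E \is a fin_num.
  by rewrite ge0_fin_numE// (le_lt_trans Iinv_le)// ltry.
set J := fine (riesz_energy Om)^-1%E.
have JE : (riesz_energy Om)^-1%E = J%:E by rewrite fineK.
rewrite /functional /lambda0U HE JE -EFinM -EFinB => HJ0.
have HJ : H - pi ^+ 2 * J = 0 by apply: EFin_inj; rewrite HJ0.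
have JW : J <= W / pi ^+ 2 by rewrite -lee_fin -JE.
have HW : H <= W.
  by move: JW; rewrite ler_pdivlMr// mulrC => h; lra.
have HWE : H = W by apply/eqP; rewrite eq_le HW WH.
have Ile : (riesz_energy Om <= (pi ^+ 2 / W)%:E)%E.
  have -> : (pi ^+ 2 / W)%:E = ((W / pi ^+ 2)%:E)^-1%E.
    by rewrite inver gt_eqF ?divr_gt0// invf_div.
  have JWE : J = W / pi ^+ 2.
    have -> : W = pi ^+ 2 * J by rewrite -HWE; lra.
    by rewrite mulrC mulKf// gt_eqF.
  by rewrite -JWE -JE inveK.
have hw : (hausdorff1 (boundary Om) <= leb2 (lines Om°))%E by rewrite HE WE lee_fin.
have [c [r [r0 lE sub1 sub2]]] := optimal_disc cOm Hfin O0 hw Ile.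
by exists c, r; split => //; rewrite HWE -WE.
Qed.

(** The circle, at positive distance from each [A n], already has the length
    of the whole boundary, by the inequality between lines and perimeter
    applied to the disc; so each [A n] is null. *)
Lemma optimal_H1_equiv c r : 0 < r -> hausdorff1 (boundary Om) = (2 * pi * r)%:E ->
  leb2 (lines Om°) = (2 * pi * r)%:E -> (forall x, Om° x -> eucl_dist c x < r) ->
  eucl_cball c r `<=` Om -> H1_equiv Om (eucl_cball c r).
Proof.
move=> r0 Hr Wr Or rO; split; last by rewrite (_ : _ `\` _ = set0) ?hausdorff10// setD_eq0.
have clOm := compact_plane_closed cOm.
have circ : ((2 * pi * r)%:E <= hausdorff1 (circle c r))%E.
  rewrite -Wr; apply: le_trans (le_hausdorff1 (@cball_boundary c r)).
  apply: (@le_trans _ _ (leb2 (lines (eucl_cball c r)°))).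
    apply: le_measure; rewrite ?inE; do ?by apply: measurable_lines; exact: open_interior.
    move=> l [l1 [x Ox xl]]; split => //; exists x => //.
    have : Om° `<=` disc c r by move=> y /Or.
    move=> /(_ x Ox); apply: disc_sub_interior => y; exact: ltW.
  rewrite -[leLHS]adde0 -(measure0 leb2).
  by apply: (lines_le_hausdorff (r0 := 1)) => //; exact: compact_cball.
have bnd x : Om x -> r <= eucl_dist c x -> boundary Om x.
  move=> Ox rx; rewrite boundary_closed//; split => // /Or.
  by rewrite ltNge rx.
pose A n : set (R * R) := [set x | Om x /\ r + n.+1%:R^-1 <= eucl_dist c x].
have A0 n : hausdorff1 (A n) = 0%E.
  have n0 : 0 < n.+1%:R^-1 :> R by rewrite invr_gt0.
  have sep x y : A n x -> circle c r y -> n.+1%:R^-1 <= eucl_dist x y.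
    move=> [_ rx] cy; have cr : eucl_dist c y = r := cy.
    have := eucl_dist_triangle y c x; rewrite cr (eucl_distC y x) => tri.
    by rewrite -(lerD2l r); exact: le_trans rx tri.
  have sub : A n `|` circle c r `<=` boundary Om.
    move=> x [[Ox rx]|cx]; first by apply: bnd => //; rewrite (le_trans _ rx)// lerDl ltW.
    by apply: bnd; [apply: rO; rewrite /eucl_cball/= cx|rewrite cx].
  have := le_trans (hausdorff1_separated n0 sep) (le_hausdorff1 sub).
  rewrite Hr => h; apply/eqP; rewrite eq_le hausdorff1_ge0 andbT.
  have := le_trans (leeD (lexx _) circ) h; rewrite -[leRHS]add0e leeD2rE//.
rewrite (_ : _ `\` _ = \bigcup_n A n); first exact: hausdorff1_null_bigcup.
apply/seteqP; split => x.
  move=> [Ox]; rewrite /eucl_cball/= => /negP; rewrite -ltNge => rx.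
  have d0 : 0 < eucl_dist c x - r by rewrite subr_gt0.
  have [n _ hn] := near_infty_natSinv_lt (PosNum d0).
  by exists n => //; split => //; have := hn n (leqnn n) => /= /ltW; rewrite lerBrDl.
move=> [n _ [Ox rx]]; split => //; apply/negP; rewrite -ltNge.
by apply: lt_le_trans rx; rewrite ltrDl invr_gt0.
Qed.

(** A missing point of the open disc would, [Om] being closed, leave out a
    small ball, which has positive area and therefore is not null for the
    length. *)
Lemma H1_equiv_disc_sub c r : H1_equiv Om (eucl_cball c r) -> disc c r `<=` Om.
Proof.
move=> [_ BO] z cz; apply: contrapT => nz.
have clOm := compact_plane_closed cOm.
have /nbhs_euclP[e e0 he] : nbhs z (~` Om).
  by apply: open_nbhs_nbhs; split => //; exact: closed_openC.
pose q : R := Num.min (e / 2) (r - eucl_dist c z).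
have q0 : 0 < q by rewrite lt_min divr_gt0// subr_gt0.
have qe : q <= e / 2 by rewrite ge_min lexx.
have qr : q <= r - eucl_dist c z by rewrite ge_min lexx orbT.
have sub : eucl_cball z q `<=` eucl_cball c r `\` Om.
  move=> y; rewrite /eucl_cball/= => zy; split.
    by rewrite /=; have := eucl_dist_triangle z c y; lra.
  by apply: he; lra.
have D0 : hausdorff1 (eucl_cball z q) = 0%E.
  by apply/eqP; rewrite eq_le hausdorff1_ge0 andbT -BO; exact: le_hausdorff1.
have := leb2_cball_gt0 z q0; rewrite leb2_hausdorff_null ?ltxx//; first exact: compact_cball.
by rewrite D0 ltry.
Qed.

Lemma H1_equiv_boundary_le c r : 0 < r -> H1_equiv Om (eucl_cball c r) ->
  (hausdorff1 (boundary Om) <= (2 * pi * r)%:E)%E.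
Proof.
move=> r0 eq; have sub := H1_equiv_disc_sub eq; have clOm := compact_plane_closed cOm.
apply: le_trans (le_hausdorff1 (boundary_sub_circle clOm sub)) _.
apply: le_trans (hausdorff1U _ _) _; rewrite eq.1 adde0.
exact: hausdorff1_circle.
Qed.

End Admissible.

Lemma inf_functional_le lambda c r : 0 < lambda -> 0 < r ->
  (inf_functional lambda <= (2 * r / pi * (pi ^+ 2 - lambda))%:E)%E.
Proof.
move=> l0 r0; apply: le_trans (functional_le_disc (c := c) l0 r0 _ _ _).
- by apply: ereal_inf_lbound; exists (eucl_cball c r) => //; exact: admissible_cball.
- exact: compact_cball.
- by move=> x /ltW.
- exact: hausdorff1_cball_boundary.
Qed.

Lemma functional_ge0 lambda Om : 0 < lambda <= lambda0U R -> admissible Om ->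
  (0 <= functional lambda Om)%E.
Proof.
move=> /andP[l0 l1] aOm; apply: le_trans (functional_ge aOm l0).
apply: mule_ge0; first exact: hausdorff1_ge0.
by rewrite lee_fin subr_ge0 ler_pdivrMr ?mul1r// exprn_gt0// pi_gt0.
Qed.

Lemma inf_functional_eq0 lambda : 0 < lambda <= lambda0U R -> inf_functional lambda = 0%E.
Proof.
move=> l01; apply/eqP; rewrite eq_le; apply/andP; split; last first.
  by apply: le_ereal_inf_tmp => _ [Om aOm <-]; exact: functional_ge0.
case/andP: l01 => l0 l1; have pi0 := @pi_gt0 R.
apply/lee_addgt0Pr => d d0; rewrite add0e.
have k0 : 0 < 2 / pi * (pi ^+ 2 - lambda) + 1.
  by rewrite ltr_wpDl// mulr_ge0 ?subr_ge0// divr_ge0// ltW.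
apply: le_trans (inf_functional_le (0, 0) l0 (divr_gt0 d0 k0)) _; rewrite lee_fin.
set k := 2 / pi * _ + 1 in k0 *.
have -> : 2 * (d / k) / pi * (pi ^+ 2 - lambda) = d * ((k - 1) / k).
  by rewrite /k addrK; ring.
rewrite ger_pMr// ler_pdivrMr// mul1r; lra.
Qed.

End Functional.

Theorem theorem2p6 (R : realType) (lambda : R) (lambda_gt0 : 0 < lambda) :
  [/\ (lambda < lambda0U R ->
        inf_functional lambda = 0%E /\
        ~ (exists Omega : set (R * R), minimizer lambda Omega)),
      (lambda = lambda0U R ->
        [/\ inf_functional lambda = 0%E,
            (forall (c : R * R) (r : R), 0 < r ->
              minimizer lambda (eucl_cball c r)) &
            (forall Omega : set (R * R), admissible Omega ->
              (minimizer lambda Omega <->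
               exists (c : R * R) (r : R),
                 0 < r /\ H1_equiv Omega (eucl_cball c r)))]) &
      (lambda0U R < lambda -> inf_functional lambda = -oo%E)].
Proof.
have pi0 := @pi_gt0 R; split.
- move=> ltl; have inf0 : inf_functional lambda = 0%E.
    by apply: inf_functional_eq0; rewrite lambda_gt0 ltW.
  split=> // -[Om [aOm]]; rewrite inf0 => f0.
  have := functional_ge aOm lambda_gt0; rewrite f0; apply/negP; rewrite -ltNge.
  apply: mule_gt0; first exact: hausdorff1_boundary_gt0.
  by rewrite lte_fin subr_gt0 ltr_pdivrMr ?mul1r// exprn_gt0.
- move=> le; have l01 : 0 < lambda <= lambda0U R by rewrite lambda_gt0 le lexx.
  have inf0 := inf_functional_eq0 l01.
  have min_disc Om c r : 0 < r -> admissible Om -> disc c r `<=` Om ->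
      (hausdorff1 (boundary Om) <= (2 * pi * r)%:E)%E -> minimizer lambda Om.
    move=> r0 aOm sub Hr; split => //; rewrite inf0; apply/eqP.
    have cOm : compact Om by case: aOm.
    rewrite eq_le functional_ge0// andbT.
    apply: le_trans (functional_le_disc lambda_gt0 r0 cOm sub Hr) _.
    by rewrite le /lambda0U subrr mulr0.
  split => // [c r r0|Om aOm].
    apply: (min_disc _ c r) => //; first exact: admissible_cball.
      by move=> x /ltW.
    exact: hausdorff1_cball_boundary.
  split=> [[_]|[c [r [r0 eq]]]]; last first.
    by apply: (min_disc _ c r) => //; [exact: (H1_equiv_disc_sub aOm eq)|exact: (H1_equiv_boundary_le aOm r0 eq)].
  rewrite inf0 le => f0.
  have [c [r [r0 Hr Wr sub1 sub2]]] := critical_optimal aOm f0.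
  by exists c, r; split => //; exact: optimal_H1_equiv.
- move=> ltl; case E : (inf_functional lambda) => [x||] //; exfalso.
    have k0 : 0 < 2 / pi * (lambda - pi ^+ 2).
      by rewrite mulr_gt0 ?subr_gt0// divr_gt0.
    have r0 : 0 < (`|x| + 1) / (2 / pi * (lambda - pi ^+ 2)) by rewrite divr_gt0// ltr_wpDl.
    have := inf_functional_le (0, 0) lambda_gt0 r0; rewrite E lee_fin; apply/negP; rewrite -ltNge.
    set k := 2 / pi * _ in k0 r0 *.
    have -> : 2 * ((`|x| + 1) / k) / pi * (pi ^+ 2 - lambda) = - (`|x| + 1).
      transitivity (- ((`|x| + 1) / k * k)); first by rewrite {3}/k; ring.
      by rewrite divfK// gt_eqF.
    by have := ler_norm (- x); rewrite normrN; lra.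
  have := inf_functional_le (0, 0) lambda_gt0 (@ltr01 R); rewrite E.
  by rewrite leye_eq.
Qed.
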